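(* A map $\mu \colon \mathcal{P}^2_o \to \mathbb{R}^2$ is a measurable valuation satisfying $\mu(\phi P) = \phi\,\mu(P)$ for all $P \in \mathcal{P}^2_o$ and all $\phi \in \mathrm{SL}(2)$ if and only if there exist constants $k_1, k_2 \in \mathbb{R}$ such that \[ \mu(P) = k_1\, m(P) + k_2\, \rho_{\frac{\pi}{2}}\, m(P^* ) \quad \text{for all } P \in \mathcal{P}^2_o . \]
   Context: $\mathcal{P}^n_o$ denotes the set of convex polytopes in $\mathbb{R}^n$ containing the origin in their interiors, equipped with the topology of the Hausdorff metric; ''measurable'' means measurable with respect to the Borel $\sigma$-algebras. A map $\mu$ on a family $\mathcal{S}$ of sets is a valuation if $\mu(K \cup L) + \mu(K \cap L) = \mu(K) + \mu(L)$ whenever $K, L, K\cup L, K \cap L \in \mathcal{S}$. The moment vector of $P$ is $m(P) = \int_P x \, dx$. The polar body is $P^* = \{ y \in \mathbb{R}^n : y^t x \leq 1 \text{ for all } x \in P\}$. $\rho_{\frac{\pi}{2}}$ denotes the counter-clockwise rotation of $\mathbb{R}^2$ by the angle $\frac{\pi}{2}$. *)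

(* Defs.v *)
(* Points of R^2 are pairs (R * R), with the product
   (Borel) measurable structure and the product Lebesgue measure. *)
From HB Require Import structures.
From mathcomp Require Import all_boot all_order all_algebra.
From mathcomp Require Import all_classical all_reals all_analysis.
Set Implicit Arguments. Unset Strict Implicit. Unset Printing Implicit Defensive.
Import Order.TTheory GRing.Theory Num.Theory.
Import numFieldNormedType.Exports.
Local Open Scope classical_set_scope.
Local Open Scope ring_scope.

Section Defs.
Variable R : realType.
Notation pt := (R * R)%type.

Definition dot (x y : pt) : R := x.1 * y.1 + x.2 * y.2.
Definition edist (x y : pt) : R := Num.sqrt ((x.1 - y.1) ^+ 2 + (x.2 - y.2) ^+ 2).

Definition conv_hull (s : seq pt) : set pt :=
  [set x | exists w : 'I_(size s) -> R,
      (forall i, 0 <= w i) /\ \sum_(i < size s) w i = 1 /\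
      x = (\sum_(i < size s) w i * (nth (0,0) s i).1,
           \sum_(i < size s) w i * (nth (0,0) s i).2)].

Definition is_polytope (P : set pt) : Prop := exists s : seq pt, P = conv_hull s.

Definition origin_interior (P : set pt) : Prop :=
  exists e : R, 0 < e /\ forall x : pt, edist x (0, 0) < e -> P x.

Definition Po : set (set pt) := [set P | is_polytope P /\ origin_interior P].

Definition dist_to (x : pt) (L : set pt) : R := inf [set edist x y | y in L].
Definition hausdorff (K L : set pt) : R :=
  Num.max (sup [set dist_to x L | x in K]) (sup [set dist_to y K | y in L]).

Definition hausdorff_open (U : set (set pt)) : Prop :=
  U `<=` Po /\
  forall P, U P -> exists e : R, 0 < e /\
     forall Q, Po Q -> hausdorff P Q < e -> U Q.

Definition Po_borel : set (set (set pt)) := <<s Po, hausdorff_open >>.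

Definition Po_measurable (mu : set pt -> pt) : Prop :=
  forall B : set pt, measurable B -> Po_borel (Po `&` mu @^-1` B).

Definition vadd (x y : pt) : pt := (x.1 + y.1, x.2 + y.2).
Definition vscale (k : R) (x : pt) : pt := (k * x.1, k * x.2).

Definition is_valuation (mu : set pt -> pt) : Prop :=
  forall K L, Po K -> Po L -> Po (K `|` L) -> Po (K `&` L) ->
    vadd (mu (K `|` L)) (mu (K `&` L)) = vadd (mu K) (mu L).

Definition mxact (A : 'M[R]_2) (x : pt) : pt :=
  (A ord0 ord0 * x.1 + A ord0 ord_max * x.2,
   A ord_max ord0 * x.1 + A ord_max ord_max * x.2).

Definition SL2_covariant (mu : set pt -> pt) : Prop :=
  forall (A : 'M[R]_2) P, \det A = 1 -> Po P ->
    mu (mxact A @` P) = mxact A (mu P).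

Definition leb2 := (@lebesgue_measure R \x @lebesgue_measure R)%E.

Definition moment (P : set pt) : pt :=
  (Rintegral leb2 P (fun x => x.1), Rintegral leb2 P (fun x => x.2)).

Definition polar (P : set pt) : set pt := [set y | forall x, P x -> dot y x <= 1].

Definition rot90 (x : pt) : pt := (- x.2, x.1).

End Defs.

(* Main.v *)
Require Import Defs.
From HB Require Import structures.
From mathcomp Require Import all_boot all_order all_algebra.
From mathcomp Require Import ring lra.
From mathcomp Require Import all_classical all_reals all_analysis.
From mathcomp Require Import measurable_realfun.
Set Implicit Arguments. Unset Strict Implicit. Unset Printing Implicit Defensive.
Import Order.TTheory GRing.Theory Num.Theory.
Import numFieldNormedType.Exports.
Local Open Scope classical_set_scope.
Local Open Scope ring_scope.

(** Let [a], [v], [b] be consecutive vertices of a polygon. Cutting off the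
    triangle [a v b] changes a valuation by an amount depending only on the
    triangle; by SL(2)-covariance it is [(f a + g b) / r] with [f] and [g]
    functions of the three determinants [p = det(a, v)], [q = det(v, b)] and
    [r = det(a, b)], and it determines the valuation: any two polygons are
    joined by successive cuts to their intersection, and [-1] acts on the
    values. Cutting the triangle in two gives cocycle equations for [f], [g].
    On the planes [p = r] and [q = r] these reduce to Cauchy's equation (the
    only place where measurability is used), so that [f] and [g] are described
    there by two profiles [l] and [l'] of the single variable [r]. Comparing
    different cuts of one triangle forces [l + l'] and [r^3 (l - l')] to be
    constant, and [f = g = 0] when both profiles vanish. Hence the valuations
    in question form a space of dimension at most 2, in which the moment of [P]
    and the rotated moment of its polar are independent, being homogeneous of
    degrees 3 and -3. *)

(** * The functional equations *)

(** The equations are never solved, and no value on a triangle is ever computed. Both are replaced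
    by rigidity: an admissible valuation is determined by its value, a single vector of the plane,
    on the corner whose three determinants equal 1. For a combination of the two moments this turns
    a linear relation between their values on that corner into a relation on all polygons, which the
    different degrees exclude; Cramer's rule then expresses the value of [mu] on the corner through
    theirs.

    The exponents 0 and 3 are those of the expected solutions. A dilation by [t] multiplies
    determinants by [t^2], so that a valuation homogeneous of degree [d] has profiles homogeneous of
    degree [(d - 3) / 2] in [r]: 0 for the moment, -3 for the rotated polar moment. Exchanging [f]
    and [g] reflects the plane and swaps the profiles, whence the separate treatment of [l + l'] and
    [l - l'].

    The obstacle is that the pieces of a corner mostly lie off the two planes where [f] and [g] are
    known. The cuts are chosen so that the unknown pieces coincide and can be eliminated. *)

Section FunctionalEquation.
Variable R : realFieldType.
Implicit Types (f g : R -> R -> R -> R) (p q r s A : R).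

(* The cocycle equations of the header: the corner [a], [v], [b] with
   determinants [p1 + p2], [q], [r] is cut by the line through [b] and a point
   [c] of [av], where [p1 = det(a, c)], [p2 = det(c, v)] and [s = det(c, b)]. *)
Definition cut_additive f g := forall p1 p2 q r s,
  0 < p1 -> 0 < p2 -> 0 < q -> 0 < r -> 0 < s -> r < p1 + p2 + q ->
  s * (p1 + p2) = r * p2 + q * p1 ->
  f (p1 + p2) q r = f p2 q s + f p1 s r /\
  s * g (p1 + p2) q r = r * g p2 q s + s * g p1 s r + p1 * f p2 q s.

(* A cut through [a] and a point of [vb] gives the same equations for the
   mirror images, with the roles of [f] and [g] exchanged. *)
Definition mirror f := fun p q r => f q p r.

Section Vanish.
Variables f g : R -> R -> R -> R.
Hypothesis fg : cut_additive f g.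
Hypothesis fp : forall p r, 0 < p -> 0 < r -> f r p r = 0.
Hypothesis fq : forall p r, 0 < p -> 0 < r -> f p r r = 0.
Hypothesis gp : forall p r, 0 < p -> 0 < r -> g r p r = 0.
Hypothesis gq : forall p r, 0 < p -> 0 < r -> g p r r = 0.

(** The corner with determinants [(p + q, A q, r)] has two cuts for which one piece lies in the
    plane [p = r], where [f] and [g] vanish. The other piece is [(p, q, r)] for the first cut and
    its dilate by [A] for the second; the condition on [A] makes both belong to the same corner. *)
Lemma dilate_cut p q r A : 0 < p -> 0 < q -> 0 < r -> r < p + q -> A * p = p + q - r ->
  f (A * p) (A * q) (A * r) = f p q r /\
  g (A * p) (A * q) (A * r) = A * g p q r - f p q r.
Proof.
move=> p0 q0 r0 rpq Ap.
have A0 : 0 < A by rewrite -(pmulr_lgt0 _ p0) Ap; lra.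
have Aq0 : 0 < A * q by exact: mulr_gt0.
have Ar0 : 0 < A * r by exact: mulr_gt0.
have lt1 : r < p + q + A * q by lra.
have [] := fg p0 q0 Aq0 r0 q0 lt1; first by have -> : A * q * p = q * (A * p) by [ring]; rewrite Ap; ring.
rewrite fp // gp // mulr0 mulr0 !add0r addr0 => e1 /(mulfI (lt0r_neq0 q0)) e2.
have Ap0 : 0 < A * p by exact: mulr_gt0.
have pq : r + A * p = p + q by rewrite Ap; ring.
have lt2 : r < r + A * p + A * q by lra.
have [] := fg r0 Ap0 Aq0 r0 Ar0 lt2.
  by rewrite pq; ring.
rewrite pq e1 e2 fp // gp // addr0 mulr0 addr0 => <-.
move=> e3; split=> //; apply/(mulfI (lt0r_neq0 r0)).
have -> : r * (A * g p q r - f p q r) = A * r * g p q r - r * f p q r by [ring].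
by rewrite e3; ring.
Qed.
End Vanish.

(** [A] and [B] depend only on the ratios of [p], [q], [r], so the dilations by [A] and by [B] can
    be performed in either order. They turn [(f, g)] into [(f, A g - f)] and [(B f - g, g)];
    equating the two orders gives [f = (A - 1) g] and [g = (B - 1) f]. *)
Lemma vanish f g : cut_additive f g -> cut_additive (mirror g) (mirror f) ->
  (forall p r, 0 < p -> 0 < r -> f r p r = 0) ->
  (forall p r, 0 < p -> 0 < r -> f p r r = 0) ->
  (forall p r, 0 < p -> 0 < r -> g r p r = 0) ->
  (forall p r, 0 < p -> 0 < r -> g p r r = 0) ->
  forall p q r, 0 < p -> 0 < q -> 0 < r -> r < p + q -> f p q r = 0 /\ g p q r = 0.
Proof.
move=> fg gf fp fq gp gq p q r p0 q0 r0 rpq.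
pose A := (p + q - r) / p; pose B := (p + q - r) / q.
have Ap : A * p = p + q - r by rewrite /A divfK // lt0r_neq0.
have Bq : B * q = p + q - r by rewrite /B divfK // lt0r_neq0.
have A0 : 0 < A by rewrite -(pmulr_lgt0 _ p0) Ap; lra.
have B0 : 0 < B by rewrite -(pmulr_lgt0 _ q0) Bq; lra.
have dA := dilate_cut fg fp gp.
have dB p' q' r' B' p0' q0' r0' rpq' Bq' :=
  @dilate_cut (mirror g) (mirror f) gf gq fq q' p' r' B' q0' p0' r0' rpq' Bq'.
rewrite /mirror in dB.
have [fA gA] := dA _ _ _ _ p0 q0 r0 rpq Ap.
have qp : q + p = p + q by rewrite addrC.
have [] := dB p q r B p0 q0 r0; [lra|lra|move=> gB fB].
have [] := dA (B * p) (B * q) (B * r) A; try exact: mulr_gt0.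
- by rewrite -mulrDr ltr_pM2l.
- by rewrite mulrCA Ap; ring.
move=> fAB gAB; have [] := dB (A * p) (A * q) (A * r) B; try exact: mulr_gt0.
- by rewrite -mulrDr ltr_pM2l // qp.
- by rewrite mulrCA Bq; ring.
rewrite !(mulrCA B A) => gBA fBA.
have e1 : f p q r = (A - 1) * g p q r by rewrite fBA fA gA fB in fAB; lra.
have e2 : g p q r = (B - 1) * f p q r by rewrite gBA gA gB fB in gAB; lra.
have : f p q r * (1 - (A - 1) * (B - 1)) = 0.
  by rewrite {1}e1 {1}e2 mulrBr mulr1 {1}e1 e2; ring.
move/eqP; rewrite mulf_eq0 => /orP[/eqP f0|]; first by rewrite e2 f0 mulr0.
(* The strict inequality [r < p + q] excludes [(A - 1) * (B - 1) = 1], the only case with a nonzero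
   solution. *)
have -> : 1 - (A - 1) * (B - 1) = r * (p + q - r) / (p * q).
  by rewrite /A /B; field; rewrite !lt0r_neq0.
rewrite gt_eqF // divr_gt0 ?mulr_gt0 //; lra.
Qed.

(** On each plane one of the functions is linear by Cauchy's equation and the other is then
    quadratic. Its linear coefficient involves both profiles because the planes meet at the points
    [(r, r, r)]. For the moment, [l] and [l'] are the constant 1/3. *)
Definition profile f g (l l' : R -> R) :=
  (forall q r, 0 < q -> 0 < r ->
     f r q r = q * (l r * (q - r) / 2 + r * l' r) /\ g r q r = r * q * l r) /\
  (forall p r, 0 < p -> 0 < r ->
     g p r r = p * (l' r * (p - r) / 2 + r * l r) /\ f p r r = r * p * l' r).

(** Reduces a linear consequence of two equations to a [field] identity, once the multipliers [c]
    and [d] are supplied. *)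
Let lin_comb2 (c d x y u v w z : R) : u = v -> w = z ->
  x - y = c * (u - v) + d * (w - z) -> x = y.
Proof. by move=> -> ->; rewrite !subrr !mulr0 addr0 => /eqP; rewrite subr_eq0 => /eqP. Qed.

Let eq_mul_solve (A x y z t : R) : A != 0 -> A * x = y + A * t + z -> t = x - (y + z) / A.
Proof. by move=> A0 e; apply/(mulfI A0); rewrite mulrBr e; field. Qed.

(* The values at [p = r + A r], [q = A^2 r] are reached by three different
   cuts; in the last two they involve [f] and [g] off the planes [p = r] and
   [q = r], at arguments that differ by the dilation [r |-> b]. *)
Section Profile.
Variables (f g : R -> R -> R -> R) (l l' : R -> R).
Hypotheses (fg : cut_additive f g) (gf : cut_additive (mirror g) (mirror f)).
Hypothesis fgl : profile f g l l'.

(** The cut with [s = A r] leaves two pieces in the plane [p = r], so the profiles suffice. *)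
Let X_value A r : 0 < A -> 0 < r ->
  f (r + A * r) (A ^+ 2 * r) r =
    A ^+ 2 * r * (l (A * r) * (A ^+ 2 * r - A * r) / 2 + A * r * l' (A * r)) +
    A * r * (l r * (A * r - r) / 2 + r * l' r) /\
  g (r + A * r) (A ^+ 2 * r) r =
    A ^+ 2 * r * r * l (A * r) + r * (A * r) * l r +
    A * r * (l (A * r) * (A ^+ 2 * r - A * r) / 2 + A * r * l' (A * r)).
Proof.
move=> A0 r0.
have A1 : 0 < A * r by exact: mulr_gt0.
have A2 : 0 < A ^+ 2 * r by rewrite mulr_gt0 ?exprn_gt0.
have [] := fg r0 A1 A2 r0 A1; [lra|ring|].
have [fe1 ge1] := fgl.1 _ _ A2 A1; have [fe2 ge2] := fgl.1 _ _ A1 r0.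
rewrite fe1 fe2 ge1 ge2 => -> e; split=> //.
by apply/(mulfI (lt0r_neq0 A1)); rewrite e; field.
Qed.

(** The mirror cut with [s = A r] leaves one piece in the plane [q = r] and one piece off both
    planes. *)
Let Y_value A r : 1 < A -> 0 < r ->
  g (r + A * r) (A ^+ 2 * r) r =
    g (r + A * r) (A * r) (A * r) + g (A * r) (A * (A - 1) * r) r /\
  A * f (r + A * r) (A ^+ 2 * r) r =
    f (r + A * r) (A * r) (A * r) + A * f (A * r) (A * (A - 1) * r) r
    + A * (A - 1) * g (r + A * r) (A * r) (A * r).
Proof.
move=> A1 r0; have A0 : 0 < A by lra.
have Ar : 0 < A * r by exact: mulr_gt0.
have q0 : 0 < A * (A - 1) * r by rewrite !mulr_gt0 ?subr_gt0.
have p0 : 0 < r + A * r by lra.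
have [] := gf q0 Ar p0 r0 Ar; [lra|ring|rewrite /mirror].
have -> : A * (A - 1) * r + A * r = A ^+ 2 * r by ring.
move=> -> e; split=> //.
by apply/(mulfI (lt0r_neq0 r0)); move: e; rewrite mulrA (mulrC r A) => ->; ring.
Qed.

(** The mirror cut with [s = b]. Since [A b = r + A r], the piece off the planes is the one of
    [Y_value] with [b] in place of [r]. *)
Let XY_value A r b : 1 < A -> 0 < r -> A * b = r + A * r ->
  g (r + A * r) (A ^+ 2 * r) r = g (A * b) (A * (A - 1) * b) b + g b r r /\
  b * f (r + A * r) (A ^+ 2 * r) r =
    r * f (A * b) (A * (A - 1) * b) b + b * f b r r
    + r * g (A * b) (A * (A - 1) * b) b.
Proof.
move=> A1 r0 Ab; have A0 : 0 < A by lra.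
have Ar : 0 < A * r by exact: mulr_gt0.
have b0 : 0 < b by rewrite -(pmulr_rgt0 _ A0) Ab; lra.
have q0 : 0 < A * (A - 1) * b by rewrite !mulr_gt0 ?subr_gt0.
have qE : A * (A - 1) * b = A ^+ 2 * r - r.
  by have -> : A * (A - 1) * b = (A - 1) * (A * b) by [ring]; rewrite Ab; ring.
have p0 : 0 < r + A * r by lra.
have [] := gf r0 q0 p0 r0 b0; first lra.
  rewrite qE; have -> : b * (r + (A ^+ 2 * r - r)) = A * r * (A * b) by ring.
  by rewrite Ab; ring.
rewrite /mirror.
have -> : r + A * (A - 1) * b = A ^+ 2 * r by rewrite qE; ring.
by rewrite Ab.
Qed.

(** [X_value] and [Y_value] at [b] determine the values off the planes; substituted into [XY_value]
    at [r], they leave two relations between the profiles at [r], [A r], [b] and [r + A r]. *)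
Lemma profile_equations A r b : 1 < A -> 0 < r -> A * b = r + A * r ->
  A ^+ 3 * ((A + 1) / 2 * l (A * r) + l' (A * r)) + (A ^+ 2 - A - 1) * l r
    - (A + 1) / (2 * A) * l' r =
  (A + 1) ^+ 2 * (l b + (A + 1) * (A - 2) / 2 * l (r + A * r)
                  + (2 * A + 1) * (A - 1) / (2 * A) * l' (r + A * r)) /\
  A ^+ 2 * l (A * r) + ((A + 1) / 2 - (A + 1) / A) * l r
    + ((A + 1) / (2 * A ^+ 2) - 1) * l' r =
  (A + 1) / A * ((A + 1) / 2 * l b - l' b + (A ^+ 2 - A - 1) * l (r + A * r)
                 + (A + 1) / (2 * A) * l' (r + A * r)).
Proof.
move=> A1 r0 Ab; have A0 : 0 < A by lra.
have b0 : 0 < b by rewrite -(pmulr_rgt0 _ A0) Ab ltr_wpDl ?ltW ?mulr_gt0.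
have Ab0 : 0 < A * b by exact: mulr_gt0.
have Cb0 : 0 < b + A * b by exact: addr_gt0.
have [fX gX] := X_value A0 r0; have [fXb gXb] := X_value A0 b0.
have [] := Y_value A1 b0; have [] := XY_value A1 r0 Ab.
have [-> ->] := fgl.2 _ _ Cb0 Ab0; have [-> ->] := fgl.2 _ _ b0 r0.
rewrite gX fX gXb fXb.
move: (g (A * b) _ b) (f (A * b) _ b) => gY fY eg ef egY efY.
have bE : b = (r + A * r) / A by rewrite -Ab (mulrC A) mulfK // lt0r_neq0.
move: eg ef egY efY; rewrite Ab.
move: (l r) (l' r) (l (A * r)) (l' (A * r)) (l b) (l' b)
      (l (r + A * r)) (l' (r + A * r)) => l0 m0 l1 m1 l2 m2 l3 m3.
rewrite {b Ab b0 Ab0 Cb0 fX gX fXb gXb}bE.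
have rN := lt0r_neq0 r0; have AN := lt0r_neq0 A0.
have CN : A + 1 != 0 by rewrite lt0r_neq0 //; lra.
move=> eg ef egY efY.
have {egY}gYE := canRL (addKr _) (esym egY).
have {efY}fYE := eq_mul_solve AN efY.
subst gY fY; split.
  apply: (lin_comb2 (c := A / r ^+ 2) (d := 0) eg ef); field; rewrite ?rN ?AN ?CN //.
apply: (lin_comb2 (c := r ^- 2) (d := - (r ^+ 3 * (A + 1)) ^-1) eg ef); field.
by rewrite ?rN ?AN ?CN.
Qed.
End Profile.

Section Ratio.
Variables (a c : R -> R) (h : R -> R).
Hypothesis ac : forall A r, 1 < A -> 0 < r ->
  c A * (h ((A + 1) * r) - h r) = a A * (h (A * r) - h r).

(* The relation at [(A, r)], [(2A, r)] and [(2A + 1, r)] only involves the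
   values of [h] at [r], [A r], [(A + 1) r] and [(2A + 1) r], once doubling is
   known to preserve [h]. *)
Lemma constant_of_doubling :
  (forall r, 0 < r -> h (2 * r) = h r) ->
  (forall A, 2 <= A ->
     a A * c (2 * A) * c (2 * A + 1) - c A * a (2 * A + 1) * a (2 * A) != 0) ->
  forall A r, 1 < A -> 0 < r -> h (A * r) = h r.
Proof.
move=> h2 nz.
have big A r : 2 <= A -> 0 < r -> h (A * r) = h r.
  move=> A2 r0; have A1 : 1 < A by lra.
  have e1 := ac A1 r0.
  have A21 : 1 < 2 * A by lra.
  have A211 : 1 < 2 * A + 1 by lra.
  have e2 := ac A21 r0; have e3 := ac A211 r0.
  have Ar : 0 < A * r by rewrite mulr_gt0 //; lra.
  have A1r : 0 < (A + 1) * r by rewrite mulr_gt0 //; lra.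
  have E1 : 2 * A * r = 2 * (A * r) by ring.
  have E2 : (2 * A + 1 + 1) * r = 2 * ((A + 1) * r) by ring.
  rewrite E1 h2 // in e2; rewrite E2 h2 // in e3.
  apply/eqP; rewrite -subr_eq0; apply/eqP; apply: (mulfI (nz _ A2)); rewrite mulr0.
  move: e1 e2 e3; set x := h _ - _; set y := h (A * r) - _; set z := h _ - _ => e1 e2 e3.
  have -> : (a A * c (2 * A) * c (2 * A + 1) - c A * a (2 * A + 1) * a (2 * A)) * y
    = c (2 * A) * c (2 * A + 1) * (a A * y) - c A * a (2 * A + 1) * (a (2 * A) * y)
    by ring.
  rewrite -e1 -e2.
  have -> : c (2 * A) * c (2 * A + 1) * (c A * x) = c (2 * A) * c A * (c (2 * A + 1) * x)
    by ring.
  by rewrite e3; ring.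
move=> A r A1 r0.
have r2 : 0 < 2 ^-1 * r by rewrite mulr_gt0 ?invr_gt0.
(* Ratios below 2 are reached from [r / 2] with the ratio [2 A], which is covered by [big]. *)
have -> : A * r = 2 * A * (2 ^-1 * r) by field.
have {2}-> : r = 2 * (2 ^-1 * r) by field.
rewrite big ?h2 //; lra.
Qed.

End Ratio.

(** Each relation added to its mirror image involves only [l + l']. The multipliers [2 B (B - 1)]
    and [- 4 B^2 (B + 1)] cancel the value at [b], and what remains has the form required by
    [constant_of_doubling]. *)
Lemma profile_sum_constant f g l l' A r : cut_additive f g ->
  cut_additive (mirror g) (mirror f) -> profile f g l l' -> 1 < A -> 0 < r ->
  l (A * r) + l' (A * r) = l r + l' r.
Proof.
move=> fg gf fgl.
have lfg : profile (mirror g) (mirror f) l' l by case: fgl.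
pose a A : R := A ^+ 4 * (7 + 2 * A - A ^+ 2).
pose c A : R := - (A + 1) ^+ 3 * (A - 1) * (A ^+ 2 - 4 * A + 1).
pose h r := l r + l' r.
have ac B t : 1 < B -> 0 < t ->
    c B * (h ((B + 1) * t) - h t) = a B * (h (B * t) - h t).
  move=> B1 t0; have B0 : B != 0 by rewrite lt0r_neq0 //; lra.
  have Bb : B * ((t + B * t) / B) = t + B * t by rewrite mulrC divfK.
  have [K L] := profile_equations fg gf fgl B1 t0 Bb.
  have [K' L'] := profile_equations gf fg lfg B1 t0 Bb.
  have -> : (B + 1) * t = t + B * t by ring.
  rewrite /h /a /c.
  apply: (lin_comb2 (c := 2 * B * (B - 1)) (d := - 4 * B ^+ 2 * (B + 1))
           (congr2 +%R K K') (congr2 +%R L L')); field; exact: B0.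
apply: (constant_of_doubling ac) => [t t0|B B2].
  (* Five homogeneous equations for the five differences [h (i t) - h t] with [i] from 2 to 6; the
     one at [(2, 2 t)] closes the system. *)
  have n2 := ac 2 t ltac:(lra) t0.
  have n3 := ac 3 t ltac:(lra) t0.
  have n4 := ac 5 t ltac:(lra) t0.
  have n5 := ac 4 t ltac:(lra) t0.
  have t2 : 0 < 2 * t by lra.
  have n22 := ac 2 (2 * t) ltac:(lra) t2.
  move: n2 n3 n4 n5 n22; rewrite /a /c.
  have -> : (2 + 1) * t = 3 * t by ring.
  have -> : (3 + 1) * t = 4 * t by ring.
  have -> : (5 + 1) * t = 6 * t by ring.
  have -> : (4 + 1) * t = 5 * t by ring.
  have -> : (2 + 1) * (2 * t) = 6 * t by ring.
  have -> : 2 * (2 * t) = 4 * t by ring.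
  move: (h t) (h (2 * t)) (h (3 * t)) (h (4 * t)) (h (5 * t)) (h (6 * t)).
  by move=> *; lra.
rewrite /a /c.
(* After powers of [B], [B + 1] and [2 B + 1] are factored out, the determinant has positive
   coefficients in [u]. *)
pose u := B - 2; have u0 : 0 <= u by rewrite /u; lra.
have BE : B = 2 + u by rewrite /u; ring.
rewrite lt0r_neq0 //.
suff : 0 < 32 * B ^+ 4 * (B + 1) ^+ 3 * (2 * B + 1) ^+ 3 *
         (66 + 447 * u + 806 * u ^+ 2 + 499 * u ^+ 3 + 98 * u ^+ 4).
  by congr (0 < _); rewrite BE; ring.
have B0 : 0 < B by lra.
have [B1 B21] : 0 < B + 1 /\ 0 < 2 * B + 1 by split; lra.
have [u2 u3 u4] := And3 (exprn_ge0 2 u0) (exprn_ge0 3 u0) (exprn_ge0 4 u0).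
apply: mulr_gt0; last lra.
by do 3 (apply: mulr_gt0 => //; last exact: exprn_gt0).
Qed.

(** The same elimination of [b] for each relation minus its mirror image. The weight [r^3]
    compensates the degree -3 of the profiles of the polar moment, so that [h] should be
    constant. *)
Lemma profile_diff_constant f g l l' A r : cut_additive f g ->
  cut_additive (mirror g) (mirror f) -> profile f g l l' -> 1 < A -> 0 < r ->
  (A * r) ^+ 3 * (l (A * r) - l' (A * r)) = r ^+ 3 * (l r - l' r).
Proof.
move=> fg gf fgl.
have lfg : profile (mirror g) (mirror f) l' l by case: fgl.
pose a A : R := A * (7 + 2 * A - A ^+ 2).
pose c A : R := - (A + 1) * (A - 5) * (A - 1).
pose h r := r ^+ 3 * (l r - l' r).
have ac B t : 1 < B -> 0 < t ->
    c B * (h ((B + 1) * t) - h t) = a B * (h (B * t) - h t).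
  move=> B1 t0; have B0 : B != 0 by rewrite lt0r_neq0 //; lra.
  have Bb : B * ((t + B * t) / B) = t + B * t by rewrite mulrC divfK.
  have [K L] := profile_equations fg gf fgl B1 t0 Bb.
  have [K' L'] := profile_equations gf fg lfg B1 t0 Bb.
  have -> : (B + 1) * t = t + B * t by ring.
  rewrite /h /a /c.
  apply: (lin_comb2 (c := 2 * B * (B + 3) * t ^+ 3) (d := - 4 * B ^+ 2 * (B + 1) * t ^+ 3)
           (congr2 (fun x y => x - y) K K') (congr2 (fun x y => x - y) L L'));
    field; exact: B0.
apply: (constant_of_doubling ac) => [t t0|B B2].
  (* Here [c 5 = 0], so the relation at 5 says [h (5 t) = h t]; those at 4, 3 and 2 carry this
     equality down to [h (2 t)]. *)
  have n2 := ac 2 t ltac:(lra) t0.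
  have n3 := ac 3 t ltac:(lra) t0.
  have n4 := ac 5 t ltac:(lra) t0.
  have n5 := ac 4 t ltac:(lra) t0.
  move: n2 n3 n4 n5; rewrite /a /c.
  have -> : (2 + 1) * t = 3 * t by ring.
  have -> : (3 + 1) * t = 4 * t by ring.
  have -> : (4 + 1) * t = 5 * t by ring.
  move: (h t) (h (2 * t)) (h (3 * t)) (h (4 * t)) (h (5 * t)) (h ((5 + 1) * t)).
  by move=> *; lra.
rewrite /a /c.
pose u := B - 2; have u0 : 0 <= u by rewrite /u; lra.
have BE : B = 2 + u by rewrite /u; ring.
(* This time it is the opposite of the determinant that has positive coefficients in [u]. *)
rewrite ltr0_neq0 // -oppr_gt0.
suff : 0 < 16 * (90 + 2061 * u + 5120 * u ^+ 2 + 5624 * u ^+ 3 + 3310 * u ^+ 4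
         + 1075 * u ^+ 5 + 180 * u ^+ 6 + 12 * u ^+ 7).
  by congr (0 < _); rewrite BE; ring.
have [u2 u3 u4] := And3 (exprn_ge0 2 u0) (exprn_ge0 3 u0) (exprn_ge0 4 u0).
have [u5 u6 u7] := And3 (exprn_ge0 5 u0) (exprn_ge0 6 u0) (exprn_ge0 7 u0); lra.
Qed.

(** The point [(1, 1, 1)] lies on both planes, so the values of [f] and [g] there are those of both
    profiles at 1. They fix the two constants, hence both profiles vanish everywhere. *)
Lemma profile_rigidity f g l l' : cut_additive f g ->
  cut_additive (mirror g) (mirror f) -> profile f g l l' ->
  f 1 1 1 = 0 -> g 1 1 1 = 0 ->
  forall p q r, 0 < p -> 0 < q -> 0 < r -> r < p + q -> f p q r = 0 /\ g p q r = 0.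
Proof.
move=> fg gf fgl f1 g1.
have [/(_ 1 1 ltr01 ltr01)[_ l1] /(_ 1 1 ltr01 ltr01)[_ m1]] := fgl.
rewrite g1 !mul1r in l1; rewrite f1 !mul1r in m1.
have lm0 r : 0 < r -> l r = 0 /\ l' r = 0.
  move=> r0; suff [] : l r + l' r = 0 /\ r ^+ 3 * (l r - l' r) = 0.
    move=> s /eqP; rewrite mulf_eq0 expf_eq0 /= gt_eqF //= => /eqP d; split; lra.
  have sumc := profile_sum_constant fg gf fgl; have diffc := profile_diff_constant fg gf fgl.
  have [r1|r1|<-] := ltgtP 1 r; last by rewrite -l1 -m1; split; ring.
    have := (sumc r 1 r1 ltr01, diffc r 1 r1 ltr01).
    by rewrite mulr1 -l1 -m1 => -[-> ->]; split; ring.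
  have rV : 1 < r^-1 by rewrite invf_gt1.
  have := (sumc _ _ rV r0, diffc _ _ rV r0).
  by rewrite mulVf ?lt0r_neq0 // -l1 -m1 => -[<- <-]; split; ring.
apply: vanish => // x r x0 r0; have [l0 m0] := lm0 r r0.
- by have [-> _] := fgl.1 _ _ x0 r0; rewrite l0 m0; ring.
- by have [_ ->] := fgl.2 _ _ x0 r0; rewrite m0; ring.
- by have [_ ->] := fgl.1 _ _ x0 r0; rewrite l0; ring.
- by have [-> _] := fgl.2 _ _ x0 r0; rewrite l0 m0; ring.
Qed.

End FunctionalEquation.

(** * Polytopes around the origin *)

Lemma seq_argmax (R : realType) (T : eqType) (f : T -> R) (s : seq T) : s != [::] ->
  exists2 v, v \in s & forall u, u \in s -> f u <= f v.
Proof.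
elim: s => [//|v s IH _]; have [->|/IH[w ws wmax]] := eqVneq s [::].
  by exists v => [|u]; rewrite ?mem_head // inE => /eqP->.
have [vw|/ltW wv] := leP (f v) (f w).
  exists w => [|z]; first by rewrite inE ws orbT.
  by rewrite inE => /predU1P[->//|/wmax].
exists v => [|z]; first exact: mem_head.
by rewrite inE => /predU1P[->//|/wmax/le_trans]; apply.
Qed.

(** Supplies the decreasing measure of the induction in [valuation_cut]. *)
Lemma count_lt (T : eqType) (p q : pred T) (s : seq T) (v : T) :
  {in s, forall x, p x -> q x} -> v \in s -> q v -> ~~ p v -> (count p s < count q s)%N.
Proof.
elim: s => [//|u s IH] pq vs qv pv /=.
have {}IH := IH (fun x xs => pq x (mem_behead (s := u :: s) xs)).
have pqu : (p u <= q u)%N by case: (p u) (pq u (mem_head _ _)) => // ->.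
move: vs; rewrite inE => /predU1P[<-|vs]; last by rewrite -addnS leq_add // IH.
rewrite qv (negPf pv) add0n add1n ltnS.
elim: s pq {IH pqu} => [//|w s IH] pq /=.
have pqw : (p w <= q w)%N by case: (p w) (pq w) => // -> //; rewrite !inE eqxx orbT.
rewrite leq_add // IH // => x; rewrite inE => /predU1P[->|xs]; apply: pq.
  exact: mem_head.
by rewrite !inE xs !orbT.
Qed.

Section Polytopes.
Variable R : realType.
Local Notation pt := (R * R)%type.
Implicit Types (s ys zs : seq pt) (x y v : pt) (P Q K L : set pt) (c t M : R).

Lemma dotC x y : dot x y = dot y x.
Proof. by rewrite /dot mulrC [x.2 * _]mulrC. Qed.

(* [(x, t)] is a nonnegative combination of the vectors [(v, 1)], [v \in s]. *)
Fixpoint cone s x t : Prop := match s with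
  | [::] => x = (0, 0) /\ t = 0
  | v :: s' => exists a, 0 <= a /\ cone s' (x.1 - a * v.1, x.2 - a * v.2) (t - a)
  end.

Lemma coneP s x t : cone s x t <-> exists w : 'I_(size s) -> R,
  (forall i, 0 <= w i) /\ \sum_(i < size s) w i = t /\
  x = (\sum_(i < size s) w i * (nth (0, 0) s i).1,
       \sum_(i < size s) w i * (nth (0, 0) s i).2).
Proof.
elim: s x t => [|v s IH] x t /=.
  split=> [[-> ->]|[w [_ []]]]; last by rewrite !big_ord0.
  by exists (fun=> 0); rewrite !big_ord0.
split=> [[a [a0 /IH[w [w0 [wt [x1 x2]]]]]]|[w [w0 [wt ->]]]].
  exists (fun i => oapp w a (unlift ord0 i)); split=> [i|].
    by case: unliftP => [j|] _ /=; [exact: w0|exact: a0].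
  rewrite !big_ord_recl unlift_none /=.
  split; first by under eq_bigr do rewrite liftK; rewrite wt addrC subrK.
  rewrite [x]surjective_pairing; congr pair.
    by under eq_bigr do rewrite liftK; rewrite -x1 addrC subrK.
  by under eq_bigr do rewrite liftK; rewrite -x2 addrC subrK.
exists (w ord0); split=> //; apply/IH; exists (fun i => w (lift ord0 i)).
split=> //; rewrite -wt !big_ord_recl /=.
by split; [|congr pair]; rewrite addrAC subrr add0r.
Qed.

Lemma conv_hullP s x : conv_hull s x <-> cone s x 1.
Proof. exact: iff_sym (coneP s x 1). Qed.

Lemma cone0 s : cone s (0, 0) 0.
Proof. by elim: s => [|v s IH] //=; exists 0; rewrite !mul0r !subr0. Qed.

Lemma cone_mem s v : v \in s -> cone s v 1.
Proof.
elim: s => [|u s IH] //=; rewrite inE => /predU1P[->|/IH vs].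
  by exists 1; rewrite ler01 !mul1r !subrr; split=> //; exact: cone0.
by exists 0; rewrite !mul0r !subr0 lexx -surjective_pairing.
Qed.

Lemma cone_le s y c x t : (forall v, v \in s -> dot y v <= c) -> cone s x t ->
  dot y x <= c * t.
Proof.
elim: s x t => [|v s IH] x t yc /=.
  by move=> [-> ->]; rewrite /dot /= !mulr0 addr0.
move=> [a [a0 /IH H]].
have {}H := H (fun u us => yc u (mem_behead (s := v :: s) us)).
have := ler_wpM2l a0 (yc v (mem_head _ _)); move: H; rewrite /dot /=; lra.
Qed.

Lemma finite_interpolation (l u : seq R) :
  (forall a b, a \in l -> b \in u -> a <= b) ->
  exists m, (forall a, a \in l -> a <= m) /\ (forall b, b \in u -> m <= b).
Proof.
elim: l => [|a l IH] lu.
  elim: u {lu} => [|b u [m [_ mu]]]; first by exists 0.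
  exists (Num.min b m); split=> // c; rewrite inE => /predU1P[->|/mu mc].
    by rewrite ge_min lexx.
  by rewrite ge_min mc orbT.
have [d b dl bu|m [lm mu]] := IH; first by apply: lu => //; rewrite inE dl orbT.
exists (Num.max a m); split=> [d|b bu].
  by rewrite inE le_max => /predU1P[->|/lm ->]; rewrite ?lexx ?orbT.
by rewrite ge_max mu // lu // mem_head.
Qed.

Let hval (h : pt * R) x t := h.2 * t - dot h.1 x.

(* Fourier-Motzkin elimination of the weight of each generator in turn. *)
Lemma cone_halfspaces s : exists hs : seq (pt * R),
  forall x t, cone s x t <-> (forall h, h \in hs -> 0 <= hval h x t).
Proof.
elim: s => [|v s [hs IH]].
  (* Without generators the cone is the origin of the space of pairs [(x, t)], cut out by two
     opposite inequalities per coordinate. *)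
  exists [:: ((1, 0), 0); ((-1, 0), 0); ((0, 1), 0); ((0, -1), 0);
             ((0, 0), 1); ((0, 0), -1)] => x t /=; split.
    by move=> [-> ->] h _; rewrite /hval /dot /= !mulr0 addr0 subrr.
  move=> h.
  have := h ((1, 0), 0) ltac:(by rewrite !inE eqxx ?orbT).
  have := h ((-1, 0), 0) ltac:(by rewrite !inE eqxx ?orbT).
  have := h ((0, 1), 0) ltac:(by rewrite !inE eqxx ?orbT).
  have := h ((0, -1), 0) ltac:(by rewrite !inE eqxx ?orbT).
  have := h ((0, 0), 1) ltac:(by rewrite !inE eqxx ?orbT).
  have := h ((0, 0), -1) ltac:(by rewrite !inE eqxx ?orbT).
  rewrite /hval /dot /= => *; split; last lra.
  by rewrite [x]surjective_pairing; congr pair; lra.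
pose e h := hval h v 1.
pose comb (h k : pt * R) : pt * R := ((e k * h.1.1 - e h * k.1.1,
  e k * h.1.2 - e h * k.1.2), e k * h.2 - e h * k.2).
have combE h k x t : hval (comb h k) x t = e k * hval h x t - e h * hval k x t.
  by rewrite /hval /comb /dot /=; ring.
have shift h x t a : hval h (x.1 - a * v.1, x.2 - a * v.2) (t - a) = hval h x t - a * e h.
  by rewrite /e /hval /dot /=; ring.
(* As a condition on the weight [a] of [v], an inequality [h] is an upper bound if [0 < e h] and a
   lower bound if [e h < 0]. The first list compares the upper bounds with the lower bound [0 <= a]
   and keeps the inequalities free of [a]; the second compares all lower with all upper bounds. *)
exists ([seq h <- hs | 0 <= e h] ++
  [seq comb h k | h <- [seq h <- hs | e h < 0], k <- [seq k <- hs | 0 < e k]]) => x t /=.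
split=> [[a [a0 /IH H]] h|H].
  have {}H k : k \in hs -> a * e k <= hval k x t.
    by move=> /H; rewrite shift subr_ge0.
  rewrite mem_cat => /orP[|/allpairsP[[h1 h2] /= []]].
    by rewrite mem_filter => /andP[eh /H]; apply: le_trans; exact: mulr_ge0.
  rewrite !mem_filter => /andP[e1 /H H1] /andP[e2 /H H2] ->; rewrite combE.
  have := ler_wpM2l (ltW e2) H1; have := ler_wnM2l (ltW e1) H2; lra.
have [|m [ml mu]] := @finite_interpolation
    (0 :: [seq hval h x t / e h | h <- [seq h <- hs | e h < 0]])
    [seq hval h x t / e h | h <- [seq h <- hs | 0 < e h]].
  move=> a b; rewrite inE => /predU1P[->|/mapP[h1]]; last rewrite mem_filter => /andP[e1 h1s] ->.
    move=> /mapP[h]; rewrite mem_filter => /andP[e0 hh] ->.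
    rewrite divr_ge0 ?(ltW e0) // H // mem_cat mem_filter hh ltW //.
  move=> /mapP[h2]; rewrite mem_filter => /andP[e2 h2s] ->.
  rewrite ler_ndivrMr // mulrAC ler_pdivrMr //.
  have := H (comb h1 h2); rewrite combE mem_cat => H'.
  have := H' ltac:(by rewrite allpairs_f ?mem_filter ?e1 ?e2 ?orbT); lra.
exists m; split; first by apply: ml; exact: mem_head.
apply/IH => h hh; rewrite shift subr_ge0.
have [e0|e0|e0] := ltgtP (e h) 0.
- rewrite -ler_ndivrMr // ml // inE; apply/orP; right; apply/mapP; exists h => //.
  by rewrite mem_filter e0.
- rewrite -ler_pdivlMr // mu //; apply/mapP; exists h => //.
  by rewrite mem_filter e0.
- by rewrite e0 mulr0 H // mem_cat mem_filter hh e0 lexx.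
Qed.

(** Every half-plane with the origin in its interior can be normalised to have right-hand side 1, so
    [ys] has no separate offsets. By [polar_conv_hull] this set is the polar of the hull of [ys]. *)
Definition hps ys : set pt := [set x | forall y, y \in ys -> dot y x <= 1].

Definition pbox M : set pt := [set x | `|x.1| <= M /\ `|x.2| <= M].

Lemma conv_hull_mem s v : v \in s -> conv_hull s v.
Proof. by move=> vs; apply/conv_hullP; exact: cone_mem. Qed.

Lemma conv_hull_le s y c x : (forall v, v \in s -> dot y v <= c) ->
  conv_hull s x -> dot y x <= c.
Proof. by move=> yc /conv_hullP /(cone_le yc); rewrite mulr1. Qed.

Definition cross d : seq pt := [:: (d, 0); (- d, 0); (0, d); (0, - d)].

Lemma conv_hull_hps s d : 0 < d -> (forall v, v \in cross d -> conv_hull s v) ->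
  exists zs, conv_hull s = hps zs.
Proof.
move=> d0 sd; have [hs H] := cone_halfspaces s.
have {}H x : conv_hull s x <-> forall h, h \in hs -> dot h.1 x <= h.2.
  split=> [/conv_hullP/H hx h /hx|hx]; first by rewrite /hval mulr1 subr_ge0.
  by apply/conv_hullP/H => h /hx; rewrite /hval mulr1 subr_ge0.
have hd h : h \in hs -> `|h.1.1| * d <= h.2 /\ `|h.1.2| * d <= h.2.
  move=> hh; have {}sd v vd := (H v).1 (sd v vd) h hh.
  have := sd (d, 0) ltac:(by rewrite !inE eqxx ?orbT).
  have := sd (- d, 0) ltac:(by rewrite !inE eqxx ?orbT).
  have := sd (0, d) ltac:(by rewrite !inE eqxx ?orbT).
  have := sd (0, - d) ltac:(by rewrite !inE eqxx ?orbT).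
  rewrite /dot /= => *; split.
    by case: (ger0P h.1.1) => _; lra.
  by case: (ger0P h.1.2) => _; lra.
exists [seq (h.1.1 / h.2, h.1.2 / h.2) | h <- hs].
have key h x : h \in hs -> (dot h.1 x <= h.2) = (dot (h.1.1 / h.2, h.1.2 / h.2) x <= 1).
  move=> /hd [h1 h2]; have h0 : 0 <= h.2 by apply: le_trans h1; rewrite mulr_ge0 // ltW.
  have -> : dot (h.1.1 / h.2, h.1.2 / h.2) x = dot h.1 x / h.2 by rewrite /dot /=; ring.
  move: h0; rewrite le_eqVlt => /predU1P[h0|h0]; last by rewrite ler_pdivrMr // mul1r.
  (* If [h.2 = 0], the points of the cross force [h.1 = 0]. The original inequality is then void,
     and so is the normalised one, as the inverse of 0 is 0. *)
  rewrite -h0 invr0 mulr0 ler01; apply/idP.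
  have z (a : R) : `|a| * d <= h.2 -> a = 0.
    by rewrite -h0 pmulr_lle0 // normr_le0 => /eqP.
  by rewrite /dot (z _ h1) (z _ h2) !mul0r addr0.
apply/seteqP; split=> x.
  by move=> /H hx _ /mapP[h hh ->]; rewrite -key // hx.
by move=> hx; apply/H => h hh; rewrite key // hx //; exact: map_f.
Qed.

(** The converse of [conv_hull_hps], by duality: the hull of [C] is some [hps zs], so [hps C] is the
    bipolar of [zs], that is, the hull of [zs] and the origin. *)
Lemma hps_conv_hull ys M : hps ys `<=` pbox M -> is_polytope (hps ys).
Proof.
move=> yM; pose N := Num.max 1 M; have N0 : 0 < N by rewrite lt_max ltr01.
(* The extra constraints hold throughout the box, so they change nothing, but they put the origin in
   the interior of the hull of [C]. *)
pose C := ys ++ cross N^-1.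
have CE : hps C = hps ys.
  apply/seteqP; split=> x hx y yy; first by apply: hx; rewrite mem_cat yy.
  move: yy; rewrite mem_cat => /orP[/hx//|].
  have [x1 x2] := yM _ hx.
  have {}x1 : `|x.1| <= N by rewrite (le_trans x1) // le_max lexx orbT.
  have {}x2 : `|x.2| <= N by rewrite (le_trans x2) // le_max lexx orbT.
  move: x1 x2; rewrite !ler_norml => /andP[x1 x1'] /andP[x2 x2'].
  have h u : - N <= u -> u <= N -> N^-1 * u <= 1 /\ - N^-1 * u <= 1.
    by move=> u1 u2; rewrite mulNr -mulrN !ler_pdivrMl // mulr1; split=> //; lra.
  have [h1 h2] := h _ x1 x1'; have [h3 h4] := h _ x2 x2'.
  by rewrite !inE => /or4P[] /eqP ->; rewrite /dot /=; lra.
have [||zs zsE] := @conv_hull_hps C N^-1; first by rewrite invr_gt0.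
  by move=> v vd; apply: conv_hull_mem; rewrite mem_cat vd orbT.
exists ((0, 0) :: zs); rewrite -CE; set D := _ :: zs.
have [gs G] := cone_halfspaces D.
apply/seteqP; split=> x; last first.
  move=> xD y yC; apply: conv_hull_le xD => z.
  rewrite inE => /predU1P[->|zz]; first by rewrite /dot /= !mulr0 addr0 ler01.
  have : conv_hull C y by exact: conv_hull_mem.
  by rewrite zsE dotC; exact.
move=> hx; apply/conv_hullP/G => g gg; rewrite /hval mulr1 subr_ge0.
have gD z : z \in D -> dot g.1 z <= g.2.
  by move=> /cone_mem/G/(_ _ gg); rewrite /hval mulr1 subr_ge0.
have g0 : 0 <= g.2 by have := gD (0, 0) (mem_head _ _); rewrite /dot /= !mulr0 addr0.
(* [g.2] may be 0, so the division is by [g.2 + e]. *)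
apply/ler_addgt0Pr => e e0; have ge0 : 0 < g.2 + e by rewrite ltr_wpDl.
have : hps zs (g.1.1 / (g.2 + e), g.1.2 / (g.2 + e)).
  move=> z zz; have -> : dot z (g.1.1 / (g.2 + e), g.1.2 / (g.2 + e)) = dot g.1 z / (g.2 + e).
    by rewrite /dot /=; ring.
  rewrite ler_pdivrMr // mul1r (le_trans (gD z _)) ?lerDl ?ltW //.
  by rewrite inE zz orbT.
rewrite -zsE => /(@conv_hull_le _ x 1) H.
have {H}: dot x (g.1.1 / (g.2 + e), g.1.2 / (g.2 + e)) <= 1.
  by apply: H => y /hx; rewrite dotC.
have -> : dot x (g.1.1 / (g.2 + e), g.1.2 / (g.2 + e)) = dot g.1 x / (g.2 + e).
  by rewrite /dot /=; ring.
by rewrite ler_pdivrMr // mul1r.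
Qed.

Lemma norm_le_edist x : `|x.1| <= Defs.edist x (0, 0) /\ `|x.2| <= Defs.edist x (0, 0).
Proof.
rewrite /Defs.edist /= !subr0 -!sqrtr_sqr; split; apply: ler_wsqrtr.
  by rewrite lerDl sqr_ge0.
by rewrite lerDr sqr_ge0.
Qed.

Lemma origin_interior_cross P : origin_interior P ->
  exists d, 0 < d /\ forall v, v \in cross d -> P v.
Proof.
move=> [e [e0 eP]]; exists (e / 2); split=> [|v]; first by rewrite divr_gt0.
have e2 : 0 <= e / 2 by rewrite divr_ge0 // ltW.
rewrite !inE => /or4P[] /eqP ->; apply: eP;
  rewrite /Defs.edist /= !subr0 expr0n /= ?sqrrN ?add0r ?addr0 sqrtr_sqr ger0_norm //; lra.
Qed.

Lemma hps_ball ys : exists e, 0 < e /\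
  forall x, `|x.1| <= e -> `|x.2| <= e -> hps ys x.
Proof.
pose m := 1 + \sum_(y <- ys) (`|y.1| + `|y.2|).
have m0 : 0 < m by rewrite ltr_pwDl // sumr_ge0 // => y _; rewrite addr_ge0.
exists m^-1; rewrite invr_gt0; split=> // x x1 x2 y yy.
have ym : `|y.1| + `|y.2| <= m.
  rewrite /m (big_rem _ yy) /= addrCA lerDl.
  by apply: addr_ge0 => //; apply: sumr_ge0 => z _; exact: addr_ge0.
apply: (le_trans (ler_norm _)); rewrite (le_trans (ler_normD _ _)) // !normrM.
apply: (@le_trans _ _ ((`|y.1| + `|y.2|) * m^-1)).
  by rewrite mulrDl lerD // ler_wpM2l.
by rewrite ler_pdivrMr // mul1r.
Qed.

Lemma conv_hull_bounded s : exists M, conv_hull s `<=` pbox M.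
Proof.
pose M := \sum_(y <- s) (`|y.1| + `|y.2|); exists M => x xs.
have yM y : y \in s -> `|y.1| + `|y.2| <= M.
  move=> yy; rewrite /M (big_rem _ yy) /= lerDl.
  by apply: sumr_ge0 => z _; exact: addr_ge0.
have H (c : pt) : (forall y, y \in s -> dot c y <= M) -> dot c x <= M.
  by move=> cM; exact: conv_hull_le cM xs.
have yb y : y \in s -> [/\ y.1 <= M, - y.1 <= M, y.2 <= M & - y.2 <= M].
  move=> /yM; have [] := (ler_norm y.1, ler_norm y.2).
  have := ler_norm (- y.1); have := ler_norm (- y.2); rewrite !normrN.
  have [] := (normr_ge0 y.1, normr_ge0 y.2); move=> *; split; lra.
have a1 : 1 * x.1 + 0 * x.2 <= M by apply: (H (1, 0)) => y /yb[]; rewrite /dot /=; lra.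
have a2 : -1 * x.1 + 0 * x.2 <= M by apply: (H (-1, 0)) => y /yb[]; rewrite /dot /=; lra.
have a3 : 0 * x.1 + 1 * x.2 <= M by apply: (H (0, 1)) => y /yb[]; rewrite /dot /=; lra.
have a4 : 0 * x.1 + -1 * x.2 <= M by apply: (H (0, -1)) => y /yb[]; rewrite /dot /=; lra.
by split; rewrite ler_norml; apply/andP; split; lra.
Qed.

(** The description of polygons used from here on: stability under intersection and linear maps,
    closedness and measurability are immediate for bounded intersections of half-planes. *)
Lemma PoP P : Po P <-> exists ys M, P = hps ys /\ P `<=` pbox M.
Proof.
split=> [[[s ->] /origin_interior_cross[d [d0 ds]]]|[ys [M [-> yM]]]].
  have [zs zsE] := conv_hull_hps d0 ds; exists zs.
  by have [M sM] := conv_hull_bounded s; exists M.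
split; first exact: hps_conv_hull yM.
have [e [e0 eh]] := hps_ball ys; exists e; split=> // x xe.
by have [x1 x2] := norm_le_edist x; apply: eh; rewrite (le_trans _ (ltW xe)).
Qed.

Lemma hpsI ys zs : hps (ys ++ zs) = hps ys `&` hps zs.
Proof.
apply/seteqP; split=> [x H|x [yx zx] y].
  by split=> y yy; apply: H; rewrite mem_cat yy ?orbT.
by rewrite mem_cat => /orP[/yx|/zx].
Qed.

Lemma Po_cap_hps P ys : Po P -> Po (P `&` hps ys).
Proof.
move=> /PoP[zs [M [-> zM]]]; apply/PoP; exists (zs ++ ys), M.
by rewrite hpsI; split=> // x [/zM].
Qed.

Lemma PoI P Q : Po P -> Po Q -> Po (P `&` Q).
Proof. by move=> PP /PoP[ys [M [-> _]]]; exact: Po_cap_hps. Qed.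

Lemma polar_conv_hull s : polar (conv_hull s) = hps s.
Proof.
apply/seteqP; split=> y H x xs; first by rewrite dotC; apply: H; exact: conv_hull_mem.
by apply: conv_hull_le xs => v /H; rewrite dotC.
Qed.

Lemma Po_polar P : Po P -> Po (polar P).
Proof.
move=> [[s ->] /origin_interior_cross[d [d0 ds]]]; rewrite polar_conv_hull.
apply/PoP; exists s, d^-1; split=> // y; rewrite -polar_conv_hull => yP.
have := yP _ (ds (d, 0) ltac:(by rewrite !inE eqxx ?orbT)).
have := yP _ (ds (- d, 0) ltac:(by rewrite !inE eqxx ?orbT)).
have := yP _ (ds (0, d) ltac:(by rewrite !inE eqxx ?orbT)).
have := yP _ (ds (0, - d) ltac:(by rewrite !inE eqxx ?orbT)).
rewrite /dot /= => *; split; rewrite -div1r ler_pdivlMr //.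
  by case: (ger0P y.1) => _; lra.
by case: (ger0P y.2) => _; lra.
Qed.

Lemma polarK P : Po P -> polar (polar P) = P.
Proof.
move=> /PoP[ys [M [-> yM]]]; apply/seteqP; split=> x H; last first.
  by move=> y yP; rewrite dotC; exact: yP.
by move=> y yy; rewrite dotC; apply: H => z; apply.
Qed.

Lemma Po_bounded P : Po P -> exists M, 0 < M /\ P `<=` pbox M.
Proof.
move=> /PoP[ys [M [_ PM]]]; exists (Num.max 1 M); rewrite lt_max ltr01; split=> //.
by move=> x /PM[x1 x2]; split; rewrite le_max ?x1 ?x2 orbT.
Qed.

Lemma Po_ball P : Po P -> exists e, 0 < e /\
  forall x, `|x.1| <= e -> `|x.2| <= e -> P x.
Proof. by move=> /PoP[ys [M [-> _]]]; exact: hps_ball. Qed.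

Lemma Po0 P : Po P -> P (0, 0).
Proof. by move=> /Po_ball[e [e0]]; apply; rewrite normr0 ltW. Qed.

Lemma Po_convex P a x y : Po P -> P x -> P y -> 0 <= a <= 1 ->
  P (a * x.1 + (1 - a) * y.1, a * x.2 + (1 - a) * y.2).
Proof.
move=> /PoP[ys [M [-> _]]] hx hy /andP[a0 a1] z zz.
have a1' : 0 <= 1 - a by lra.
have := ler_wpM2l a0 (hx z zz); have := ler_wpM2l a1' (hy z zz); rewrite /dot /=; lra.
Qed.

(** * Linear maps and dilations acting on polygons *)

Lemma det_mx2 (A : 'M[R]_2) :
  \det A = A ord0 ord0 * A ord_max ord_max - A ord0 ord_max * A ord_max ord0.
Proof.
have -> : ord_max = lift ord0 ord0 :> 'I_2 by exact/val_inj.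
rewrite (expand_det_row _ ord0) !big_ord_recl big_ord0 addr0 /cofactor !det_mx11 !mxE.
have -> : lift (lift ord0 ord0) ord0 = ord0 :> 'I_2 by exact/val_inj.
by rewrite /= /bump /= expr0 expr1 mul1r; ring.
Qed.

Lemma mxactM (A B : 'M[R]_2) (x : pt) : mxact (A *m B) x = mxact A (mxact B x).
Proof.
have E i j : (A *m B) i j = A i ord0 * B ord0 j + A i ord_max * B ord_max j.
  rewrite mxE !big_ord_recl big_ord0 addr0.
  by have -> : lift ord0 ord0 = ord_max :> 'I_2 by exact/val_inj.
by rewrite /mxact !E /=; congr pair; ring.
Qed.

Lemma mxact1 (x : pt) : mxact 1%:M x = x.
Proof. by case: x => x y; rewrite /mxact !mxE /= !mul1r !mul0r addr0 add0r. Qed.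

Lemma image_mxact (A : 'M[R]_2) (P : set pt) : \det A = 1 ->
  mxact A @` P = mxact (invmx A) @^-1` P.
Proof.
move=> detA; have uA : A \in unitmx by rewrite unitmxE detA unitr1.
apply/seteqP; split=> [_ [x Px <-]|x Px] /=.
  by rewrite -mxactM mulVmx // mxact1.
by exists (mxact (invmx A) x) => //; rewrite -mxactM mulmxV // mxact1.
Qed.

Lemma image_vscale (s : R) (P : set pt) : s != 0 ->
  vscale s @` P = vscale s^-1 @^-1` P.
Proof.
move=> s0; apply/seteqP; split=> [_ [[x y] Px <-]|[x y] Px] /=.
  by rewrite /vscale /= !mulKf.
by exists (vscale s^-1 (x, y)) => //; rewrite /vscale /= !mulVKf.
Qed.

Lemma mxact_pbox (A : 'M[R]_2) (P : set pt) M : P `<=` pbox M ->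
  exists M', mxact A @` P `<=` pbox M'.
Proof.
move=> PM; pose m := \sum_i \sum_j `|A i j|; exists (m * M) => _ [x /PM[x1 x2] <-].
have row i : `|A i ord0| + `|A i ord_max| <= m.
  rewrite /m (bigD1 i) //= big_ord_recl big_ord1.
  have -> : lift ord0 ord0 = ord_max :> 'I_2 by exact/val_inj.
  by rewrite lerDl sumr_ge0 // => j _; rewrite sumr_ge0.
have M0 : 0 <= M by exact: le_trans x1.
have K i : `|A i ord0 * x.1 + A i ord_max * x.2| <= m * M.
  rewrite (le_trans (ler_normD _ _)) // !normrM.
  rewrite (le_trans _ (ler_wpM2r M0 (row i))) // mulrDl.
  by rewrite lerD // ler_wpM2l.
by split; exact: K.
Qed.

Lemma vscale_pbox (s : R) (P : set pt) M : 0 < s -> P `<=` pbox M ->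
  vscale s @` P `<=` pbox (s * M).
Proof.
move=> s0 PM _ [x /PM[x1 x2] <-].
by rewrite /vscale; split=> /=; rewrite normrM gtr0_norm // ler_pM2l.
Qed.

Lemma dot_mxact (A : 'M[R]_2) x y : dot y (mxact A x) = dot (mxact A^T y) x.
Proof. by rewrite /dot /mxact !mxE /=; ring. Qed.

Lemma Po_vscale P (k : R) : 0 < k -> Po P -> Po (vscale k @` P).
Proof.
move=> k0 /PoP[ys [M [-> yM]]]; have kN := lt0r_neq0 k0.
apply/PoP; exists [seq vscale k^-1 y | y <- ys], (k * M); split; last first.
  exact: vscale_pbox.
apply/seteqP; split=> [_ [x hx <-] _ /mapP[y yy ->]|x hx].
  rewrite (_ : dot _ _ = dot y x) ?hx // /dot /vscale /=; field; exact: kN.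
exists (vscale k^-1 x); last first.
  by rewrite /vscale /= !mulVKf //; case: x {hx}.
move=> y yy; have := hx _ (map_f _ yy).
by congr (_ <= _); rewrite /dot /vscale /=; ring.
Qed.

Lemma Po_mxact (A : 'M[R]_2) P : \det A = 1 -> Po P -> Po (mxact A @` P).
Proof.
move=> dA /PoP[ys [M [-> yM]]]; have [M' AM] := mxact_pbox A yM.
apply/PoP; exists [seq mxact (invmx A)^T y | y <- ys], M'; split=> //.
have uA : A \in unitmx by rewrite unitmxE dA unitr1.
rewrite image_mxact //; apply/seteqP; split=> [x hx _ /mapP[y yy ->]|x hx y yy] /=.
  by rewrite -dot_mxact hx.
by rewrite dot_mxact hx // map_f.
Qed.

Lemma polar_mxact (A : 'M[R]_2) P : \det A = 1 ->
  polar (mxact A @` P) = mxact (invmx A)^T @` polar P.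
Proof.
move=> dA; have uA : A \in unitmx by rewrite unitmxE dA unitr1.
rewrite [RHS]image_mxact; last by rewrite det_tr det_inv dA invr1.
rewrite trmx_inv invmxK; apply/seteqP; split=> y H /=.
  by move=> x Px; rewrite -dot_mxact; apply: H; exists x.
by move=> _ [x Px <-]; rewrite dot_mxact; exact: H.
Qed.

End Polytopes.

(** * Plane Lebesgue measure and moments *)

Section PlaneMeasure.
Variable R : realType.
Local Notation mR := (measurableTypeR R).
Local Notation pt := (mR * mR)%type.
Local Notation leb := (@lebesgue_measure R).

Lemma lebesgue_measure_translate (c : R) (A : set R) : measurable A ->
  leb ((fun y : R => y + c) @^-1` A) = leb A.
Proof.
move=> mA; have mf : measurable_fun [set: mR] (fun y : mR => y + c : mR).
  exact: measurable_funD.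
rewrite -[LHS]/(pushforward leb (fun y : mR => y + c : mR) A).
apply/esym/lebesgue_measure_unique => //= _ [[a b]] _ <-.
rewrite /pushforward (_ : _ @^-1` _ = `]a - c, b - c]%classic); last first.
  by apply/seteqP; split=> y /=; rewrite !in_itv /= ltrBlDr lerBrDr.
by rewrite !lebesgue_measure_itv /= !lte_fin ltrD2r -!EFinD opprB addrA subrK.
Qed.

Lemma lebesgue_measure_dilate (s : R) (A : set R) : 0 < s -> measurable A ->
  leb ((fun y : R => (s * y)%R) @^-1` A) = (s^-1%:E * leb A)%E.
Proof.
move=> s0 mA; have mf : measurable_fun [set: mR] (fun y : mR => s * y : mR).
  exact: measurable_funM.
have k0 : 0 <= s by exact: ltW.
have /(_ mf A mA) : forall A, measurable A ->
    leb A = mscale (NngNum k0) (pushforward leb (fun y : mR => s * y : mR)) A.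
  move=> m; apply: lebesgue_measure_unique => //= _ [x _ <-].
  rewrite -[RHS]/(s%:E * leb ((fun y : R => (s * y)%R) @^-1` `]x.1, x.2]))%E.
  have -> : (fun y : R => s * y) @^-1` `]x.1, x.2] = `]s^-1 * x.1, s^-1 * x.2]%classic.
    by apply/seteqP; split=> y /=; rewrite !in_itv /= ltr_pdivrMl ?ler_pdivlMl.
  rewrite !lebesgue_measure_itv /= !lte_fin ltr_pM2l ?invr_gt0 //.
  case: ifP => _; last by rewrite mule0.
  by rewrite -!EFinD -EFinM -mulrBr mulVKf // lt0r_neq0.
move=> ->; rewrite /mscale /pushforward /= muleA -EFinM mulVf ?mul1e //.
by rewrite lt0r_neq0.
Qed.

Lemma leb2X (A B : set R) : measurable A -> measurable B ->
  leb2 (A `*` B) = (leb A * leb B)%E.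
Proof. by move=> mA mB; exact: product_measure1E. Qed.

Lemma leb2_dilate (s : R) (A : set pt) : 0 < s -> measurable A ->
  leb2 ((fun x : pt => (s * x.1, s * x.2)) @^-1` A) = ((s ^-2)%:E * leb2 A)%E.
Proof.
move=> s0 mA; have k0 : 0 <= s ^+ 2 by rewrite exprn_ge0 // ltW.
pose phi := fun x : mR * mR => (s * x.1, s * x.2) : mR * mR.
have ms : measurable_fun [set: mR] (fun y : mR => s * y : mR).
  exact: measurable_funM.
have mf : measurable_fun [set: mR * mR] phi.
  by apply: measurable_fun_pair; apply: measurable_funM.
have /(_ mf A mA) : forall A, measurable A ->
    leb2 A = mscale (NngNum k0) (pushforward (@leb2 R) phi) A.
  move=> m; apply: product_measure_unique => //= B C mB mC.
  rewrite -[LHS]/((s ^+ 2)%R%:E * leb2 (phi @^-1` (B `*` C)))%E /phi.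
  have -> : (fun x : mR * mR => (s * x.1, s * x.2)) @^-1` (B `*` C) =
    ((fun y : R => s * y) @^-1` B) `*` ((fun y : R => s * y) @^-1` C) by [].
  rewrite leb2X.
  - rewrite (lebesgue_measure_dilate s0 mB) (lebesgue_measure_dilate s0 mC).
    rewrite [X in (_ * X)%E]muleACA -EFinM [LHS]muleA -EFinM (_ : s ^+ 2 * _ = 1) ?mul1e //.
    by field; rewrite lt0r_neq0.
  - by rewrite -[X in measurable X]setTI; exact: ms.
  - by rewrite -[X in measurable X]setTI; exact: ms.
move=> ->; rewrite /mscale /pushforward /= muleA -EFinM mulVf ?mul1e //.
by rewrite expf_neq0 // lt0r_neq0.
Qed.

Lemma leb2_swap (A : set pt) : measurable A ->
  leb2 ((fun x : pt => (x.2, x.1)) @^-1` A) = leb2 A.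
Proof.
move=> mA; pose phi := fun x : mR * mR => (x.2, x.1) : mR * mR.
have mf : measurable_fun [set: mR * mR] phi.
  by apply: measurable_fun_pair.
rewrite -[LHS]/(pushforward (@leb2 R) phi A).
apply/esym/product_measure_unique => //= B C mB mC.
rewrite -[LHS]/(leb2 (phi @^-1` (B `*` C))) /phi.
have -> : (fun x : mR * mR => (x.2, x.1)) @^-1` (B `*` C) = C `*` B.
  by apply/seteqP; split=> -[x y] [].
by rewrite leb2X // muleC.
Qed.

(** The product measure integrates the lengths of vertical sections, and the shear only translates
    each section. *)
Lemma leb2_shear (t : R) (A : set pt) : measurable A ->
  leb2 ((fun x : pt => (x.1, x.2 + t * x.1)) @^-1` A) = leb2 A.
Proof.
move=> mA; apply: eq_integral => x _ /=.
have mx : measurable (xsection (A : set (mR * mR)) x : set mR).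
  exact: (@measurable_xsection _ _ mR mR A x mA).
rewrite -[RHS](lebesgue_measure_translate (t * x) mx).
congr (leb _); apply/seteqP; split=> y; rewrite /xsection /= !inE //.
Qed.

(** * Integration over bounded sets and change of variables *)

Lemma measurable_linear (a b : R) :
  measurable_fun [set: pt] (fun x : pt => a * x.1 + b * x.2).
Proof. by apply: measurable_funD; apply: measurable_funM. Qed.

Lemma measurable_mxact (A : 'M[R]_2) : measurable_fun [set: pt] (mxact A : pt -> pt).
Proof. by apply: measurable_fun_pair; exact: measurable_linear. Qed.

Lemma measurable_vscale (s : R) : measurable_fun [set: pt] (vscale s : pt -> pt).
Proof. by apply: measurable_fun_pair; apply: measurable_funM. Qed.

Lemma pboxE (M : R) : pbox M = `[- M, M] `*` `[- M, M].
Proof. by apply/seteqP; split=> -[x y] /=; rewrite /pbox /= !in_itv /= !ler_norml. Qed.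

Lemma measurable_pbox (M : R) : measurable (pbox M : set pt).
Proof. by rewrite pboxE; apply: measurableX; exact: measurable_itv. Qed.

Lemma leb2_bounded (P : set pt) M : measurable P -> P `<=` pbox M -> (leb2 P < +oo)%E.
Proof.
move=> mP PM; apply: (@le_lt_trans _ _ (leb2 (pbox M))).
  by apply: (le_measure (@leb2 R)) => //; rewrite inE //; exact: measurable_pbox.
rewrite pboxE leb2X; try exact: measurable_itv.
have H : (leb `[(- M)%R, M] < +oo)%E.
  by rewrite lebesgue_measure_itv /=; case: ifP => _ //; rewrite ltry.
by rewrite lte_mul_pinfty // ge0_fin_numE.
Qed.

Lemma integrable_linear (P : set pt) M (a b : R) : measurable P -> P `<=` pbox M ->
  (@leb2 R).-integrable P (EFin \o (fun x : pt => a * x.1 + b * x.2)).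
Proof.
move=> mP PM; apply: measurable_bounded_integrable => //.
- exact: leb2_bounded mP PM.
- by apply: measurable_funTS; exact: measurable_linear.
exists ((`|a| + `|b|) * M); split; first exact: num_real.
move=> K MK x /PM[x1 x2]; apply: le_trans (ltW MK).
rewrite (le_trans (ler_normD _ _)) // !normrM mulrDl lerD // ler_wpM2l //.
Qed.

Lemma integrable_fst (P : set pt) M : measurable P -> P `<=` pbox M ->
  (@leb2 R).-integrable P (EFin \o (fun x : pt => x.1)).
Proof.
move=> mP PM; have := integrable_linear 1 0 mP PM.
by congr (integrable _ _ _); apply/funext => x /=; rewrite mul1r mul0r addr0.
Qed.

Lemma integrable_snd (P : set pt) M : measurable P -> P `<=` pbox M ->
  (@leb2 R).-integrable P (EFin \o (fun x : pt => x.2)).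
Proof.
move=> mP PM; have := integrable_linear 0 1 mP PM.
by congr (integrable _ _ _); apply/funext => x /=; rewrite mul1r mul0r add0r.
Qed.

Lemma Rintegral_linear (P : set pt) M (a b : R) : measurable P -> P `<=` pbox M ->
  Rintegral (@leb2 R) P (fun x => a * x.1 + b * x.2) =
  a * (moment P).1 + b * (moment P).2.
Proof.
move=> mP PM; have i1 := integrable_fst mP PM; have i2 := integrable_snd mP PM.
have j1 : (@leb2 R).-integrable P (EFin \o (fun x : pt => a * x.1)).
  have := integrable_linear a 0 mP PM.
  by congr (integrable _ _ _); apply/funext => x /=; rewrite mul0r addr0.
have j2 : (@leb2 R).-integrable P (EFin \o (fun x : pt => b * x.2)).
  have := integrable_linear 0 b mP PM.
  by congr (integrable _ _ _); apply/funext => x /=; rewrite mul0r add0r.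
by rewrite (RintegralD mP j1 j2) !RintegralZl.
Qed.

Lemma Rintegral_transform (T : pt -> pt) (k : R) (P : set pt) (f : pt -> R) :
  measurable_fun [set: pt] T -> 0 <= k ->
  (forall A, measurable A -> leb2 (T @^-1` A) = (k%:E * leb2 A)%E) ->
  measurable P -> measurable_fun [set: pt] f ->
  (@leb2 R).-integrable P (EFin \o f) ->
  (@leb2 R).-integrable (T @^-1` P) (EFin \o (f \o T)) ->
  Rintegral (@leb2 R) (T @^-1` P) (f \o T) = k * Rintegral (@leb2 R) P f.
Proof.
move=> mT k0 TE mP mf iP iT.
have mfE : measurable_fun [set: pt] (EFin \o f) by exact/measurable_EFinP.
have E : (\int[@leb2 R]_(x in T @^-1` P) ((f \o T) x)%:E =
          \int[pushforward (@leb2 R) T]_(x in P) (f x)%:E)%E.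
  by symmetry; exact: (integral_pushforward mT mfE iT mP).
have E2 : (\int[pushforward (@leb2 R) T]_(x in P) (f x)%:E =
    \int[mscale (NngNum k0) (@leb2 R)]_(x in P) (f x)%:E)%E.
  by apply: eq_measure_integral => A mA _; exact: TE.
have mfP : measurable_fun P (EFin \o f) by exact: measurable_funTS.
have mpos : measurable_fun P ((EFin \o f)^\+)%E by exact: measurable_funepos.
have mneg : measurable_fun P ((EFin \o f)^\-)%E by exact: measurable_funeneg.
have pos0 x : P x -> (0 <= (EFin \o f)^\+ x)%E by move=> _; exact: funepos_ge0.
have neg0 x : P x -> (0 <= (EFin \o f)^\- x)%E by move=> _; exact: funeneg_ge0.
have E3 : (\int[mscale (NngNum k0) (@leb2 R)]_(x in P) (f x)%:E =
    k%:E * \int[@leb2 R]_(x in P) (f x)%:E)%E.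
  have p := ge0_integral_mscale (@leb2 R) mP (NngNum k0) mpos pos0.
  have n := ge0_integral_mscale (@leb2 R) mP (NngNum k0) mneg neg0.
  have I1 := integralE (mscale (NngNum k0) (@leb2 R)) P (EFin \o f).
  have I2 := integralE (@leb2 R) P (EFin \o f).
  have kf : k%:E \is a fin_num by [].
  have nf : (- \int[@leb2 R]_(x in P) ((EFin \o f)^\- x))%E \is a fin_num.
    by rewrite fin_numN; exact: integrable_neg_fin_num.
  have d := muleBr kf (fin_num_adde_defl (\int[@leb2 R]_(x in P) ((EFin \o f)^\+ x))%E nf).
  apply: (etrans I1); apply: (etrans (congr2 (fun x y => (x - y)%E) p n)).
  by apply: (etrans (esym d)); exact: (congr1 (mule k%:E) (esym I2)).
have ff : (\int[@leb2 R]_(x in P) (f x)%:E)%E \is a fin_num.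
  exact: (integrable_fin_num mP iP).
by rewrite /Rintegral (etrans E (etrans E2 E3)) fineM.
Qed.

Let preserving (T : pt -> pt) := measurable_fun [set: pt] T /\
  forall S : set pt, measurable S -> leb2 (T @^-1` S) = leb2 S.

Let preserving_comp T U : preserving T -> preserving U -> preserving (T \o U).
Proof.
move=> [mT hT] [mU hU]; split; first exact: measurableT_comp.
move=> S mS; rewrite comp_preimage hU ?hT // -[X in measurable X]setTI; exact: mT.
Qed.

Let shear (t : R) (x : pt) : pt := (x.1, x.2 + t * x.1).
Let swap (x : pt) : pt := (x.2, x.1).

Let preserving_shear t : preserving (shear t).
Proof.
split; last by move=> S mS; exact: leb2_shear.
by apply: measurable_fun_pair => //; apply: measurable_funD => //; apply: measurable_funM.
Qed.

Let preserving_swap : preserving swap.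
Proof. by split; [exact: measurable_fun_pair|move=> S mS; exact: leb2_swap]. Qed.

Let lin (a b c d : R) (x : pt) : pt := (a * x.1 + b * x.2, c * x.1 + d * x.2).

(** A matrix of determinant 1 with [c != 0] is a product of three shears in alternating directions;
    conjugation by [swap] changes the direction of a shear. *)
Let preserving_lin0 a b c d : a * d - b * c = 1 -> c != 0 -> preserving (lin a b c d).
Proof.
move=> det c0.
suff -> : lin a b c d = swap \o shear ((a - 1) / c) \o swap \o shear c \o
                        swap \o shear ((d - 1) / c) \o swap.
  do 3 (apply: (preserving_comp _ preserving_swap);
        apply: (preserving_comp _ (preserving_shear _))).
  exact: preserving_swap.
have -> : b = (a * d - 1) / c by rewrite -det; field.
by apply/funext => -[x y]; rewrite /lin /swap /shear /=; congr pair; field.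
Qed.

Let preserving_lin a b c d : a * d - b * c = 1 -> preserving (lin a b c d).
Proof.
move=> det; have [c0|] := eqVneq c 0; last exact: preserving_lin0.
(* If [c = 0] then [d != 0], and composing with a shear replaces the entry [c] by [c + d = d]. *)
have -> : lin a b c d = lin (a + b) b (c + d) d \o shear (-1).
  by apply/funext => -[x y]; rewrite /lin /shear /=; congr pair; ring.
apply: preserving_comp; last exact: preserving_shear.
apply: preserving_lin0; first by rewrite -det; ring.
rewrite c0 add0r; apply/eqP => d0; move: det.
by rewrite c0 d0 !mulr0 subrr => /esym/eqP; rewrite oner_eq0.
Qed.

Lemma leb2_mxact (A : 'M[R]_2) (S : set pt) : \det A = 1 -> measurable S ->
  leb2 (mxact A @^-1` S) = leb2 S.
Proof. by rewrite det_mx2 => /preserving_lin[_]; apply. Qed.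

Lemma measurable_image_mxact (A : 'M[R]_2) (P : set pt) : \det A = 1 ->
  measurable P -> measurable (mxact A @` P : set pt).
Proof.
by move=> dA mP; rewrite image_mxact // -[X in measurable X]setTI; exact: measurable_mxact.
Qed.

Lemma measurable_image_vscale (s : R) (P : set pt) : s != 0 ->
  measurable P -> measurable (vscale s @` P : set pt).
Proof.
by move=> s0 mP; rewrite image_vscale // -[X in measurable X]setTI; exact: measurable_vscale.
Qed.

Lemma moment_mxact (A : 'M[R]_2) (P : set pt) M : \det A = 1 ->
  measurable P -> P `<=` pbox M -> moment (mxact A @` P) = mxact A (moment P).
Proof.
move=> dA mP PM; set S := mxact A @` P.
have mS : measurable (S : set pt) by exact: measurable_image_mxact.
have [M' SM] := mxact_pbox A PM.
have TS : mxact A @^-1` S = P.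
  rewrite /S image_mxact // -comp_preimage (_ : _ \o _ = id) //.
  by apply/funext => x /=; rewrite -mxactM mulVmx ?mxact1 // unitmxE dA unitr1.
have TE (B : set pt) : measurable B -> leb2 (mxact A @^-1` B) = (1%:E * leb2 B)%E.
  by move=> mB; rewrite mul1e leb2_mxact.
have mT := measurable_mxact A.
have i1 := integrable_fst mS SM; have i2 := integrable_snd mS SM.
have j1 : (@leb2 R).-integrable (mxact A @^-1` S)
    (EFin \o ((fun x : pt => x.1) \o mxact A)).
  by rewrite TS; exact: integrable_linear PM.
have j2 : (@leb2 R).-integrable (mxact A @^-1` S)
    (EFin \o ((fun x : pt => x.2) \o mxact A)).
  by rewrite TS; exact: integrable_linear PM.
have e1 := Rintegral_transform mT ler01 TE mS measurable_fst i1 j1.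
have e2 := Rintegral_transform mT ler01 TE mS measurable_snd i2 j2.
rewrite TS mul1r in e1; rewrite TS mul1r in e2.
rewrite /moment -e1 -e2 /mxact.
rewrite -!(Rintegral_linear _ _ mP PM) //.
Qed.

Lemma moment_vscale (s : R) (P : set pt) M : 0 < s ->
  measurable P -> P `<=` pbox M -> moment (vscale s @` P) = vscale (s ^+ 3) (moment P).
Proof.
move=> s0 mP PM; set S := vscale s @` P; have sN := lt0r_neq0 s0.
have mS : measurable (S : set pt) by exact: measurable_image_vscale.
have SM := vscale_pbox s0 PM.
have TS : vscale s @^-1` S = P.
  rewrite /S image_vscale // -comp_preimage (_ : _ \o _ = id) //.
  by apply/funext => -[x y]; rewrite /vscale /= !mulKf.
have k0 : 0 <= s ^-2 by rewrite invr_ge0 exprn_ge0 // ltW.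
have TE (B : set pt) : measurable B -> leb2 (vscale s @^-1` B) = ((s ^- 2)%:E * leb2 B)%E.
  by move=> mB; exact: leb2_dilate.
have mT := measurable_vscale s.
have i1 := integrable_fst mS SM; have i2 := integrable_snd mS SM.
have l1 := integrable_linear s 0 mP PM; have l2 := integrable_linear 0 s mP PM.
have f1 : (fun x : pt => x.1) \o vscale s = (fun x : pt => s * x.1 + 0 * x.2).
  by apply/funext => x /=; rewrite mul0r addr0.
have f2 : (fun x : pt => x.2) \o vscale s = (fun x : pt => 0 * x.1 + s * x.2).
  by apply/funext => x /=; rewrite mul0r add0r.
rewrite -f1 -TS in l1; rewrite -f2 -TS in l2.
have e1 := Rintegral_transform mT k0 TE mS measurable_fst i1 l1.
have e2 := Rintegral_transform mT k0 TE mS measurable_snd i2 l2.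
move: e1 e2; rewrite TS f1 f2 !(Rintegral_linear _ _ mP PM) => e1 e2.
have {e1}e1 : (moment S).1 = s ^+ 3 * (moment P).1.
  by rewrite [LHS](canRL (mulKf _) (esym e1)) ?invr_eq0 ?expf_neq0 //; field.
have {e2}e2 : (moment S).2 = s ^+ 3 * (moment P).2.
  by rewrite [LHS](canRL (mulKf _) (esym e2)) ?invr_eq0 ?expf_neq0 //; field.
by rewrite [moment S]surjective_pairing e1 e2.
Qed.

Lemma moment_valuation (K L : set pt) M : measurable K -> measurable L ->
  K `<=` pbox M -> L `<=` pbox M ->
  vadd (moment (K `|` L)) (moment (K `&` L)) = vadd (moment K) (moment L).
Proof.
move=> mK mL KM LM.
have H (f : pt -> R) : (forall (P : set pt) M, measurable P -> P `<=` pbox M ->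
      (@leb2 R).-integrable P (EFin \o f)) ->
    Rintegral (@leb2 R) (K `|` L) f + Rintegral (@leb2 R) (K `&` L) f =
    Rintegral (@leb2 R) K f + Rintegral (@leb2 R) L f.
  move=> iF; have mD : measurable (L `\` K) by exact: measurableD.
  have mI : measurable (L `&` K) by exact: measurableI.
  have -> : K `|` L = K `|` (L `\` K) by apply/seteqP; split=> x; have [] := pselect (K x); rewrite /setU /setD /=; tauto.
  rewrite Rintegral_setU //; first last.
  - by rewrite disj_set2E; apply/eqP; rewrite setDIK.
  - by apply: (iF _ M); [exact: measurableU|move=> x [/KM|[/LM]]].
  have {3}-> : L = (L `\` K) `|` (L `&` K) by apply/seteqP; split=> x; have [] := pselect (K x); rewrite /setU /setD /setI /=; tauto.
  rewrite Rintegral_setU //; first by rewrite addrA [K `&` L]setIC.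
  - by apply: (iF _ M); [exact: measurableU|move=> x [[/LM]|[/LM]]].
  - by rewrite disj_set2E; apply/eqP/seteqP; split=> x // -[[_ nK] [_ /nK]].
by rewrite /vadd /moment /= !H //; [exact: integrable_snd|exact: integrable_fst].
Qed.

Lemma Rintegral_setD (I P : set pt) (f : pt -> R) : measurable I -> measurable P ->
  I `<=` P -> (@leb2 R).-integrable P (EFin \o f) ->
  Rintegral (@leb2 R) P f - Rintegral (@leb2 R) I f = Rintegral (@leb2 R) (P `\` I) f.
Proof.
move=> mI mP IP fP; have mD : measurable (P `\` I) by exact: measurableD.
have PE : I `|` (P `\` I) = P by rewrite setDUK.
have E : Rintegral (@leb2 R) (I `|` (P `\` I)) f =
    Rintegral (@leb2 R) I f + Rintegral (@leb2 R) (P `\` I) f.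
  apply: Rintegral_setU => //; first by rewrite PE.
  by rewrite disj_set2E; apply/eqP; rewrite setDIK.
by rewrite -{1}PE E addrAC subrr add0r.
Qed.

Lemma fine_leb2_setD (I P : set pt) M : measurable I -> measurable P -> I `<=` P ->
  P `<=` pbox M -> fine (leb2 (P `\` I)) = fine (leb2 P) - fine (leb2 I).
Proof.
move=> mI mP IP PM; have fP := leb2_bounded mP PM.
have fI : (leb2 I < +oo)%E by apply: leb2_bounded mI _ => x /IP /PM; exact.
have E := measureD (mu := @leb2 R) mP mI fP; rewrite (setIidr IP) in E.
rewrite (etrans (congr1 fine E) (fineB _ _)) //; by rewrite ge0_fin_numE.
Qed.

Lemma Rintegral_setD_le (I P : set pt) (f : pt -> R) M : measurable I -> measurable P ->
  I `<=` P -> P `<=` pbox M -> (@leb2 R).-integrable P (EFin \o f) ->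
  (forall x, P x -> `|f x| <= M) ->
  `|Rintegral (@leb2 R) P f - Rintegral (@leb2 R) I f| <= M * (fine (leb2 P) - fine (leb2 I)).
Proof.
move=> mI mP IP PM fP fM; have mD : measurable (P `\` I) by exact: measurableD.
have DM : P `\` I `<=` pbox M by move=> x [/PM].
have fD : (@leb2 R).-integrable (P `\` I) (EFin \o f).
  by apply: integrableS fP => // x [].
rewrite Rintegral_setD // -(fine_leb2_setD mI mP IP PM).
rewrite (le_trans (le_normr_Rintegral mD fD)) // -Rintegral_cst //.
apply: le_Rintegral => //.
- exact: (integrable_abse fD).
- apply: measurable_bounded_integrable => //.
    exact: leb2_bounded mD DM.
  exact: bounded_cst.
- by move=> x [/fM].
Qed.

(** The source of the continuity of moments: a polygon and its neighbours lie between the same two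
    dilates, and only the areas of these dilates have to be compared. *)
Lemma moment_sandwich (I P S : set pt) M : 0 <= M -> measurable I -> measurable P -> measurable S ->
  I `<=` P -> P `<=` S -> S `<=` pbox M ->
  `|(moment P).1 - (moment I).1| <= M * (fine (leb2 S) - fine (leb2 I)) /\
  `|(moment P).2 - (moment I).2| <= M * (fine (leb2 S) - fine (leb2 I)).
Proof.
move=> M0 mI mP mS IP PS SM; have PM : P `<=` pbox M by move=> x /PS /SM.
have PSle : fine (leb2 P) <= fine (leb2 S).
  rewrite fine_le ?ge0_fin_numE ?(leb2_bounded _ SM) ?(leb2_bounded _ PM) //.
  by apply: (le_measure (@leb2 R)) => //; rewrite inE.
have le : M * (fine (leb2 P) - fine (leb2 I)) <= M * (fine (leb2 S) - fine (leb2 I)).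
  by rewrite ler_wpM2l // lerB.
split; apply: (le_trans _ le); apply: (Rintegral_setD_le mI mP IP PM).
- exact: integrable_fst mP PM.
- by move=> x /PM[].
- exact: integrable_snd mP PM.
- by move=> x /PM[].
Qed.

Lemma fine_leb2_vscale (s : R) (P : set pt) M : 0 < s -> measurable P -> P `<=` pbox M ->
  fine (leb2 (vscale s @` P)) = s ^+ 2 * fine (leb2 P).
Proof.
move=> s0 mP PM; rewrite image_vscale ?lt0r_neq0 // leb2_dilate ?invr_gt0 //.
rewrite exprVn invrK fineM // ge0_fin_numE //; exact: leb2_bounded mP PM.
Qed.

Let rectangleP (a b c d : R) (z : R * R) : (`[a, b] `*` `[c, d]) z <->
  [/\ a <= z.1, z.1 <= b, c <= z.2 & z.2 <= d].
Proof.
rewrite /setX /=; rewrite !in_itv /=.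
by split=> [[/andP[? ?] /andP[? ?]]|[-> -> -> ->]].
Qed.

(** The rectangles differ by a set of area 2 on which the first coordinate is at least 1, so no
    integral of a coordinate has to be evaluated. *)
Lemma moment_grows : 0 < (moment (`[-1, 2] `*` `[-1, 1] : set pt)).1
                        - (moment (`[-1, 1] `*` `[-1, 1] : set pt)).1.
Proof.
set P : set pt := _ `*` _; set I : set pt := _ `*` _.
have mP : measurable P by apply: measurableX; exact: measurable_itv.
have mI : measurable I by apply: measurableX; exact: measurable_itv.
have IP : I `<=` P.
  by move=> z /rectangleP[? ? ? ?]; apply/rectangleP; split=> //; lra.
have PM : P `<=` pbox 2.
  by move=> z /rectangleP[? ? ? ?]; split; rewrite ler_norml; apply/andP; split; lra.
have mD : measurable (P `\` I) by exact: measurableD.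
have DM : P `\` I `<=` pbox 2 by move=> x [/PM].
rewrite (Rintegral_setD mI mP IP (integrable_fst mP PM)).
have : fine (leb2 (P `\` I)) = 2.
  rewrite (fine_leb2_setD mI mP IP PM) !leb2X; try exact: measurable_itv.
  by rewrite !lebesgue_measure_itv /= !lte_fin !ifT //=; lra.
move=> e2; apply: (@lt_le_trans _ _ (1 * fine (leb2 (P `\` I)))); first by rewrite e2; lra.
rewrite -Rintegral_cst //; apply: le_Rintegral => //.
- apply: measurable_bounded_integrable => //; first exact: leb2_bounded mD DM.
  exact: bounded_cst.
- exact: integrable_fst mD DM.
move=> z [/rectangleP[? ? ? ?] nI].
by rewrite leNgt; apply/negP => x3; apply: nI; apply/rectangleP; split=> //; exact: ltW.
Qed.

End PlaneMeasure.

(** * The Hausdorff metric *)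

Section Hausdorff.
Variable R : realType.
Local Notation pt := (R * R)%type.
Implicit Types (P Q K L : set pt) (x y z v : pt) (c d e : R).
Local Notation edist := (@Defs.edist R).

Lemma edist_ge0 x y : 0 <= edist x y. Proof. exact: sqrtr_ge0. Qed.

Lemma edist_le x y d : `|x.1 - y.1| <= d -> `|x.2 - y.2| <= d -> edist x y <= 2 * d.
Proof.
move=> h1 h2; have d0 : 0 <= d by exact: le_trans h1.
rewrite -(@ger0_norm _ (2 * d)) ?mulr_ge0 // -sqrtr_sqr; apply: ler_wsqrtr.
have := lerXn2r 2 (normr_ge0 _ : _ \in Num.nneg) (d0 : d \in Num.nneg) h1.
have := lerXn2r 2 (normr_ge0 _ : _ \in Num.nneg) (d0 : d \in Num.nneg) h2.
rewrite !real_normK ?num_real // exprMn; have := sqr_ge0 d; lra.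
Qed.

Lemma coord_le_edist x y : `|x.1 - y.1| <= edist x y /\ `|x.2 - y.2| <= edist x y.
Proof. by have := norm_le_edist (x.1 - y.1, x.2 - y.2); rewrite /Defs.edist /= !subr0. Qed.

Lemma dist_to_le x y L : L y -> dist_to x L <= edist x y.
Proof.
move=> Ly; apply: ge_inf; last by exists y.
by exists 0 => _ [z _ <-]; exact: edist_ge0.
Qed.

Lemma hausdorff_le K L d : K !=set0 -> L !=set0 ->
  (forall x, K x -> exists2 y, L y & edist x y <= d) ->
  (forall y, L y -> exists2 x, K x & edist y x <= d) -> hausdorff K L <= d.
Proof.
move=> [k Kk] [l Ll] KL LK; rewrite ge_max; apply/andP; split; apply: ge_sup.
- by exists (dist_to k L), k.
- by move=> _ [x /KL[y Ly xy] <-]; exact: le_trans (dist_to_le x Ly) xy.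
- by exists (dist_to l K), l.
- by move=> _ [x /LK[y Ly xy] <-]; exact: le_trans (dist_to_le x Ly) xy.
Qed.

Let lt_dist_to x L d : L !=set0 -> dist_to x L < d -> exists2 y, L y & edist x y < d.
Proof.
move=> [l Ll] xd; have hi : has_inf [set edist x y | y in L].
  by split; [exists (edist x l), l|exists 0 => _ [z _ <-]; exact: edist_ge0].
have d0 : 0 < d - dist_to x L by rewrite subr_gt0.
have [_ [y Ly <-] xy] := inf_adherent d0 hi; exists y => //.
by rewrite (lt_le_trans xy) // /dist_to addrC subrK.
Qed.

Let dist_to_ubound K L M l : L l -> K `<=` pbox M ->
  has_ubound [set dist_to x L | x in K].
Proof.
move=> Ll KM; exists (2 * (M + `|l.1| + `|l.2|)) => _ [x /KM[x1 x2] <-].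
apply: (le_trans (dist_to_le x Ll)); apply: edist_le.
  by rewrite (le_trans (ler_normB _ _)) //; have := normr_ge0 l.2; lra.
by rewrite (le_trans (ler_normB _ _)) //; have := normr_ge0 l.1; lra.
Qed.

Lemma hausdorff_lt P Q d : Po P -> Po Q -> hausdorff P Q < d ->
  (forall x, P x -> exists2 y, Q y & edist x y < d) /\
  (forall y, Q y -> exists2 x, P x & edist y x < d).
Proof.
move=> PP PQ; have [M [_ PM]] := Po_bounded PP; have [N [_ QN]] := Po_bounded PQ.
have P0 := Po0 PP; have Q0 := Po0 PQ.
rewrite gt_max => /andP[h1 h2]; split=> [x Px|y Qy]; apply: lt_dist_to.
- by exists (0, 0).
- apply: le_lt_trans h1; apply: ub_le_sup; last by exists x.
  exact: dist_to_ubound Q0 PM.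
- by exists (0, 0).
- apply: le_lt_trans h2; apply: ub_le_sup; last by exists y.
  exact: dist_to_ubound P0 QN.
Qed.

(** A multiplicative substitute for Hausdorff closeness. Around polygons containing the origin in
    their interior it gives the same neighbourhoods, and polarity preserves it, so that the
    continuity of the polar moment follows from that of the moment. *)
Definition radially_close c P Q := P `<=` vscale c @` Q /\ Q `<=` vscale c @` P.

Lemma vscaleP c P x : 0 < c -> (vscale c @` P) x <-> P (vscale c^-1 x).
Proof. by move=> c0; rewrite image_vscale ?lt0r_neq0. Qed.

Lemma radially_close_hausdorff P Q M c : P `<=` pbox M -> Q `<=` pbox M -> 1 < c ->
  P !=set0 -> Q !=set0 -> radially_close c P Q -> hausdorff P Q <= 2 * ((c - 1) * M).
Proof.
move=> PM QM c1 P0 Q0 [PQ QP]; have c0 : 0 < c by lra.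
have H u : `|u| <= M -> `|u - c^-1 * u| <= (c - 1) * M.
  move=> uM; have -> : u - c^-1 * u = c^-1 * (c - 1) * u by field; rewrite lt0r_neq0.
  rewrite !normrM gtr0_norm ?invr_gt0 // gtr0_norm ?subr_gt0 // -mulrA.
  have M0 : 0 <= M by apply: le_trans uM.
  have cM : 0 <= (c - 1) * M by rewrite mulr_ge0 // subr_ge0 ltW.
  rewrite ler_pdivrMl // (le_trans _ (ler_peMl cM (ltW c1))) //.
  by rewrite ler_wpM2l // subr_ge0 ltW.
have D x : pbox M x -> edist x (vscale c^-1 x) <= 2 * ((c - 1) * M).
  by move=> [x1 x2]; apply: edist_le; exact: H.
apply: hausdorff_le => // x hx; exists (vscale c^-1 x).
- exact/vscaleP/PQ.
- exact/D/PM.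
- exact/vscaleP/QP.
- exact/D/QM.
Qed.

(** Closeness in Minkowski form: as [P] contains a box of radius [e], a displacement shorter than
    [d] is an element of [P] scaled by [d / e]. *)
Let hausdorff_shift P Q e d x : Po P -> 0 < e ->
  (forall x, `|x.1| <= e -> `|x.2| <= e -> P x) -> 0 < d ->
  (exists2 z, Q z & edist x z < d) ->
  exists z w, [/\ Q z, P w, x.1 = z.1 + d / e * w.1 & x.2 = z.2 + d / e * w.2].
Proof.
move=> PP e0 eP d0 [z Qz xz]; have [h1 h2] := coord_le_edist x z.
have H u : `|u| <= edist x z -> `|e / d * u| <= e.
  move=> uz; rewrite normrM gtr0_norm ?divr_gt0 // mulrAC ler_pdivrMr //.
  by rewrite ler_pM2l // (le_trans uz) // ltW.
exists z, (e / d * (x.1 - z.1), e / d * (x.2 - z.2)); split=> //=.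
- by apply: eP; exact: H.
- by field; rewrite !lt0r_neq0.
- by field; rewrite !lt0r_neq0.
Qed.

Lemma hausdorff_radially_close P c : Po P -> 1 < c ->
  exists2 d, 0 < d & forall Q, Po Q -> hausdorff P Q < d -> radially_close c P Q.
Proof.
move=> PP c1; have c0 : 0 < c by lra.
have [e [e0 eP]] := Po_ball PP.
pose r := (c - 1) / c; have r0 : 0 < r by rewrite divr_gt0 // subr_gt0.
have rE : r * c = c - 1 by rewrite divfK // lt0r_neq0.
exists (r * e) => [|Q PQ]; first exact: mulr_gt0.
have d0 : 0 < r * e by exact: mulr_gt0.
have re : r * e / e = r by rewrite mulfK // lt0r_neq0.
move=> /(hausdorff_lt PP PQ)[PtoQ QtoP].
have {}PtoQ x Px := hausdorff_shift PP e0 eP d0 (PtoQ x Px).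
have {}QtoP x Qx := hausdorff_shift PP e0 eP d0 (QtoP x Qx).
rewrite re in PtoQ QtoP; split=> x hx; apply/vscaleP => //.
  (* [P] lies in [Q + r P]. For a normal [y] of [Q] the support functions give [h_P <= 1 + r h_P],
     that is, [h_P <= c], because [1 - r] is the inverse of [c]; the maximum of [dot y] on [P] is
     attained at [v]. *)
  have [s sP] := PP.1; have [ys [M [QE _]]] := (PoP Q).1 PQ; rewrite QE => y yy.
  have s0 : s != [::].
    apply/eqP => s0; have := Po0 PP; rewrite sP s0 => /conv_hullP[_ /eqP].
    by rewrite oner_eq0.
  have [v vs vmax] := seq_argmax (dot y) s0.
  have Pv : P v by rewrite sP; exact: conv_hull_mem.
  have xv : dot y x <= dot y v by rewrite sP in hx; exact: conv_hull_le hx.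
  have [z [w [Qz Pw v1 v2]]] := PtoQ v Pv.
  have wv : dot y w <= dot y v by rewrite sP in Pw; exact: conv_hull_le Pw.
  have zy : dot y z <= 1 by rewrite QE in Qz; exact: Qz.
  have vE : dot y v = dot y z + r * dot y w by rewrite /dot v1 v2; ring.
  have : (1 - r) * dot y v <= 1 by have := ler_wpM2l (ltW r0) wv; lra.
  have -> : 1 - r = c^-1 by rewrite /r; field; rewrite lt0r_neq0.
  move=> h; rewrite (_ : dot y _ = c^-1 * dot y x); last by rewrite /dot /=; ring.
  by rewrite (le_trans _ h) // ler_wpM2l // invr_ge0 ltW.
(* Conversely [Q] lies in [P + r P], which is [(1 + r) P] by convexity, and [1 + r <= c]. *)
have [z [w [Pz Pw x1 x2]]] := QtoP x hx.
have r1 : 0 < 1 + r by lra.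
have P0 := Po0 PP.
have Pu : P ((1 + r)^-1 * x.1, (1 + r)^-1 * x.2).
  have a01 : 0 <= (1 + r)^-1 <= 1 by rewrite invr_ge0 ltW //= invf_le1 // lerDl ltW.
  have := Po_convex PP Pz Pw a01; congr (P (_, _)); rewrite ?x1 ?x2; field; rewrite lt0r_neq0 //.
have k01 : 0 <= c^-1 * (1 + r) <= 1.
  rewrite mulr_ge0 ?invr_ge0 ?(ltW c0) ?(ltW r1) //= ler_pdivrMl // mulr1.
  by have := ler_wpM2l (ltW r0) (ltW c1); rewrite rE; lra.
have := Po_convex PP Pu P0 k01; congr (P _); rewrite /vscale /= !mulr0 !addr0.
by congr pair; field; rewrite !lt0r_neq0.
Qed.

End Hausdorff.

(** * Continuity and measurability *)

Section Continuity.
Variable R : realType.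
Local Notation pt := (R * R)%type.
Local Notation mR := (measurableTypeR R).
Implicit Types (P Q : set pt) (mu : set pt -> pt) (F G : set pt -> R).

Lemma measurable_hps (ys : seq pt) : measurable (hps ys : set (mR * mR)).
Proof.
elim: ys => [|y ys IH].
  by rewrite (_ : hps _ = setT) //; apply/seteqP; split=> x // _ z.
rewrite -cat1s hpsI; apply: measurableI => //.
rewrite (_ : hps _ = (fun x : mR * mR => y.1 * x.1 + y.2 * x.2 : mR) @^-1` `]-oo, 1]).
  rewrite -[X in measurable X]setTI.
  exact: (measurable_linear y.1 y.2 (@measurableT _ _) (measurable_itv `]-oo, 1])).
apply/seteqP; split=> x /=; rewrite in_itv /=; first by apply; rewrite mem_head.
by move=> h z; rewrite inE => /eqP->.
Qed.

Lemma Po_measurable_set P : Po P -> measurable (P : set (mR * mR)).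
Proof. by move=> /PoP[ys [M [-> _]]]; exact: measurable_hps. Qed.

Definition Po_continuous F := forall P, Po P -> forall e, 0 < e ->
  exists2 c, 1 < c & forall Q, Po Q -> radially_close c P Q -> `|F Q - F P| < e.

Lemma radially_close_le (c d : R) P Q : Po P -> Po Q -> 0 < c -> c <= d ->
  radially_close c P Q -> radially_close d P Q.
Proof.
move=> PP PQ c0 cd; have d0 : 0 < d by lra.
have H K L : Po L -> K `<=` vscale c @` L -> K `<=` vscale d @` L.
  move=> PL KL x /KL /(vscaleP _ _ c0) Lx; apply/vscaleP => //.
  have a01 : 0 <= c / d <= 1.
    by rewrite divr_ge0 ?(ltW c0) ?(ltW d0) //= ler_pdivrMr // mul1r.
  have := Po_convex PL Lx (Po0 PL) a01; congr (L _); rewrite /vscale /= !mulr0 !addr0.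
  by congr pair; field; rewrite !lt0r_neq0.
by move=> [h1 h2]; split; exact: H.
Qed.

Lemma Po_continuous_linear a b F G : Po_continuous F -> Po_continuous G ->
  Po_continuous (fun P => a * F P + b * G P).
Proof.
move=> cF cG P PP e e0; pose m := 1 + `|a| + `|b|.
have m0 : 0 < m by rewrite ltr_wpDr // ltr_wpDr.
have em : 0 < e / m by rewrite divr_gt0.
have [c c1 hF] := cF P PP _ em; have [d d1 hG] := cG P PP _ em.
exists (Num.min c d) => [|Q PQ PQc]; first by rewrite lt_min c1.
have cd0 : 0 < Num.min c d by rewrite lt_min !(lt_trans ltr01).
have [mc md] : Num.min c d <= c /\ Num.min c d <= d by rewrite !ge_min !lexx orbT.
have h1 := hF Q PQ (radially_close_le PP PQ cd0 mc PQc).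
have h2 := hG Q PQ (radially_close_le PP PQ cd0 md PQc).
have -> : a * F Q + b * G Q - (a * F P + b * G P) = a * (F Q - F P) + b * (G Q - G P) by ring.
rewrite (le_lt_trans (ler_normD _ _)) // !normrM.
have eE : e = e / m + `|a| * (e / m) + `|b| * (e / m).
  by rewrite /m; field; rewrite lt0r_neq0.
have := ler_wpM2l (normr_ge0 a) (ltW h1); have := ler_wpM2l (normr_ge0 b) (ltW h2); lra.
Qed.

Lemma radially_close_polar c P Q : 0 < c ->
  radially_close c P Q -> radially_close c (polar P) (polar Q).
Proof.
move=> c0; have H K L : K `<=` vscale c @` L -> polar L `<=` vscale c @` polar K.
  move=> KL y yL; apply/vscaleP => // x /KL[z Lz <-].
  have := yL z Lz; congr (_ <= _); rewrite /dot /vscale /=; field; exact: lt0r_neq0.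
by move=> [h1 h2]; split; exact: H.
Qed.

Lemma Po_continuous_polar F : Po_continuous F -> Po_continuous (F \o @polar R).
Proof.
move=> cF P PP e e0; have [c c1 h] := cF _ (Po_polar PP) e e0; exists c => // Q PQ PQc.
by apply: h; [exact: Po_polar|apply: radially_close_polar => //; rewrite (lt_trans ltr01)].
Qed.

Lemma Po_continuous_moment : Po_continuous (fun P => (moment P).1) /\
  Po_continuous (fun P => (moment P).2).
Proof.
suff H P : Po P -> forall e, 0 < e -> exists2 c, 1 < c &
    forall Q, Po Q -> radially_close c P Q ->
      `|(moment Q).1 - (moment P).1| < e /\ `|(moment Q).2 - (moment P).2| < e.
  by split=> P PP e e0; have [c c1 h] := H P PP e e0; exists c => // Q PQ /(h Q PQ)[].
move=> PP e e0; have [M [M0 PM]] := Po_bounded PP.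
have mP := Po_measurable_set PP.
pose l := fine (leb2 P); have l0 : 0 <= l by rewrite fine_ge0.
(* The areas of the dilates of [P] by [1 + u] and by its inverse differ by at most [5 u l]. Times
   the bound [2 M] of the coordinates, this has to stay below [e / 2]. *)
pose m := 1 + 20 * M * l; have m0 : 0 < m.
  by rewrite ltr_wpDr // !mulr_ge0 // ltW.
pose u := Num.min 1 (e / m); have u0 : 0 < u by rewrite lt_min ltr01 divr_gt0.
have u1 : u <= 1 by rewrite ge_min lexx.
have um : u * m <= e by rewrite -ler_pdivlMr // ge_min lexx orbT.
exists (1 + u) => [|Q PQ [PcQ QcP]]; first by rewrite ltrDl.
have c0 : 0 < 1 + u by lra.
have mQ := Po_measurable_set PQ.
have cV0 : 0 < (1 + u)^-1 by rewrite invr_gt0.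
have cN := lt0r_neq0 c0.
pose S := vscale (1 + u) @` P; pose I := vscale (1 + u)^-1 @` P.
have mS : measurable (S : set (mR * mR)) by apply: measurable_image_vscale.
have mI : measurable (I : set (mR * mR)).
  by apply: measurable_image_vscale => //; rewrite invr_eq0.
have IQ : I `<=` Q.
  move=> x /(vscaleP _ _ cV0); rewrite invrK => /PcQ /(vscaleP _ _ c0).
  by rewrite /vscale /= !mulKf //; case: x.
have SM : S `<=` pbox (2 * M).
  move=> x /(vscale_pbox c0 PM)[x1 x2].
  have h : (1 + u) * M <= 2 * M by rewrite ler_wpM2r ?(ltW M0) //; lra.
  by split; [exact: le_trans x1 h|exact: le_trans x2 h].
have PPc : radially_close (1 + u) P P.
  suff H : P `<=` vscale (1 + u) @` P by [].
  move=> x Px; apply/vscaleP => //.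
  have a01 : 0 <= (1 + u)^-1 <= 1 by rewrite (ltW cV0) /= invf_le1 // lerDl ltW.
  by have := Po_convex PP Px (Po0 PP) a01; rewrite /vscale /= !mulr0 !addr0.
have [PS _] := PPc.
have IP : I `<=` P.
  move=> x /(vscaleP _ _ cV0); rewrite invrK => /PS /(vscaleP _ _ c0).
  by rewrite /vscale /= !mulKf //; case: x.
have M2 : 0 <= 2 * M by rewrite mulr_ge0 // ltW.
have [q1 q2] := moment_sandwich M2 mI mQ mS IQ QcP SM.
have [p1 p2] := moment_sandwich M2 mI mP mS IP PS SM.
have vE : fine (leb2 S) - fine (leb2 I) <= 5 * u * l.
  rewrite (fine_leb2_vscale c0 mP PM) (fine_leb2_vscale cV0 mP PM) -/l -mulrBl.
  rewrite ler_wpM2r // exprVn.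
  have : 1 - 2 * u <= ((1 + u) ^+ 2)^-1.
    have s0 : 0 < (1 + u) ^+ 2 by rewrite exprn_gt0.
    rewrite -[_^-1]mul1r ler_pdivlMr //.
    have u2 : 0 <= u ^+ 2 by exact: sqr_ge0.
    have u3 : 0 <= u ^+ 3 by rewrite exprn_ge0 // ltW.
    clear -u2 u3.
    by have -> : (1 - 2 * u) * (1 + u) ^+ 2 = 1 - 3 * u ^+ 2 - 2 * u ^+ 3; [ring|lra].
  have : u ^+ 2 <= u by rewrite expr2 ler_piMl // ltW.
  clear; by have -> : (1 + u) ^+ 2 = 1 + 2 * u + u ^+ 2; [ring|lra].
have D : 2 * M * (fine (leb2 S) - fine (leb2 I)) < e / 2.
  apply: (le_lt_trans (ler_wpM2l M2 vE)).
  have ml : u * m = u + 2 * (2 * M * (5 * u * l)) by rewrite /m; ring.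
  clear -u0 um ml; lra.
have tri (x y z : R) : `|x - z| < e / 2 -> `|y - z| < e / 2 -> `|x - y| < e.
  move=> xz yz; have -> : x - y = (x - z) - (y - z) by ring.
  rewrite (le_lt_trans (ler_normB _ _)) // [e]splitr; exact: ltrD.
by split; [apply: (tri _ _ (moment I).1)|apply: (tri _ _ (moment I).2)]; exact: le_lt_trans D.
Qed.

Lemma Po_continuous_open F (U : set R) : Po_continuous F -> open U ->
  hausdorff_open (@Po R `&` F @^-1` U).
Proof.
move=> cF oU; split=> [P []//|P [PP PU]].
have /nbhs_ballP[e /= e0 eU] : nbhs (F P) U by rewrite nbhsE; exists U.
have [c c1 h] := cF P PP e e0.
have [d d0 hd] := hausdorff_radially_close PP c1.
exists d; split=> // Q PQ PQd; split=> //=; apply: eU.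
by rewrite /ball /= distrC; apply: h => //; exact: hd.
Qed.

Let Po_borel_sigma : sigma_algebra (@Po R) (@Po_borel R).
Proof. exact: smallest_sigma_algebra. Qed.

Let Po_borelI (A B : set (set pt)) : Po_borel (@Po R `&` A) -> Po_borel (@Po R `&` B) ->
  Po_borel ((@Po R `&` A) `&` (@Po R `&` B)).
Proof.
have [S0 SC SU] := Po_borel_sigma => /SC hA /SC hB.
pose T n := if n == 0%N then @Po R `\` (@Po R `&` A) else @Po R `\` (@Po R `&` B).
have /SU/SC : forall n, Po_borel (T n) by move=> [|n].
congr Po_borel; apply/seteqP; split=> [P [PP H]|P [[PP PA] [_ PB]]].
  by split; split=> //; apply: contrapT => n; apply: H;
    [exists 0%N|exists 1%N] => //; rewrite /T /=; split=> // -[].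
by split=> // -[[|n] _]; rewrite /T /= => -[_]; apply.
Qed.

Lemma Po_continuous_preimage F (B : set mR) : Po_continuous F -> measurable B ->
  Po_borel (@Po R `&` F @^-1` B).
Proof.
move=> cF; rewrite RGenOInfty.measurableE.
have [S0 SC SU] := Po_borel_sigma.
pose C := [set A : set R | Po_borel (@Po R `&` F @^-1` A)].
suff : <<s @RGenOInfty.G R >> `<=` C by apply.
apply: smallest_sub; first split.
- by rewrite /C /= preimage_set0 setI0.
- move=> A /SC; rewrite /C /=; congr Po_borel; apply/seteqP; split=> Q /=.
    by move=> [PQ nA]; split=> //; split=> // FA; apply: nA.
  by move=> [PQ [_ nA]]; split=> // -[].
- move=> A hA; rewrite /C /= preimage_bigcup setI_bigcupr; exact: SU.
move=> _ [a ->]; rewrite /C /=; apply: sub_sigma_algebra.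
by apply: Po_continuous_open => //; exact: itv_open.
Qed.

Lemma Po_continuous_measurable mu : Po_continuous (fun P => (mu P).1) ->
  Po_continuous (fun P => (mu P).2) -> Po_measurable mu.
Proof.
move=> c1 c2 B; have [S0 SC SU] := Po_borel_sigma.
pose C := [set A : set pt | Po_borel (@Po R `&` mu @^-1` A)].
rewrite measurable_prod_measurableType => mB.
suff : <<s [set A `*` A' | A in measurable & A' in measurable] >> `<=` C by apply.
apply: smallest_sub; first split.
- by rewrite /C /= preimage_set0 setI0.
- move=> A /SC; rewrite /C /=; congr Po_borel; apply/seteqP; split=> Q /=.
    by move=> [PQ nA]; split=> //; split=> // FA; apply: nA.
  by move=> [PQ [_ nA]]; split=> // -[].
- move=> A hA; rewrite /C /= preimage_bigcup setI_bigcupr; exact: SU.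
move=> _ [A mA [A' mA' <-]]; rewrite /C /=.
rewrite (_ : _ `&` _ = (@Po R `&` (fun P => (mu P).1) @^-1` A) `&` (@Po R `&` (fun P => (mu P).2) @^-1` A')).
  by apply: Po_borelI; apply: Po_continuous_preimage.
by apply/seteqP; split=> Q /=; [move=> [? [? ?]]|move=> [[? ?] [? ?]]].
Qed.

(** For a fixed polygon, [t |-> cut t] is continuous for the Hausdorff metric, so its composite with
    a Borel map is Borel. *)
Lemma Po_measurable_cut mu P (y z : pt) : Po P -> Po_measurable mu ->
  let cut t := P `&` hps [:: (y.1 + t * z.1, y.2 + t * z.2)] in
  measurable_fun [set: mR] (fun t : mR => (mu (cut t)).1 : mR) /\
  measurable_fun [set: mR] (fun t : mR => (mu (cut t)).2 : mR).
Proof.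
move=> PP mmu cut; have Pcut t : Po (cut t) by exact: Po_cap_hps.
have key U : Po_borel U -> measurable (cut @^-1` U : set mR).
  pose C := [set A : set (set pt) | measurable (cut @^-1` A : set mR)].
  suff : @Po_borel R `<=` C by apply.
  apply: smallest_sub; first split.
  - by rewrite /C /= preimage_set0.
  - move=> A; rewrite /C /= => mA.
    rewrite (_ : cut @^-1` _ = ~` (cut @^-1` A)); first exact: measurableC.
    by apply/seteqP; split=> t /=; [case|split].
  - by move=> A hA; rewrite /C /= preimage_bigcup; apply: bigcup_measurable => k _; exact: hA.
  move=> A [APo oA]; rewrite /C /=; apply: open_measurable.
  rewrite openE => t /oA[e [e0 he]].
  have [M [M0 PM]] := Po_bounded PP.
  pose C' := 1 + (`|z.1| + `|z.2|) * M; have C0 : 0 < C'.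
    by rewrite ltr_pwDl // mulr_ge0 ?addr_ge0 // ltW.
  pose h := e / (4 * M); have h0 : 0 < h by rewrite divr_gt0 // mulr_gt0.
  (* [C'] bounds [dot z x] on [P], so a change of the parameter by [h / C'] moves the constraint by
     at most [h], which a dilation by [1 + h] absorbs. *)
  have close a b : `|a - b| <= h / C' -> cut a `<=` vscale (1 + h) @` cut b.
    move=> ab x [Px xa]; have c0 : 0 < 1 + h by lra.
    have cV0 : 0 < (1 + h)^-1 by rewrite invr_gt0.
    apply/vscaleP => //; split=> [|w].
      have a01 : 0 <= (1 + h)^-1 <= 1 by rewrite (ltW cV0) /= invf_le1 // lerDl ltW.
      by have := Po_convex PP Px (Po0 PP) a01; rewrite /vscale /= !mulr0 !addr0.
    rewrite inE => /eqP ->; have {}xa := xa _ (mem_head _ _).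
    have zx : `|dot z x| <= C'.
      rewrite (le_trans (ler_normD _ _)) // !normrM; have [x1 x2] := PM x Px.
      by have := ler_wpM2l (normr_ge0 z.1) x1; have := ler_wpM2l (normr_ge0 z.2) x2; rewrite /C'; lra.
    have : `|(b - a) * dot z x| <= h.
      rewrite normrM distrC; apply: (le_trans (ler_wpM2l (normr_ge0 _) zx)).
      by rewrite -ler_pdivlMr.
    rewrite ler_norml => /andP[_ ab'].
    rewrite (_ : dot _ _ = (1 + h)^-1 * (dot (y.1 + a * z.1, y.2 + a * z.2) x
      + (b - a) * dot z x)); last by rewrite /dot /=; ring.
    by rewrite ler_pdivrMl // mulr1 lerD.
  exists (h / C'); first by rewrite /= divr_gt0.
  move=> t' /= tt'; apply: he => //.
  have ne a : cut a !=set0 by exists (0, 0); exact: Po0.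
  have cM a : cut a `<=` pbox M by move=> x [/PM].
  have h1 : 1 < 1 + h by lra.
  have := radially_close_hausdorff (cM t) (cM t') h1 (ne t) (ne t').
  have -> : 2 * ((1 + h - 1) * M) = e / 2 by rewrite /h; field; rewrite lt0r_neq0.
  move=> /(_ _)/le_lt_trans; apply; last lra.
  by split; apply: close; rewrite ?(distrC t') ltW.
have mk (f : pt -> mR) : measurable_fun [set: mR * mR] f ->
    measurable_fun [set: mR] (fun t : mR => f (mu (cut t))).
  move=> mf _ Y mY; rewrite setTI.
  have mB := mmu _ (mf measurableT Y mY); rewrite setTI in mB.
  have := key _ mB; congr measurable; apply/seteqP; split=> t /=; [by case|by split].
by split; apply: mk; [exact: measurable_fst|exact: measurable_snd].
Qed.

End Continuity.

(** * Cauchy's functional equation *)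

Section Additive.
Variable R : realType.
Local Notation mR := (measurableTypeR R).
Local Notation leb := (@lebesgue_measure R).
Let additive (h : R -> R) := forall x y : R, 0 < x -> 0 < y -> h (x + y) = h x + h y.

(** From [h 1 = 0] and three doublings [h] vanishes at 1/8, so it has period 1/8 and the bound near
    0 holds on all positive numbers. Then [h (n x) = n h x] stays bounded, which forces
    [h x = 0]. *)
Let bounded_additive (h : R -> R) (C : R) : additive h -> h 1 = 0 ->
  (forall x, 0 < x -> x < 4^-1 -> `|h x| <= C) -> forall x, 0 < x -> h x = 0.
Proof.
move=> hD h1 hC.
have h8 x : 0 < x -> h (x + 8^-1) = h x.
  move=> x0; rewrite hD //; apply/eqP; rewrite -subr_eq0 addrC addKr; apply/eqP.
  have e2 (y : R) : 0 < y -> h (y + y) = 2 * h y by move=> y0; rewrite hD //; ring.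
  have := e2 8^-1 ltac:(lra); have := e2 (8^-1 + 8^-1) ltac:(lra).
  have := e2 (8^-1 + 8^-1 + (8^-1 + 8^-1)) ltac:(lra).
  have -> : 8^-1 + 8^-1 + (8^-1 + 8^-1) + (8^-1 + 8^-1 + (8^-1 + 8^-1)) = 1 :> R by field.
  rewrite h1; lra.
have hb x : 0 < x -> `|h x| <= C.
  move=> x0; have [n xn] : exists n : nat, x <= n.+1%:R / 8.
    exists (Num.bound (8 * x)); rewrite ler_pdivlMr // mulrC.
    apply: (le_trans (ltW (archi_boundP _))); first by rewrite mulr_ge0 // ltW.
    by rewrite ler_nat.
  elim: n x x0 xn => [|n IH] x x0 xn; first by apply: hC => //; lra.
  have [x1|x1] := leP x (n.+1%:R / 8); first exact: IH.
  have n0 : 0 <= n%:R :> R by [].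
  have x8 : 0 < x - 8^-1 by move: x1; rewrite -natr1; lra.
  have -> : h x = h (x - 8^-1) by rewrite -(h8 (x - 8^-1)) // subrK.
  by apply: IH => //; move: xn; rewrite -[n.+2%:R]natr1; lra.
move=> x x0; apply/eqP; rewrite -normr_le0; apply/ler_addgt0Pr => e e0; rewrite add0r.
have C0 : 0 <= C by apply: le_trans (hb 1 ltr01).
have hn n : h (n.+1%:R * x) = n.+1%:R * h x.
  elim: n => [|n IH]; first by rewrite !mul1r.
  rewrite -natr1 !mulrDl !mul1r hD ?IH // mulr_gt0 //.
pose n := Num.bound (C / e); have nC : C / e < n.+1%:R.
  apply: (lt_le_trans (archi_boundP _)); first by rewrite divr_ge0 // ltW.
  by rewrite ler_nat.
have := hb (n.+1%:R * x) ltac:(by rewrite mulr_gt0).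
rewrite hn normrM gtr0_norm //; move: nC; rewrite ltr_pdivrMr // => nC nx.
have : n.+1%:R * `|h x| <= n.+1%:R * e by exact: le_trans nx (ltW nC).
by rewrite ler_pM2l.
Qed.

(* For [n] large [E n] fills more than 3/4 of [0, 1], hence meets its translate
   by any [t < 1/4]. *)
Let measurable_bounded (h : R -> R) : additive h -> measurable_fun (`]0, 1[ : set mR) (h : mR -> mR) ->
  exists C, forall x, 0 < x -> x < 4^-1 -> `|h x| <= C.
Proof.
move=> hD mh; pose E (n : nat) : set mR := `]0, 1[ `&` [set x | `|h x| <= n%:R].
have mE n : measurable (E n).
  have -> : E n = `]0, 1[ `&` h @^-1` `[- n%:R, n%:R].
    by apply/seteqP; split=> x /= [? ?]; split=> //=; rewrite ?in_itv /= ?ler_norml // -ler_norml.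
  by apply: mh; [exact: measurable_itv|exact: measurable_itv].
have UE : \bigcup_n E n = `]0, 1[%classic.
  apply/seteqP; split=> x; first by move=> [n _ []].
  move=> x01; exists (Num.bound (`|h x|)) => //; split=> //=.
  by apply/ltW/archi_boundP.
have [n En] : exists n, (leb (E n) > (3 / 4)%:E)%E.
  apply: contrapT => /forallNP nE.
  have ndE : nondecreasing_seq E.
    move=> m n mn; apply/subsetPset => x [x01 xm]; split=> //=.
    by rewrite (le_trans xm) // ler_nat.
  have cv : leb \o E @ \oo --> leb (\bigcup_n E n).
    by apply: nondecreasing_cvg_mu => //; rewrite UE; exact: measurable_itv.
  have : (lim (leb \o E @ \oo) <= (3 / 4)%:E)%E.
    apply: lime_le; first by apply/cvg_ex; exists (leb (\bigcup_n E n)).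
    by apply: nearW => n /=; rewrite leNgt; apply/negP/nE.
  rewrite (cvg_lim _ cv) // UE lebesgue_measure_itv /= lte_fin ltr01 -EFinB lee_fin; lra.
exists (n%:R + n%:R) => t t0 t4.
suff [x [x0 [Ex Et]]] : exists x, 0 < x /\ E n x /\ E n (x + t).
  have -> : h t = h (x + t) - h x by rewrite hD // addrC addKr.
  by rewrite (le_trans (ler_normB _ _)) // lerD //; [exact: Et.2|exact: Ex.2].
apply: contrapT => nEx.
pose F : set mR := (fun y : R => y + t) @^-1` E n.
have mF : measurable F.
  have mt : measurable_fun [set: mR] (fun y : mR => y + t : mR) by exact: measurable_funD.
  by rewrite -[F]setTI; exact: mt.
have FE : leb F = leb (E n) by exact: (@lebesgue_measure_translate R t (E n) (mE n)).
have EF0 : E n `&` F = set0.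
  apply/seteqP; split=> x // [Ex Fx]; apply: nEx; exists x; split=> //.
  by have [] := Ex; rewrite /= in_itv /= => /andP[].
(* Were the two sets disjoint, a total length above 3/2 would fit into an interval of length 5/4. *)
have sub : E n `|` F `<=` `]- 4^-1, 1[%classic.
  move=> x [[]|[]] /=; rewrite !in_itv /= => /andP[x0 x1] _; apply/andP; split; lra.
have := le_measure leb (mem_set (measurableU _ _ (mE n) mF))
          (mem_set (measurable_itv `]- 4^-1, 1[)) sub.
have mU : leb (E n `|` F) = (leb (E n) + leb (E n))%E.
  by rewrite -{2}FE; exact: measureU.
move=> /(le_trans (_ : (leb (E n) + leb (E n) <= leb (E n `|` F))%E)).
rewrite {1}mU lexx => /(_ isT) le54.
have : ((3 / 4)%:E + (3 / 4)%:E < leb (E n) + leb (E n))%E by exact: lteD.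
have le5 : (leb (`](- 4^-1)%R, 1%R[)%classic <= (5 / 4)%:E)%E.
  by rewrite lebesgue_measure_itv /= lte_fin ifT ?lee_fin; lra.
by move=> /lt_le_trans/(_ (le_trans le54 le5)); rewrite -EFinD lte_fin; lra.
Qed.

Lemma measurable_additive_linear (h : R -> R) :
  (forall x y, 0 < x -> 0 < y -> h (x + y) = h x + h y) ->
  measurable_fun (`]0, 1[ : set mR) (h : mR -> mR) ->
  forall x, 0 < x -> h x = x * h 1.
Proof.
move=> hD mh x x0; have [C hC] := measurable_bounded hD mh.
apply/eqP; rewrite -subr_eq0; apply/eqP.
apply: (bounded_additive (h := fun x => h x - x * h 1) (C := C + `|h 1|)) => //.
- by move=> y z y0 z0; rewrite hD //; ring.
- by rewrite mul1r subrr.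
move=> y y0 y4; rewrite (le_trans (ler_normB _ _)) // lerD ?hC //.
by rewrite normrM gtr0_norm // ler_piMl //; lra.
Qed.

End Additive.

(** * Cutting off vertices *)

Section Ears.
Variable R : realType.
Local Notation pt := (R * R)%type.
Implicit Types (P Q : set pt) (a b c v x : pt) (mu : set pt -> pt) (t p q r s : R).

Definition dt x y : R := x.1 * y.2 - x.2 * y.1.

(** Twice the signed area of the triangle [a], [x], [b]. At the origin it is [- dt a b], so for
    [0 < dt a b] it is positive exactly beyond the line [ab]. *)
Definition side a b x : R := dt a x + dt x b - dt a b.

Definition below a b : set pt := [set x | side a b x <= 0].

Definition mix t a b : pt := ((1 - t) * a.1 + t * b.1, (1 - t) * a.2 + t * b.2).

Lemma side_mixl t a c b x : side (mix t a c) b x = (1 - t) * side a b x + t * side c b x.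
Proof. by rewrite /side /dt /=; ring. Qed.

Lemma side_mixr t a c b x : side b (mix t a c) x = (1 - t) * side b a x + t * side b c x.
Proof. by rewrite /side /dt /=; ring. Qed.

Lemma sidexx a x : side a a x = 0.
Proof. by rewrite /side /dt; ring. Qed.

Lemma below_hps a b : 0 < dt a b ->
  below a b = hps [:: ((b.2 - a.2) / dt a b, (a.1 - b.1) / dt a b)].
Proof.
move=> r0; have E x : (side a b x <= 0) =
    (dot ((b.2 - a.2) / dt a b, (a.1 - b.1) / dt a b) x <= 1).
  have -> : dot ((b.2 - a.2) / dt a b, (a.1 - b.1) / dt a b) x =
      (dt a x + dt x b) / dt a b by rewrite /dot /dt /=; ring.
  by rewrite ler_pdivrMr // mul1r subr_le0.
apply/seteqP; split=> x; rewrite /below /= E.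
  by move=> h y; rewrite inE => /eqP->.
by apply; rewrite mem_head.
Qed.

Lemma Po_below P a b : Po P -> 0 < dt a b -> Po (P `&` below a b).
Proof. by move=> PP ab; rewrite below_hps //; exact: Po_cap_hps. Qed.

(* [a], [v], [b] are consecutive vertices, in counterclockwise order, of a
   convex polygon around the origin. *)
Definition corner a v b := [/\ 0 < dt a v, 0 < dt v b, 0 < dt a b & 0 < side a b v].

Definition triangle a v b : set pt :=
  [set x | [/\ 0 <= side a b x, side a v x <= 0 & side v b x <= 0]].

(** [a] and [b] may be interior points of edges of [P]. The two conditions say that cutting [P]
    along [ab] removes exactly the part of the triangle beyond that line. *)
Definition ear P a v b :=
  triangle a v b `<=` P /\ P `<=` below a v `&` below v b.

Lemma triangle_barycentric a v b x : corner a v b -> triangle a v b x ->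
  exists l m n : R, [/\ [/\ 0 <= l, 0 <= m & 0 <= n], l + m + n = 1 &
    x = (l * a.1 + m * v.1 + n * b.1, l * a.2 + m * v.2 + n * b.2)].
Proof.
move=> [_ _ _ d0] [x1 x2 x3]; have dN := lt0r_neq0 d0.
exists (- side v b x / side a b v), (side a b x / side a b v), (- side a v x / side a b v).
rewrite !divr_ge0 ?oppr_ge0 ?(ltW d0) //.
move: dN; rewrite /side /dt => dN; split=> //; first by field.
by rewrite [x]surjective_pairing /=; congr pair; field.
Qed.

(** One concrete polygon with the prescribed ear; the box is large enough to contain the three
    points. *)
Definition ear_polygon a v b : set pt :=
  (pbox (1 + `|a.1| + `|a.2| + `|v.1| + `|v.2| + `|b.1| + `|b.2|) `&` below a v)
  `&` below v b.

Lemma Po_pbox (M : R) : 0 < M -> Po (pbox M : set pt).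
Proof.
move=> M0; apply/PoP; exists (cross M^-1), M; split=> //.
have E (u : R) : (M^-1 * u <= 1) = (u <= M) by rewrite ler_pdivrMl // mulr1.
apply/seteqP; split=> x.
  move=> [] ; rewrite !ler_norml => /andP[x1 x2] /andP[x3 x4] y.
  by rewrite !inE => /or4P[] /eqP->; rewrite /dot /= mul0r ?addr0 ?add0r ?mulNr -?mulrN E //; lra.
move=> h.
have := h (M^-1, 0) ltac:(by rewrite !inE eqxx ?orbT).
have := h (- M^-1, 0) ltac:(by rewrite !inE eqxx ?orbT).
have := h (0, M^-1) ltac:(by rewrite !inE eqxx ?orbT).
have := h (0, - M^-1) ltac:(by rewrite !inE eqxx ?orbT).
rewrite /dot /= !mul0r !addr0 !add0r !mulNr -!mulrN !E => *.
by split; rewrite ler_norml; apply/andP; split; lra.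
Qed.

Lemma ear_polygonP a v b : corner a v b ->
  Po (ear_polygon a v b) /\ ear (ear_polygon a v b) a v b.
Proof.
move=> C; have [p0 q0 r0 d0] := C; split.
  by do 2 apply: Po_below => //; apply: Po_pbox; rewrite !ltr_wpDr.
split=> x; last by move=> [[_ ?]].
move=> Tx; have [_ x2 x3] := Tx; split=> //; split=> //.
have [l [m [n [[l0 m0 n0] s1 ->]]]] := triangle_barycentric C Tx.
have H (k u : R) : 0 <= k -> k <= 1 -> `|k * u| <= `|u|.
  by move=> k0 k1; rewrite normrM ger0_norm // ler_piMl.
have T (y1 y2 y3 : R) : `|y1 + y2 + y3| <= `|y1| + `|y2| + `|y3|.
  by rewrite (le_trans (ler_normD _ _)) // lerD2r ler_normD.
have [l1 m1 n1] : [/\ l <= 1, m <= 1 & n <= 1] by split; lra.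
have [N1 N2 N3] := And3 (normr_ge0 a.1) (normr_ge0 v.1) (normr_ge0 b.1).
have [N4 N5 N6] := And3 (normr_ge0 a.2) (normr_ge0 v.2) (normr_ge0 b.2).
split=> /=; apply: (le_trans (T _ _ _)).
  by have := H l a.1 l0 l1; have := H m v.1 m0 m1; have := H n b.1 n0 n1; lra.
by have := H l a.2 l0 l1; have := H m v.2 m0 m1; have := H n b.2 n0 n1; lra.
Qed.

(* By [ear_valueE] any polygon with the ear [a v b] would do. *)
Definition ear_value mu a v b : pt :=
  mu (ear_polygon a v b) - mu (ear_polygon a v b `&` below a b).

Lemma vaddE x y : vadd x y = x + y. Proof. by []. Qed.

(** If [K] and [L] share the ear, then [K] is the union of its cut and [K & L], whose intersection
    is the cut of [K & L]. The valuation property equates the losses of [K] and of [K & L];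
    exchanging [K] and [L] finishes. *)
Lemma ear_valueE mu P a v b : is_valuation mu -> corner a v b -> Po P -> ear P a v b ->
  mu P - mu (P `&` below a b) = ear_value mu a v b.
Proof.
move=> mV C PP PE; have [QP QE] := ear_polygonP C.
rewrite /ear_value; move: (ear_polygon a v b) QP QE => Q QP QE.
have [_ _ r0 _] := C.
have key K L : Po K -> Po L -> ear K a v b -> ear L a v b ->
    mu K - mu (K `&` below a b) = mu (K `&` L) - mu (K `&` L `&` below a b).
  move=> PK PL [TK KW] [TL _].
  have := mV (K `&` below a b) (K `&` L) (Po_below PK r0) (PoI PK PL).
  have -> : K `&` below a b `|` K `&` L = K.
    apply/seteqP; split=> x; first by case=> -[].
    move=> Kx; have [x1 x2] := KW x Kx.
    have [h|h] := leP (side a b x) 0; first by left.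
    by right; split=> //; apply: TL; split=> //; exact: ltW.
  have -> : K `&` below a b `&` (K `&` L) = K `&` L `&` below a b.
    by apply/seteqP; split=> x; rewrite /setI /=; tauto.
  move=> /(_ PK (Po_below (PoI PK PL) r0)); rewrite !vaddE => e.
  by apply/eqP; rewrite subr_eq addrAC eq_sym subr_eq addrC -e addrC.
by rewrite (key P Q) // (key Q P) // [Q `&` P]setIC.
Qed.

Lemma ear_mixl P a v b t : 0 < t < 1 -> ear P a v b -> ear P (mix t a v) v b.
Proof.
move=> /andP[t0 t1] [QT QW]; have t2 : 0 < 1 - t by lra.
split=> x.
  rewrite /triangle /= !side_mixl sidexx mulr0 addr0 => -[x1 x2 x3]; apply: QT; rewrite pmulr_rle0 // in x2; split=> //.
  have : t * side v b x <= 0 by rewrite pmulr_rle0.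
  by rewrite -(pmulr_rge0 _ t2); lra.
by move=> /QW[x1 x2]; split=> //; rewrite /below /= side_mixl sidexx mulr0 addr0 pmulr_rle0.
Qed.

Lemma ear_mixr P a v b t : 0 < t < 1 -> ear P a v b -> ear P a v (mix t v b).
Proof.
move=> /andP[t0 t1] [QT QW]; have t2 : 0 < 1 - t by lra.
split=> x.
  rewrite /triangle /= !side_mixr sidexx mulr0 add0r => -[x1 x2 x3]; apply: QT; rewrite pmulr_rle0 // in x3; split=> //.
  have : (1 - t) * side a v x <= 0 by rewrite pmulr_rle0.
  by rewrite -(pmulr_rge0 _ t0); lra.
by move=> /QW[x1 x2]; split=> //; rewrite /below /= side_mixr sidexx mulr0 add0r pmulr_rle0.
Qed.

(** Cutting along [cb] and then along [ab] has the same result as cutting along [ab] at once, so the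
    losses telescope. *)
Lemma ear_value_cutl mu a v b t : is_valuation mu -> corner a v b -> 0 < t < 1 ->
  let c := mix t a v in [/\ corner c v b, corner a c b &
  ear_value mu a v b = ear_value mu c v b + ear_value mu a c b].
Proof.
move=> mV C /andP[t0 t1] c; have [p0 q0 r0 d0] := C.
have t2 : 0 < 1 - t by lra.
have C1 : corner c v b.
  split.
  - by have -> : dt c v = (1 - t) * dt a v by [rewrite /dt /=; ring]; exact: mulr_gt0.
  - exact: q0.
  - have -> : dt c b = (1 - t) * dt a b + t * dt v b by rewrite /dt /=; ring.
    by rewrite addr_gt0 // mulr_gt0.
  - by rewrite side_mixl (_ : side v b v = 0) ?mulr0 ?addr0 ?mulr_gt0 // /side /dt; ring.
have C2 : corner a c b.
  have [_ _ c0 _] := C1; split=> //.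
  - by have -> : dt a c = t * dt a v by [rewrite /dt /=; ring]; exact: mulr_gt0.
  - by have -> : side a b c = t * side a b v by [rewrite /side /dt /=; ring]; exact: mulr_gt0.
split=> //; have [QP [QT QW]] := ear_polygonP C.
have scb x : side c b x = (1 - t) * side a b x + t * side v b x by exact: side_mixl.
have sac x : side a c x = t * side a v x by rewrite side_mixr sidexx mulr0 add0r.
have E1 : ear (ear_polygon a v b) c v b by apply: ear_mixl; rewrite ?t0.
have [_ _ c0 _] := C1.
have E2 : ear (ear_polygon a v b `&` below c b) a c b.
  split=> x.
    move=> [x1 x2 x3]; split=> //; apply: QT; split=> //.
      by move: x2; rewrite sac pmulr_rle0.
    move: x3; rewrite scb -(pmulr_rle0 (side v b x) t0).
    by have : 0 <= (1 - t) * side a b x by [rewrite pmulr_rge0]; lra.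
  by move=> [/QW[x1 x2] x3]; split=> //; rewrite /below /= sac pmulr_rle0.
rewrite -(ear_valueE mV C1 QP E1) -(ear_valueE mV C2 (Po_below QP c0) E2).
rewrite addrA subrK /ear_value; congr (_ - mu _).
apply/seteqP; split=> x; last by move=> [[]].
move=> [Qx x1]; split=> //; split=> //; rewrite /below /= scb.
have [_ x2] := QW x Qx.
by have [] := (pmulr_rle0 (side a b x) t2, pmulr_rle0 (side v b x) t0); rewrite x1 [side v b x <= 0]x2; lra.
Qed.

Lemma ear_value_cutr mu a v b t : is_valuation mu -> corner a v b -> 0 < t < 1 ->
  let c := mix t v b in [/\ corner a v c, corner a c b &
  ear_value mu a v b = ear_value mu a v c + ear_value mu a c b].
Proof.
move=> mV C /andP[t0 t1] c; have [p0 q0 r0 d0] := C.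
have t2 : 0 < 1 - t by lra.
have C1 : corner a v c.
  split=> //.
  - by have -> : dt v c = t * dt v b by [rewrite /dt /=; ring]; exact: mulr_gt0.
  - have -> : dt a c = (1 - t) * dt a v + t * dt a b by rewrite /dt /=; ring.
    by rewrite addr_gt0 // mulr_gt0.
  - rewrite side_mixr (_ : side a v v = 0) ?mulr0 ?add0r ?mulr_gt0 // /side /dt; ring.
have [_ _ c0 _] := C1.
have C2 : corner a c b.
  split=> //.
  - by have -> : dt c b = (1 - t) * dt v b by [rewrite /dt /=; ring]; exact: mulr_gt0.
  - by have -> : side a b c = (1 - t) * side a b v by [rewrite /side /dt /=; ring]; exact: mulr_gt0.
split=> //; have [QP [QT QW]] := ear_polygonP C.
have sac x : side a c x = (1 - t) * side a v x + t * side a b x by exact: side_mixr.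
have scb x : side c b x = (1 - t) * side v b x by rewrite side_mixl sidexx mulr0 addr0.
have E1 : ear (ear_polygon a v b) a v c by apply: ear_mixr; rewrite ?t0.
have E2 : ear (ear_polygon a v b `&` below a c) a c b.
  split=> x.
    move=> [x1 x2 x3]; split=> //; apply: QT; split=> //.
      move: x2; rewrite sac -(pmulr_rle0 (side a v x) t2).
      by have : 0 <= t * side a b x by [rewrite pmulr_rge0]; lra.
    by move: x3; rewrite scb pmulr_rle0.
  by move=> [/QW[x1 x2] x3]; split=> //; rewrite /below /= scb pmulr_rle0.
rewrite -(ear_valueE mV C1 QP E1) -(ear_valueE mV C2 (Po_below QP c0) E2).
rewrite addrA subrK /ear_value; congr (_ - mu _).
apply/seteqP; split=> x; last by move=> [[]].
move=> [Qx x1]; split=> //; split=> //; rewrite /below /= sac.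
have [x2 _] := QW x Qx.
by have [] := (pmulr_rle0 (side a b x) t0, pmulr_rle0 (side a v x) t2); rewrite x1 [side a v x <= 0]x2; lra.
Qed.

End Ears.

(** * Reduction to functions of determinants *)

Section Coordinates.
Variable R : realType.
Local Notation pt := (R * R)%type.
Local Notation mR := (measurableTypeR R).
Implicit Types (P Q : set pt) (a b c v x : pt) (t p q r s : R).
Variable mu : set pt -> pt.
Hypotheses (muV : is_valuation mu) (muC : SL2_covariant mu).

Lemma mxactB (A : 'M[R]_2) x y : mxact A (x - y) = mxact A x - mxact A y.
Proof. by rewrite [LHS]surjective_pairing [RHS]surjective_pairing /mxact /=; congr pair; ring. Qed.

Lemma dt_mxact (A : 'M[R]_2) x y : \det A = 1 -> dt (mxact A x) (mxact A y) = dt x y.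
Proof.
rewrite det_mx2 => dA; rewrite -[RHS]mul1r -dA /dt /mxact /=; ring.
Qed.

Lemma side_mxact (A : 'M[R]_2) a b x : \det A = 1 ->
  side (mxact A a) (mxact A b) (mxact A x) = side a b x.
Proof. by move=> dA; rewrite /side !dt_mxact. Qed.

Lemma mxact_inv (A : 'M[R]_2) x : \det A = 1 -> mxact A (mxact (invmx A) x) = x.
Proof. by move=> dA; rewrite -mxactM mulmxV ?mxact1 // unitmxE dA unitr1. Qed.

Lemma ear_value_mxact (A : 'M[R]_2) a v b : \det A = 1 -> corner a v b ->
  ear_value mu (mxact A a) (mxact A v) (mxact A b) = mxact A (ear_value mu a v b).
Proof.
move=> dA C; have [QP [QT QW]] := ear_polygonP C.
have C' : corner (mxact A a) (mxact A v) (mxact A b).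
  by case: C => *; rewrite /corner !dt_mxact // side_mxact.
have E : ear (mxact A @` ear_polygon a v b) (mxact A a) (mxact A v) (mxact A b).
  split=> [x|_ [x /QW[x1 x2] <-]].
    rewrite -[x](mxact_inv _ dA) /triangle /= !side_mxact // => Tx.
    by exists (mxact (invmx A) x) => //; exact: QT.
  by split; rewrite /below /= side_mxact.
rewrite -(ear_valueE muV C' (Po_mxact dA QP) E).
have -> : mxact A @` ear_polygon a v b `&` below (mxact A a) (mxact A b) =
    mxact A @` (ear_polygon a v b `&` below a b).
  apply/seteqP; split=> [_ [[x Qx <-]]|_ [x [Qx x1] <-]].
    by rewrite /below /= side_mxact // => ?; exists x.
  by split; [exists x|rewrite /below /= side_mxact].
have [_ _ r0 _] := C.
by rewrite !muC //; [rewrite -mxactB|exact: Po_below].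
Qed.

(** The corner [(1, 0)], [(q / r, p)], [(0, r)] has determinants [p], [q], [r]. There
    [(f a + g b) / r] is the vector [(f / r, g)], which explains the factor [r]. *)
Definition earf p q r : R := r * (ear_value mu (1, 0) (q / r, p) (0, r)).1.
Definition earg p q r : R := (ear_value mu (1, 0) (q / r, p) (0, r)).2.

Lemma ear_value_coord a v b : corner a v b ->
  let f := earf (dt a v) (dt v b) (dt a b) in
  let g := earg (dt a v) (dt v b) (dt a b) in
  ear_value mu a v b =
    ((f * a.1 + g * b.1) / dt a b, (f * a.2 + g * b.2) / dt a b).
Proof.
move=> C f g; have [p0 q0 r0 d0] := C; have rN := lt0r_neq0 r0.
(* The columns [a] and [b / dt a b] have determinant 1, and [A] carries the standard corner with the
   same determinants to [a], [v], [b]. *)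
pose A : 'M[R]_2 := \matrix_(i, j) (if j == ord0 then (if i == ord0 then a.1 else a.2)
  else (if i == ord0 then b.1 / dt a b else b.2 / dt a b)).
have AE x : mxact A x = (a.1 * x.1 + b.1 / dt a b * x.2, a.2 * x.1 + b.2 / dt a b * x.2).
  by rewrite /mxact !mxE.
have dA : \det A = 1.
  by rewrite det_mx2 !mxE /=; move: rN; rewrite /dt => rN; field.
have aE : a = mxact A (1, 0) by rewrite AE /= !mulr1 !mulr0 !addr0; case: (a).
have bE : b = mxact A (0, dt a b).
  by rewrite AE /= !mulr0 !add0r !divfK //; case: (b).
have vE : v = mxact A (dt v b / dt a b, dt a v).
  rewrite AE [v]surjective_pairing /=; move: rN; rewrite /dt /= => rN; congr pair; field; exact: rN.
have C' : corner (1, 0) (dt v b / dt a b, dt a v) (0, dt a b).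
  have : corner (mxact A (1, 0)) (mxact A (dt v b / dt a b, dt a v)) (mxact A (0, dt a b)).
    by rewrite -aE -vE -bE.
  by rewrite /corner !dt_mxact // side_mxact.
have -> : ear_value mu a v b = mxact A (ear_value mu (1, 0) (dt v b / dt a b, dt a v) (0, dt a b)).
  by rewrite -ear_value_mxact // -aE -vE -bE.
rewrite AE /f /g /earf /earg; congr pair; field; exact: rN.
Qed.

Let corner0 p q r : 0 < p -> 0 < q -> 0 < r -> r < p + q ->
  [/\ corner (1, 0) (q / r, p) (0, r), dt (1, 0) (q / r, p) = p,
     dt (q / r, p) (0, r) = q & dt (1, 0) (0, r) = r].
Proof.
move=> p0 q0 r0 rpq; have rN := lt0r_neq0 r0.
have [e1 e2 e3] : [/\ dt (1, 0) (q / r, p) = p,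
     dt (q / r, p) (0, r) = q & dt (1, 0) (0, r) = r].
  by rewrite /dt /= !mul1r !mul0r !mulr0 !subr0 divfK.
by rewrite /corner /side e1 e2 e3; split=> //; split=> //; lra.
Qed.

Lemma ear_cut_additive : cut_additive earf earg.
Proof.
move=> p1 p2 q r s p10 p20 q0 r0 s0 rpq sE.
have rN := lt0r_neq0 r0; have sN := lt0r_neq0 s0.
have p0 : 0 < p1 + p2 by exact: addr_gt0.
have pN := lt0r_neq0 p0.
have [C e1 e2 e3] := corner0 p0 q0 r0 rpq.
have t01 : 0 < p1 / (p1 + p2) < 1 by rewrite divr_gt0 //= ltr_pdivrMr // mul1r ltrDl.
have [C1 C2] := ear_value_cutl muV C t01.
set c := mix _ _ _ in C1 C2 *.
have cE : c = (s / r, p1).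
  rewrite /c /mix /=; congr pair; last by rewrite mulr0 add0r divfK.
  have -> : s = (r * p2 + q * p1) / (p1 + p2) by rewrite -sE mulfK.
  by field; rewrite pN rN.
have f1 : dt c (q / r, p1 + p2) = p2.
  rewrite cE /dt /=; apply/(mulfI rN); rewrite mulrBr.
  have -> : r * (s / r * (p1 + p2)) = s * (p1 + p2) by field.
  by rewrite sE; field.
have f2 : dt c (0, r) = s by rewrite cE /dt /= mulr0 subr0 divfK.
have f3 : dt (1, 0) c = p1 by rewrite cE /dt /= mul1r mul0r subr0.
rewrite (ear_value_coord C) (ear_value_coord C1) (ear_value_coord C2) e1 e2 e3 f1 f2 f3 cE.
move: (earf (p1 + p2) q r) (earg (p1 + p2) q r) (earf p2 q s) (earg p2 q s)
  (earf p1 s r) (earg p1 s r) => F G F1 G1 F2 G2 [].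
rewrite /= !mulr0 !mulr1 !add0r !addr0 => E1 E2; split.
  have {1}-> : F = r * (F / r) by field.
  by rewrite E1; field; rewrite rN sN.
have {1}-> : G = G * r / r by field.
by rewrite E2; field; rewrite rN sN.
Qed.

Lemma ear_cut_additive_mirror : cut_additive (mirror earg) (mirror earf).
Proof.
move=> q1 q2 p r s q10 q20 p0 r0 s0 rpq sE; rewrite /mirror.
have rN := lt0r_neq0 r0; have sN := lt0r_neq0 s0.
have q0 : 0 < q1 + q2 by exact: addr_gt0.
have qN := lt0r_neq0 q0.
have rpq' : r < p + (q1 + q2) by lra.
have [C e1 e2 e3] := corner0 p0 q0 r0 rpq'.
have t01 : 0 < q2 / (q1 + q2) < 1 by rewrite divr_gt0 //= ltr_pdivrMr // mul1r ltrDr.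
have [C1 C2] := ear_value_cutr muV C t01.
set c := mix _ _ _ in C1 C2 *.
have cE : c = (q1 / r, s).
  rewrite /c /mix /=; congr pair; first by field; rewrite qN rN.
  by apply/(mulfI qN); rewrite [RHS]mulrC sE; field.
have f1 : dt (1, 0) c = s by rewrite cE /dt /= mul1r mul0r subr0.
have f2 : dt c (0, r) = q1 by rewrite cE /dt /= mulr0 subr0 divfK.
have f3 : dt ((q1 + q2) / r, p) c = q2.
  rewrite cE /dt /=; apply/(mulfI rN).
  have -> : r * ((q1 + q2) / r * s - p * (q1 / r)) = s * (q1 + q2) - p * q1 by field.
  by rewrite sE; ring.
rewrite (ear_value_coord C) (ear_value_coord C1) (ear_value_coord C2) e1 e2 e3 f1 f2 f3 cE.
move: (earf p (q1 + q2) r) (earg p (q1 + q2) r) (earf p q2 s) (earg p q2 s)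
  (earf s q1 r) (earg s q1 r) => F G F1 G1 F2 G2 [].
rewrite /= !mulr0 !mulr1 !add0r !addr0 => E1 E2; split.
  have {1}-> : G = G * r / r by field.
  by rewrite E2; field; rewrite rN sN.
have {1}-> : F = r * (F / r) by field.
by rewrite E1; field; rewrite rN sN.
Qed.

(** Only families of cuts depending on one real parameter enter the argument. In this form
    measurability concerns real functions of a real variable and passes to linear combinations at
    once. *)
Definition cut_measurable (nu : set pt -> pt) := forall P (y z : pt), Po P ->
  let cut t := P `&` hps [:: (y.1 + t * z.1, y.2 + t * z.2)] in
  measurable_fun [set: mR] (fun t : mR => (nu (cut t)).1 : mR) /\
  measurable_fun [set: mR] (fun t : mR => (nu (cut t)).2 : mR).

(** Cuts with [s = r] stay in the plane [p = r], so [g] is additive in [q], hence linear. The defect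
    of additivity of [f] is then a multiple of [q1 q2]; subtracting the same multiple of [q^2 / 2]
    leaves an additive function. *)
Lemma linear_of_cut_additive (f g : R -> R -> R -> R) r :
  cut_additive (mirror g) (mirror f) -> 0 < r ->
  measurable_fun (`]0, 1[ : set mR) (fun q : mR => f r q r : mR) ->
  measurable_fun (`]0, 1[ : set mR) (fun q : mR => g r q r : mR) ->
  forall q, 0 < q -> g r q r = q * g r 1 r /\
    f r q r = g r 1 r / r * q ^+ 2 / 2 + q * (f r 1 r - g r 1 r / r / 2).
Proof.
move=> fg r0 mf mg; have rN := lt0r_neq0 r0.
have cut q1 q2 : 0 < q1 -> 0 < q2 -> g r (q1 + q2) r = g r q1 r + g r q2 r /\
    r * f r (q1 + q2) r = r * f r q2 r + r * f r q1 r + q1 * g r q2 r.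
  move=> q10 q20; have [] := fg q1 q2 r r r; try by []; [lra|ring|].
  by rewrite /mirror => e1 e2; split=> //; rewrite e1 addrC.
have gE q : 0 < q -> g r q r = q * g r 1 r.
  by apply: (measurable_additive_linear (h := fun q => g r q r)) => // x y x0 y0; have [] := cut x y x0 y0.
move=> q q0; split; first exact: gE.
pose h q := f r q r - g r 1 r / r * q ^+ 2 / 2.
suff : h q = q * h 1 by rewrite /h expr1n mulr1 => /eqP; rewrite subr_eq addrC => /eqP.
apply: (measurable_additive_linear (h := h)) => // [x y x0 y0|].
  have [_ e] := cut x y x0 y0; rewrite gE // in e.
  apply/(mulfI rN); rewrite /h mulrBr e; field; exact: rN.
apply: measurable_funB => //; apply: measurable_funM => //.
by apply: measurable_funM => //; apply: measurable_funX.
Qed.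

Lemma ear_profile : cut_measurable mu -> exists l l' : R -> R, profile earf earg l l'.
Proof.
move=> mm.
(* Corners with determinants [(r, q, r)] for which only [b] moves with [q], the normal of the chord
   being affine in [q]. The second family is its mirror image, with determinants [(p, r, r)] and
   only [a] moving. *)
have dtr r q : 0 < r -> [/\ dt (1, 0) (0, r) = r, dt (0, r) (- q / r, r) = q &
    dt (1, 0) (- q / r, r) = r].
  by move=> /lt0r_neq0 rN; rewrite /dt /=; split; field.
have corr r q : 0 < r -> 0 < q -> corner (1, 0) (0, r) (- q / r, r).
  move=> r0 q0; have [e1 e2 e3] := dtr r q r0.
  by rewrite /corner /side e1 e2 e3; split=> //; lra.
have dtl r p : 0 < r -> [/\ dt (r, - p / r) (r, 0) = p, dt (r, 0) (0, 1) = r &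
    dt (r, - p / r) (0, 1) = r].
  by move=> /lt0r_neq0 rN; rewrite /dt /=; split; field.
have corl r p : 0 < r -> 0 < p -> corner (r, - p / r) (r, 0) (0, 1).
  move=> r0 p0; have [e1 e2 e3] := dtl r p r0.
  by rewrite /corner /side e1 e2 e3; split=> //; lra.
have mr r : 0 < r -> measurable_fun (`]0, 1[ : set mR) (fun q : mR => earf r q r : mR) /\
    measurable_fun (`]0, 1[ : set mR) (fun q : mR => earg r q r : mR).
  move=> r0; have rN := lt0r_neq0 r0.
  (* The polygon for [q = 1] has all the ears with [0 < q < 1], so the values are losses of one
     polygon under a family of cuts. *)
  have [QP QE] := ear_polygonP (corr r 1 r0 ltr01).
  have [m1 m2] := mm _ (1, r^-1) (0, r ^- 2) QP.
  have E (q : R) : (q \in (`]0, 1[%classic : set mR)) -> ear_value mu (1, 0) (0, r) (- q / r, r) =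
      mu (ear_polygon (1, 0) (0, r) (- 1 / r, r)) - mu (ear_polygon (1, 0) (0, r) (- 1 / r, r)
        `&` hps [:: (1 + q * 0, r^-1 + q * r ^- 2)]).
    rewrite inE /= in_itv /= => /andP[q0 q1].
    have QEq := ear_mixr (t := q) _ QE; rewrite q0 q1 in QEq.
    have qE : mix q (0, r) (- 1 / r, r) = (- q / r, r).
      by rewrite /mix /=; congr pair; field; rewrite ?rN.
    rewrite qE in QEq.
    rewrite -(ear_valueE muV (corr _ _ r0 q0) QP (QEq isT)) below_hps; last first.
      by have [] := corr _ _ r0 q0.
    rewrite /dt /= mul1r mul0r subr0; congr (_ - mu (_ `&` hps [:: (_, _)]));
      field; exact: rN.
  have F (q : R) : q \in (`]0, 1[%classic : set mR) ->
      earf r q r = r * (ear_value mu (1, 0) (0, r) (- q / r, r)).1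
        + q / r * (ear_value mu (1, 0) (0, r) (- q / r, r)).2 /\
      earg r q r = (ear_value mu (1, 0) (0, r) (- q / r, r)).2.
    move=> q01; have q0 : 0 < q by move: q01; rewrite inE /= in_itv /= => /andP[].
    have := ear_value_coord (corr r q r0 q0).
    have [-> -> ->] := dtr r q r0; cbv zeta => ->.
    by rewrite /fst /snd; split; field; exact: rN.
  have [n1 n2] : measurable_fun (`]0, 1[ : set mR)
        (fun q : mR => (ear_value mu (1, 0) (0, r) (- q / r, r)).1 : mR) /\
      measurable_fun (`]0, 1[ : set mR)
        (fun q : mR => (ear_value mu (1, 0) (0, r) (- q / r, r)).2 : mR).
    split.
      apply: (eq_measurable_fun (fun q : mR =>
        (mu (ear_polygon (1, 0) (0, r) (- 1 / r, r))).1 -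
        (mu (ear_polygon (1, 0) (0, r) (- 1 / r, r)
          `&` hps [:: (1 + q * 0, r^-1 + q * r ^- 2)])).1 : mR)) => [q q01|].
        by rewrite E.
      by apply: measurable_funB => //; apply: measurable_funTS; exact: m1.
    apply: (eq_measurable_fun (fun q : mR =>
      (mu (ear_polygon (1, 0) (0, r) (- 1 / r, r))).2 -
      (mu (ear_polygon (1, 0) (0, r) (- 1 / r, r)
        `&` hps [:: (1 + q * 0, r^-1 + q * r ^- 2)])).2 : mR)) => [q q01|].
      by rewrite E.
    by apply: measurable_funB => //; apply: measurable_funTS; exact: m2.
  split.
    apply: (eq_measurable_fun (fun q : mR =>
      r * (ear_value mu (1, 0) (0, r) (- q / r, r)).1
        + q / r * (ear_value mu (1, 0) (0, r) (- q / r, r)).2 : mR)) => [q q01|].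
      by have [-> _] := F q q01.
    apply: measurable_funD; apply: measurable_funM => //.
    by apply: measurable_funM.
  apply: (eq_measurable_fun _ _ n2) => q q01.
  by have [_ ->] := F q q01.
have ml r : 0 < r -> measurable_fun (`]0, 1[ : set mR) (fun q : mR => earf q r r : mR) /\
    measurable_fun (`]0, 1[ : set mR) (fun q : mR => earg q r r : mR).
  move=> r0; have rN := lt0r_neq0 r0.
  have [QP QE] := ear_polygonP (corl r 1 r0 ltr01).
  have [m1 m2] := mm _ (r^-1, 1) (r ^- 2, 0) QP.
  have E (q : R) : (q \in (`]0, 1[%classic : set mR)) -> ear_value mu (r, - q / r) (r, 0) (0, 1) =
      mu (ear_polygon (r, - 1 / r) (r, 0) (0, 1)) - mu (ear_polygon (r, - 1 / r) (r, 0) (0, 1)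
        `&` hps [:: (r^-1 + q * r ^- 2, 1 + q * 0)]).
    rewrite inE /= in_itv /= => /andP[q0 q1].
    have QEq : ear (ear_polygon (r, - 1 / r) (r, 0) (0, 1)) (mix (1 - q) (r, - 1 / r) (r, 0)) (r, 0) (0, 1).
      by apply: ear_mixl => //; apply/andP; split; lra.
    have qE : mix (1 - q) (r, - 1 / r) (r, 0) = (r, - q / r).
      by rewrite /mix /=; congr pair; field; rewrite ?rN.
    rewrite qE in QEq.
    rewrite -(ear_valueE muV (corl _ _ r0 q0) QP QEq) below_hps; last first.
      by have [] := corl _ _ r0 q0.
    have [_ _ ->] := dtl r q r0; rewrite /fst /snd; congr (_ - mu (_ `&` hps [:: (_, _)]));
      field; exact: rN.
  have F (q : R) : q \in (`]0, 1[%classic : set mR) ->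
      earf q r r = (ear_value mu (r, - q / r) (r, 0) (0, 1)).1 /\
      earg q r r = r * (ear_value mu (r, - q / r) (r, 0) (0, 1)).2
        + q / r * (ear_value mu (r, - q / r) (r, 0) (0, 1)).1.
    move=> q01; have q0 : 0 < q by move: q01; rewrite inE /= in_itv /= => /andP[].
    have := ear_value_coord (corl r q r0 q0).
    have [-> -> ->] := dtl r q r0; cbv zeta => ->.
    by rewrite /fst /snd; split; field; exact: rN.
  have [n1 n2] : measurable_fun (`]0, 1[ : set mR)
        (fun q : mR => (ear_value mu (r, - q / r) (r, 0) (0, 1)).1 : mR) /\
      measurable_fun (`]0, 1[ : set mR)
        (fun q : mR => (ear_value mu (r, - q / r) (r, 0) (0, 1)).2 : mR).
    split.
      apply: (eq_measurable_fun (fun q : mR =>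
        (mu (ear_polygon (r, - 1 / r) (r, 0) (0, 1))).1 -
        (mu (ear_polygon (r, - 1 / r) (r, 0) (0, 1)
          `&` hps [:: (r^-1 + q * r ^- 2, 1 + q * 0)])).1 : mR)) => [q q01|].
        by rewrite E.
      by apply: measurable_funB => //; apply: measurable_funTS; exact: m1.
    apply: (eq_measurable_fun (fun q : mR =>
      (mu (ear_polygon (r, - 1 / r) (r, 0) (0, 1))).2 -
      (mu (ear_polygon (r, - 1 / r) (r, 0) (0, 1)
        `&` hps [:: (r^-1 + q * r ^- 2, 1 + q * 0)])).2 : mR)) => [q q01|].
      by rewrite E.
    by apply: measurable_funB => //; apply: measurable_funTS; exact: m2.
  split.
    apply: (eq_measurable_fun _ _ n1) => q q01.
    by have [-> _] := F q q01.
  apply: (eq_measurable_fun (fun q : mR =>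
    r * (ear_value mu (r, - q / r) (r, 0) (0, 1)).2 + q / r * (ear_value mu (r, - q / r) (r, 0) (0, 1)).1 : mR)) => [q q01|].
    by have [_ ->] := F q q01.
  apply: measurable_funD; apply: measurable_funM => //.
  by apply: measurable_funM.
exists (fun r => earg r 1 r / r), (fun r => earf 1 r r / r).
have H r q : 0 < r -> 0 < q -> earg r q r = q * earg r 1 r /\
    earf r q r = earg r 1 r / r * q ^+ 2 / 2 + q * (earf r 1 r - earg r 1 r / r / 2).
  move=> r0 q0; have [m1 m2] := mr r r0.
  exact: linear_of_cut_additive ear_cut_additive_mirror r0 m1 m2 q q0.
have H' r q : 0 < r -> 0 < q -> earf q r r = q * earf 1 r r /\
    earg q r r = earf 1 r r / r * q ^+ 2 / 2 + q * (earg 1 r r - earf 1 r r / r / 2).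
  move=> r0 q0; have [m1 m2] := ml r r0.
  exact: (linear_of_cut_additive (f := mirror earg) (g := mirror earf)
    ear_cut_additive r0 m2 m1 q0).
split=> q r q0 r0; have rN := lt0r_neq0 r0;
  have [g1 f1] := H r q r0 q0; have [g2 f2] := H r r r0 r0;
  have [f3 g3] := H' r q r0 q0; have [f4 g4] := H' r r r0 r0.
  split; last by rewrite g1; field.
  (* The formulas on the two planes agree at [(r, r, r)], which determines the remaining
     coefficient. *)
  have n : earf r 1 r = earf 1 r r - earg r 1 r / 2 + earg r 1 r / r / 2.
    by move: f2; rewrite f4 => e; rewrite -[earf 1 r r](mulKf rN) e; field; exact: rN.
  by rewrite f1 n; field.
split; last by rewrite f3; field.
have n : earg 1 r r = earg r 1 r - earf 1 r r / 2 + earf 1 r r / r / 2.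
  by move: g4; rewrite g2 => e; rewrite -[earg r 1 r](mulKf rN) e; field; exact: rN.
by rewrite g3 n; field.
Qed.

End Coordinates.

(** * Valuations that ignore cuts *)

Section Constancy.
Variable R : realType.
Local Notation pt := (R * R)%type.
Implicit Types (P Q : set pt) (a b c v x y z : pt) (s : seq pt).

Lemma Po_convex3 P a v b l m n : Po P -> P a -> P v -> P b ->
  0 <= l -> 0 <= m -> 0 <= n -> l + m + n = 1 ->
  P (l * a.1 + m * v.1 + n * b.1, l * a.2 + m * v.2 + n * b.2).
Proof.
move=> /PoP[ys [M [-> _]]] Pa Pv Pb l0 m0 n0 s1 y yy.
have := ler_wpM2l l0 (Pa y yy); have := ler_wpM2l m0 (Pv y yy).
have := ler_wpM2l n0 (Pb y yy); rewrite /dot /=; lra.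
Qed.

Lemma triangle_sub P a v b : corner a v b -> Po P -> P a -> P v -> P b ->
  triangle a v b `<=` P.
Proof.
move=> C PP Pa Pv Pb x /(triangle_barycentric C)[l [m [n [[l0 m0 n0] s1 ->]]]].
exact: Po_convex3.
Qed.

(** Expresses [side] in the orthogonal coordinates [dot y] and [dt y], in which the chord
    [dot y x = 1] is a coordinate line. *)
Let side_line y v b x : (side v b x) * dot y y =
  (dot y v - dot y b) * (dt y x - dt y b) - (dt y v - dt y b) * (dot y x - dot y b).
Proof. by rewrite /side /dt /dot; ring. Qed.

Let side_line2 y a v x : (side a v x) * dot y y =
  (dot y a - dot y v) * (dt y x - dt y a) - (dt y a - dt y v) * (dot y x - dot y a).
Proof. by rewrite /side /dt /dot; ring. Qed.

Lemma conv_hull_below s a b : (forall u, u \in s -> side a b u <= 0) ->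
  conv_hull s `<=` below a b.
Proof.
have E x : (side a b x <= 0) = (dot (b.2 - a.2, a.1 - b.1) x <= dt a b).
  by rewrite -[RHS]subr_le0; congr (_ <= _); rewrite /side /dot /dt /=; ring.
by move=> ab x; rewrite /below /= E; apply: conv_hull_le => u us; rewrite -E ab.
Qed.

(* An extreme point [b] of the chord cut from the polygon by [dot y x = 1],
   with a vertex [v] beyond the chord such that the line [vb] supports the
   polygon; [e = 1] and [e = -1] give the two ends of the chord. *)
Lemma chord_end s y (e : R) : Po (conv_hull s) -> (exists2 u, u \in s & 1 < dot y u) ->
  exists v b, [/\ v \in s, 1 < dot y v, conv_hull s b, dot y b = 1 &
    forall u, u \in s ->
      e * ((dot y v - 1) * (dt y u - dt y b) - (dt y v - dt y b) * (dot y u - 1)) <= 0].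
Proof.
move=> PP [u0 u0s hu0].
have [w0 w0s hw0] : exists2 w, w \in s & dot y w <= 1.
  apply: contrapT => nw; have : 1 <= - dot y (0, 0) * -1.
    rewrite mulrN1 opprK -lerN2.
    have -> : - dot y (0, 0) = dot (- y.1, - y.2) (0, 0) by rewrite /dot /=; ring.
    apply: conv_hull_le (Po0 PP) => w ws; rewrite leNgt; apply/negP => h.
    by apply: nw; exists w => //; move: h; rewrite /dot /=; lra.
  by rewrite /dot /= !mulr0; lra.
pose k u w := (dot y u - 1) / (dot y u - dot y w).
have kP u w : 1 < dot y u -> dot y w <= 1 ->
    [/\ 0 < k u w, k u w <= 1 & dot y (mix (k u w) u w) = 1].
  move=> hu hw; have d0 : 0 < dot y u - dot y w by lra.
  split; first by apply: divr_gt0 => //; rewrite subr_gt0.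
    by rewrite /k ler_pdivrMr // mul1r lerB.
  by move: (lt0r_neq0 d0); rewrite /k; rewrite /mix /dot /= => dN; field.
pose crossings := [seq mix (k u w) u w | u <- [seq u <- s | 1 < dot y u],
                                      w <- [seq w <- s | dot y w <= 1]].
have inC u w : u \in s -> w \in s -> 1 < dot y u -> dot y w <= 1 ->
    mix (k u w) u w \in crossings.
  by move=> us ws hu hw; apply: (allpairs_f (fun u w => mix (k u w) u w));
      rewrite mem_filter ?us ?ws ?hu ?hw.
have [|b bC bmax] := seq_argmax (fun x => e * dt y x) (s := crossings).
  by apply: contraTneq (inC _ _ u0s w0s hu0 hw0) => ->.
(* Among the generators beyond the chord, [v] maximises the slope seen from [b], so none of them
   lies outside the line [vb]. *)
have [|v] := seq_argmax (fun u => e * ((dt y u - dt y b) / (dot y u - 1)))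
    (s := [seq u <- s | 1 < dot y u]).
  apply: contraTneq (_ : u0 \in [seq u <- s | 1 < dot y u]) => [->//|].
  by rewrite mem_filter hu0.
rewrite mem_filter => /andP[hv vs] vmax; exists v, b.
have /allpairsP[[u1 w1] /=] := bC; rewrite !mem_filter => -[/andP[hu1 u1s] /andP[hw1 w1s] bE].
have [k0 k1 kb] := kP _ _ hu1 hw1; split=> //.
- rewrite bE; have k01 : 0 <= 1 - k u1 w1 <= 1 by apply/andP; split; lra.
  have := Po_convex PP (conv_hull_mem u1s) (conv_hull_mem w1s) k01.
  by rewrite subKr.
- by rewrite bE.
move=> u us; have hv0 : 0 < dot y v - 1 by lra.
have [hu|hu] := ltP 1 (dot y u).
  have hu' : 0 < dot y u - 1 by lra.
  have := vmax u; rewrite mem_filter hu us => /(_ isT).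
  have [vN uN] := (lt0r_neq0 hv0, lt0r_neq0 hu').
  rewrite -subr_le0 => le; rewrite (_ : _ * _ = (dot y v - 1) * (dot y u - 1) *
    (e * ((dt y u - dt y b) / (dot y u - 1)) - e * ((dt y v - dt y b) / (dot y v - 1)))).
    by rewrite pmulr_rle0 // mulr_gt0.
  by field; rewrite vN uN.
(* For [u] on the near side, the segment [vu] crosses the chord no further out than [b], by the
   choice of [b]. *)
have [k0' k1' kz] := kP _ _ hv hu.
have := bmax _ (inC _ _ vs us hv hu); rewrite -subr_le0 -(pmulr_rle0 _ hv0) => le.
rewrite -(pmulr_rle0 _ k0'); move: le; congr (_ <= _).
move: kz; set K := k v u => kz.
have tz : dt y (mix K v u) = (1 - K) * dt y v + K * dt y u by rewrite /dt /mix /=; ring.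
have dz : (1 - K) * (dot y v - 1) = - K * (dot y u - 1).
  have : dot y (mix K v u) = (1 - K) * dot y v + K * dot y u by rewrite /dot /mix /=; ring.
  by rewrite kz; lra.
rewrite tz.
have -> : (dot y v - 1) * (e * ((1 - K) * dt y v + K * dt y u) - e * dt y b) =
   e * ((1 - K) * (dot y v - 1) * (dt y v - dt y b) + K * (dot y v - 1) * (dt y u - dt y b)) by ring.
by rewrite dz; ring.
Qed.

Let small_normal P y : Po P -> exists t, [/\ 0 < t, P (t * - y.2, t * y.1) &
  P (t * y.2, t * - y.1)].
Proof.
move=> PP; have [r [r0 rP]] := Po_ball PP.
pose m := 1 + `|y.1| + `|y.2|; have m0 : 0 < m by rewrite !ltr_wpDr.
have H (u : R) : `|u| <= m -> `|r / m * u| <= r.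
  move=> um; rewrite normrM gtr0_norm ?divr_gt0 // mulrAC ler_pdivrMr //.
  by rewrite ler_pM2l.
have [N1 N2] : `|y.1| <= m /\ `|y.2| <= m.
  by have := normr_ge0 y.1; have := normr_ge0 y.2; rewrite /m; split; lra.
exists (r / m); rewrite divr_gt0 //.
by split=> //; apply: rP; apply: H; rewrite ?normrN.
Qed.

Lemma chord s y : Po (conv_hull s) -> (exists2 u, u \in s & 1 < dot y u) ->
  exists a b v v', [/\ v \in s, v' \in s, 1 < dot y v, 1 < dot y v' &
    [/\ conv_hull s a, conv_hull s b, dot y a = 1, dot y b = 1 &
      [/\ dt y a < dt y b, conv_hull s `<=` below v b & conv_hull s `<=` below a v']]].
Proof.
move=> PP us; have [v [b [vs hv Pb hb vb]]] := chord_end 1 PP us.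
have [v' [a [v's hv' Pa ha va]]] := chord_end (-1) PP us.
have yy0 : 0 < dot y y.
  have yy : 0 <= dot y y by rewrite addr_ge0 // -expr2 sqr_ge0.
  rewrite lt_neqAle yy andbT eq_sym paddr_eq0 -?expr2 ?sqr_ge0 // !sqrf_eq0.
  by apply/negP => /andP[/eqP y1 /eqP y2]; move: hv; rewrite /dot y1 y2; lra.
have Pvb : conv_hull s `<=` below v b.
  apply: conv_hull_below => u us'; rewrite -(pmulr_lle0 _ yy0) side_line hb.
  by have := vb u us'; lra.
have Pav : conv_hull s `<=` below a v'.
  apply: conv_hull_below => u us'; rewrite -(pmulr_lle0 _ yy0) side_line2 ha.
  by have := va u us'; lra.
exists a, b, v, v'; split=> //; split=> //; split=> //.
have [t [t0 Pp Pm]] := small_normal y PP.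
have k01 : 0 <= (dot y v)^-1 <= 1.
  by rewrite invr_ge0 invf_le1; lra.
have Pv := conv_hull_mem vs.
have vN : dot y v != 0 by rewrite lt0r_neq0 //; lra.
(* To see that the chord has positive length, [v] is joined to two points of the polygon on opposite
   sides of the origin on the line [dot y x = 0]. These segments meet the chord in two distinct
   points, which the supporting lines place between [a] and [b]. *)
pose z1 := ((dot y v)^-1 * v.1 + (1 - (dot y v)^-1) * (t * y.2),
            (dot y v)^-1 * v.2 + (1 - (dot y v)^-1) * (t * - y.1)).
pose z2 := ((dot y v)^-1 * v.1 + (1 - (dot y v)^-1) * (t * - y.2),
            (dot y v)^-1 * v.2 + (1 - (dot y v)^-1) * (t * y.1)).
have h1 : side a v' z1 <= 0 by exact: Pav _ (Po_convex PP Pv Pm k01).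
have h2 : side v b z2 <= 0 by exact: Pvb _ (Po_convex PP Pv Pp k01).
have d1 : dot y z1 = 1.
  by rewrite /z1; move: vN; rewrite /dot /= => vN; field.
have d2 : dot y z2 = 1.
  by rewrite /z2; move: vN; rewrite /dot /= => vN; field.
have k1 : 0 < 1 - (dot y v)^-1 by rewrite subr_gt0 invf_lt1 //; lra.
have tz : dt y z1 < dt y z2.
  rewrite -subr_gt0 (_ : _ - _ = 2 * t * (1 - (dot y v)^-1) * dot y y).
    by do 2 apply: mulr_gt0 => //; apply: mulr_gt0.
  by rewrite /z1 /z2 /dt /=; rewrite /dot; ring.
rewrite -(pmulr_lle0 _ yy0) side_line2 ha d1 subrr mulr0 subr0 in h1.
rewrite -(pmulr_lle0 _ yy0) side_line hb d2 subrr mulr0 subr0 in h2.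
have {h1} : dt y a <= dt y z1.
  by rewrite -subr_ge0 -(nmulr_rle0 _ (_ : 1 - dot y v' < 0)) //; lra.
have {h2} : dt y z2 <= dt y b.
  by rewrite -subr_le0 -(pmulr_rle0 _ (_ : 0 < dot y v - 1)) //; lra.
move: tz; lra.
Qed.

(** Near the origin [P] contains a point at which [side a b] exceeds [- dt a b], its value at the
    origin. *)
Lemma below_strict P a b y : Po P -> P `<=` below a b -> dot y b < dot y a -> 0 < dt a b.
Proof.
move=> PP Pab yba; have [t [t0 Pp _]] := small_normal y PP.
have := Pab _ Pp; rewrite /below /=.
have -> : side a b (t * - y.2, t * y.1) = t * (dot y a - dot y b) - dt a b.
  by rewrite /side /dt /dot /=; ring.
have : 0 < t * (dot y a - dot y b) by rewrite mulr_gt0 // subr_gt0.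
lra.
Qed.

(** The Plücker relation for the vectors from [a] to the other four points. With [w = v'] it
    transfers to the line [av] what is known about the supporting line [av']. *)
Let plucker a b v w x : side a v x * side a w b =
  side a b x * side a w v + side a w x * side a v b.
Proof. by rewrite /side /dt; ring. Qed.

Variable mu : set pt -> pt.
Hypotheses (muV : is_valuation mu)
  (mu0 : forall a v b, corner a v b -> ear_value mu a v b = 0).

(** Induction on the number of generators cut off. With the chord [ab] and [v] from [chord], the
    polygon cut along [av] has the ear [a v b], and removing this ear gives the cut by [y]. So [y]
    can be replaced by the normal of [av], which cuts off fewer generators: it spares [v]. *)
Lemma valuation_cut s y : Po (conv_hull s) ->
  mu (conv_hull s `&` hps [:: y]) = mu (conv_hull s).
Proof.
move=> PP; have [n] := ubnP (count (fun u => 1 < dot y u) s).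
elim: n y => [//|n IH] y; rewrite ltnS => yn.
have [|/hasPn none] := boolP (has (fun u => 1 < dot y u) s); last first.
  congr mu; apply/seteqP; split=> x; first by case.
  move=> Px; split=> // z; rewrite inE => /eqP->.
  by apply: conv_hull_le Px => u /none; rewrite -leNgt.
move=> /hasP us.
have [a [b [v [v' [vs v's hv hv' [Pa Pb ha hb [ab Pvb Pav]]]]]]] := chord PP us.
have Pv := conv_hull_mem vs.
have yy0 : 0 < dot y y.
  have yy : 0 <= dot y y by rewrite addr_ge0 // -expr2 sqr_ge0.
  rewrite lt_neqAle yy andbT eq_sym paddr_eq0 -?expr2 ?sqr_ge0 // !sqrf_eq0.
  by apply/negP => /andP[/eqP y1 /eqP y2]; move: hv; rewrite /dot y1 y2; lra.
have sab x : side a b x * dot y y = (dt y b - dt y a) * (dot y x - 1).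
  by rewrite side_line ha hb; ring.
have abE x : (side a b x <= 0) = (dot y x <= 1).
  by rewrite -(pmulr_lle0 _ yy0) sab pmulr_rle0 ?subr_gt0 // subr_le0.
have hpsE : hps [:: y] = below a b.
  apply/seteqP; split=> x; rewrite /below /= abE; first by apply; rewrite mem_head.
  by move=> xy z; rewrite inE => /eqP->.
have av' w : 1 < dot y w -> side a w b < 0.
  move=> hw; rewrite -(pmulr_llt0 _ yy0) side_line2 ha hb subrr mulr0 subr0.
  by rewrite nmulr_rlt0 ?subr_gt0 // subr_lt0.
have s1 := av' v' hv'; have s2 := av' v hv.
have s3 : side a v' v <= 0 := Pav v Pv.
have side0 c d : side c d (0, 0) = - dt c d by rewrite /side /dt /=; ring.
have dab : 0 < dt a b.
  rewrite -oppr_lt0 -side0 -(pmulr_llt0 _ yy0) sab pmulr_rlt0 ?subr_gt0 //.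
  by rewrite /dot /=; lra.
have dvb : 0 < dt v b by apply: (below_strict (y := y) PP Pvb); rewrite hb.
have dav' : 0 < dt a v'.
  apply: (below_strict (y := (- y.1, - y.2)) PP Pav).
  by move: ha hv'; rewrite /dot /=; lra.
have dav : 0 < dt a v.
  rewrite -oppr_lt0 -side0 -(nmulr_lgt0 _ s1) plucker !side0.
  rewrite ltr_wpDl //; first by rewrite mulr_le0 // oppr_le0 ltW.
  by rewrite nmulr_rgt0 ?oppr_lt0.
have Pabv x : conv_hull s x -> side a b x <= 0 -> side a v x <= 0.
  move=> Px xab; rewrite leNgt; apply/negP => xav.
  have : side a v x * side a v' b < 0 by rewrite nmulr_llt0.
  rewrite plucker ltNge addr_ge0 //; first exact: mulr_le0.
  by rewrite mulr_le0 ?(ltW s2) //; exact: Pav.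
have C : corner a v b.
  split=> //; rewrite -(pmulr_lgt0 _ yy0) sab mulr_gt0 ?subr_gt0 //.
have PQ := Po_below PP dav.
have E : ear (conv_hull s `&` below a v) a v b.
  split=> x; last by move=> [Px xav]; split=> //; exact: Pvb.
  by move=> Tx; split; [exact: (triangle_sub C PP Pa Pv Pb)|case: Tx].
have := ear_valueE muV C PQ E; rewrite mu0 // => /eqP; rewrite subr_eq0 => /eqP.
have -> : conv_hull s `&` below a v `&` below a b = conv_hull s `&` hps [:: y].
  rewrite hpsE; apply/seteqP; split=> x; first by move=> [[]].
  by move=> [Px xab]; split=> //; split=> //; exact: Pabv.
move=> <-; rewrite below_hps //; apply: IH; apply: leq_trans yn.
set y' := (_, _).
have y'E u : (1 < dot y' u) = (0 < side a v u).
  rewrite !ltNge; congr (~~ _); apply/idP/idP => h.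
    have : hps [:: y'] u by move=> z; rewrite inE => /eqP->.
    by rewrite -below_hps.
  by have : below a v u by []; rewrite below_hps //; apply; rewrite mem_head.
have sub : {in s, forall u, 1 < dot y' u -> 1 < dot y u}.
  move=> u us'; rewrite y'E !ltNge; apply: contra; rewrite -abE => h.
  by apply: Pabv => //; exact: conv_hull_mem.
have nv : ~~ (1 < dot y' v).
  by rewrite y'E (_ : side a v v = 0) ?ltxx // /side /dt; ring.
exact: count_lt sub vs hv nv.
Qed.

End Constancy.

(** * The classification *)

Section Classification.
Variable R : realType.
Local Notation pt := (R * R)%type.
Local Notation mR := (measurableTypeR R).
Implicit Types (P Q K L : set pt) (mu nu : set pt -> pt) (k : R).

Lemma valuation_zero mu : is_valuation mu -> SL2_covariant mu ->
  (forall a v b, corner a v b -> ear_value mu a v b = 0) ->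
  forall P, Po P -> mu P = 0.
Proof.
move=> muV muC mu0.
have cut P ys : Po P -> mu (P `&` hps ys) = mu P.
  move=> PP; elim: ys => [|y ys IH].
    by congr mu; apply/seteqP; split=> [x []//|x Px]; split.
  rewrite -cat1s hpsI [hps [:: y] `&` _]setIC setIA -IH.
  have PI := Po_cap_hps ys PP; have [s sE] := PI.1.
  by rewrite sE in PI *; exact: valuation_cut.
have const P Q : Po P -> Po Q -> mu P = mu Q.
  move=> PP PQ; have [ys [_ [QE _]]] := (PoP Q).1 PQ; have [zs [_ [PE _]]] := (PoP P).1 PP.
  by rewrite -(cut P ys PP) -(cut Q zs PQ) -QE -PE setIC.
move=> P PP; have d1 : \det (- 1%:M : 'M[R]_2) = 1.
  by rewrite -scaleN1r detZ det1 mulr1 sqrrN expr1n.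
have := muC _ P d1 PP; rewrite (const _ P (Po_mxact d1 PP) PP) => e.
have [e1 e2] : (mu P).1 = - (mu P).1 /\ (mu P).2 = - (mu P).2.
  by rewrite {1 3}e /mxact !mxE /=; split; ring.
by rewrite [mu P]surjective_pairing; congr pair; lra.
Qed.

Definition admissible mu := [/\ is_valuation mu, SL2_covariant mu & cut_measurable mu].

(** The three determinants of this corner are 1, so its value consists of [f 1 1 1] and
    [g 1 1 1]. *)
Lemma ear_value_rigidity mu : admissible mu ->
  ear_value mu (1, 0) (1, 1) (0, 1) = 0 -> forall P, Po P -> mu P = 0.
Proof.
move=> [muV muC mm] e0; apply: valuation_zero => // a v b C.
have [l [l' fgl]] := ear_profile muV muC mm.
have f1 : earf mu 1 1 1 = 0 by rewrite /earf divr1 e0 mulr0.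
have g1 : earg mu 1 1 1 = 0 by rewrite /earg divr1 e0.
have H := profile_rigidity (ear_cut_additive muV muC)
  (ear_cut_additive_mirror muV muC) fgl f1 g1.
rewrite (ear_value_coord muV muC C); have [p0 q0 r0 d0] := C.
have rpq : dt a b < dt a v + dt v b by move: d0; rewrite /side; lra.
have [-> ->] := H _ _ _ p0 q0 r0 rpq.
by rewrite !mul0r !addr0 !mul0r.
Qed.

Definition comb k mu l nu P := vadd (vscale k (mu P)) (vscale l (nu P)).

Lemma comb_valuation k mu l nu : is_valuation mu -> is_valuation nu ->
  is_valuation (comb k mu l nu).
Proof.
move=> muV nuV K L PK PL PU PI.
have [m1 m2] : (mu (K `|` L)).1 + (mu (K `&` L)).1 = (mu K).1 + (mu L).1 /\
    (mu (K `|` L)).2 + (mu (K `&` L)).2 = (mu K).2 + (mu L).2.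
  by have [] := muV K L PK PL PU PI.
have [n1 n2] : (nu (K `|` L)).1 + (nu (K `&` L)).1 = (nu K).1 + (nu L).1 /\
    (nu (K `|` L)).2 + (nu (K `&` L)).2 = (nu K).2 + (nu L).2.
  by have [] := nuV K L PK PL PU PI.
rewrite /comb /vadd /vscale /=; congr pair.
  by rewrite addrACA -!mulrDr m1 n1; ring.
by rewrite addrACA -!mulrDr m2 n2; ring.
Qed.

Lemma comb_covariant k mu l nu : SL2_covariant mu -> SL2_covariant nu ->
  SL2_covariant (comb k mu l nu).
Proof.
move=> muC nuC A P dA PP; rewrite /comb muC // nuC // /mxact /vadd /vscale /=.
by congr pair; ring.
Qed.

Lemma comb_cut_measurable k mu l nu : cut_measurable mu -> cut_measurable nu ->
  cut_measurable (comb k mu l nu).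
Proof.
move=> mm mn P y z PP cut; have [m1 m2] := mm P y z PP; have [n1 n2] := mn P y z PP.
by split; apply: measurable_funD; apply: measurable_funM.
Qed.

Lemma comb_admissible k mu l nu : admissible mu -> admissible nu ->
  admissible (comb k mu l nu).
Proof.
move=> [? ? ?] [? ? ?]; split; [exact: comb_valuation|exact: comb_covariant|].
exact: comb_cut_measurable.
Qed.

Lemma ear_value_comb k mu l nu a v b :
  ear_value (comb k mu l nu) a v b =
  vadd (vscale k (ear_value mu a v b)) (vscale l (ear_value nu a v b)).
Proof.
by rewrite [LHS]surjective_pairing /ear_value /comb /vadd /vscale /=; congr pair; ring.
Qed.

(** * The moment and the rotated polar moment are admissible and independent *)

Definition polar_moment P : pt := rot90 (moment (polar P)).

Let Po_segment_closed P x z t0 : Po P ->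
  (forall e, 0 < e -> exists2 t, `|t0 - t| <= e & P (mix t x z)) -> P (mix t0 x z).
Proof.
move=> /PoP[ys [M [-> _]]] H y yy; pose c := dot y z - dot y x.
have E t : dot y (mix t0 x z) = dot y (mix t x z) + (t0 - t) * c.
  by rewrite /c /dot /mix /=; ring.
apply/ler_addgt0Pr => e e0; have c0 : 0 < `|c| + 1 by rewrite ltr_wpDl.
have [|t tt Pt] := H (e / (`|c| + 1)); first exact: divr_gt0.
rewrite (E t) lerD //; first exact: Pt.
apply: (le_trans (ler_norm _)); rewrite normrM.
apply: (le_trans (ler_wpM2r (normr_ge0 c) tt)).
by rewrite mulrAC ler_pdivrMr // ler_pM2l // lerDl.
Qed.

Lemma polar_setU K L : polar (K `|` L) = polar K `&` polar L.
Proof.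
apply/seteqP; split=> y H; first by split=> x Kx; apply: H; [left|right].
by case: H => yK yL x [/yK|/yL].
Qed.

(* If [y] separates some [k] in [K] and some [l] in [L] from the origin, then
   the segment [kl] meets the closed sets [K] and [L], which cover it, in a
   common point, and [y] cuts that point off too. *)
Lemma polar_setI K L : Po K -> Po L -> Po (K `|` L) ->
  polar (K `&` L) = polar K `|` polar L.
Proof.
move=> PK PL PU; apply/seteqP; split=> y; last first.
  by move=> [H|H] x [Kx Lx]; apply: H.
move=> H; apply: contrapT => /not_orP[nK nL].
have [x Kx yx] : exists2 x, K x & 1 < dot y x.
  apply: contrapT => n; apply: nK => x Kx; rewrite leNgt; apply/negP => h; apply: n.
  by exists x.
have [z Lz yz] : exists2 z, L z & 1 < dot y z.
  apply: contrapT => n; apply: nL => z Lz; rewrite leNgt; apply/negP => h; apply: n.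
  by exists z.
pose T := [set t : R | 0 <= t <= 1 /\ K (mix t x z)].
have mix0 : mix 0 x z = x by rewrite [RHS]surjective_pairing /mix; congr pair; ring.
have mix1 : mix 1 x z = z by rewrite [RHS]surjective_pairing /mix; congr pair; ring.
have T0 : T 0 by rewrite /T /= mix0 lexx ler01.
have Tsup : has_sup T by split; [exists 0|exists 1 => t [/andP[]]].
pose t0 := sup T.
have t00 : 0 <= t0 by apply: ub_le_sup => //; case: Tsup.
have t01 : t0 <= 1 by apply: ge_sup; [exists 0|move=> t [/andP[]]].
have Kt0 : K (mix t0 x z).
  apply: Po_segment_closed => // e e0; have [t [t1 Kt] tt] := sup_adherent e0 Tsup.
  have tt0 : t <= t0 by apply: ub_le_sup => //; case: Tsup.
  by exists t => //; rewrite ger0_norm ?subr_ge0 //; move: tt; rewrite -/t0; lra.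
have Lt0 : L (mix t0 x z).
  apply: Po_segment_closed => // e e0.
  have [t1|t1] := leP 1 t0.
    exists 1; last by rewrite mix1.
    have -> : t0 = 1 by apply/le_anti; rewrite t01.
    by rewrite subrr normr0 ltW.
  pose t := Num.min 1 (t0 + e); have t0t : t0 < t by rewrite lt_min t1 ltrDl.
  have [te tl] : t <= t0 + e /\ t <= 1 by rewrite !ge_min !lexx orbT.
  exists t; first by rewrite distrC ger0_norm; lra.
  have k01 : 0 <= 1 - t <= 1 by apply/andP; split; lra.
  have : (K `|` L) (mix t x z).
    have := Po_convex PU (or_introl Kx : (K `|` L) x) (or_intror Lz : (K `|` L) z) k01.
    by rewrite subKr.
  case=> // Kt; exfalso; suff : t <= t0 by lra.
  by apply: ub_le_sup; [case: Tsup|split=> //; apply/andP; split; lra].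
have := H _ (conj Kt0 Lt0).
have -> : dot y (mix t0 x z) = (1 - t0) * dot y x + t0 * dot y z.
  by rewrite /dot /mix /=; ring.
have t0' : 0 <= 1 - t0 by lra.
have := ler_wpM2l t0' (ltW yx); have := ler_wpM2l t00 (ltW yz).
have [t1|t1] := ltP t0 1.
  by have : (1 - t0) * 1 < (1 - t0) * dot y x by [rewrite ltr_pM2l // subr_gt0]; lra.
have -> : t0 = 1 by apply/le_anti; rewrite t01.
lra.
Qed.

Lemma moment_is_valuation : is_valuation (@moment R).
Proof.
move=> K L PK PL _ _; have [M [_ KM]] := Po_bounded PK; have [N [_ LN]] := Po_bounded PL.
have mono (M1 M2 : R) : M1 <= M2 -> (pbox M1 : set pt) `<=` pbox M2.
  by move=> le x [x1 x2]; split; [exact: le_trans x1 le|exact: le_trans x2 le].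
apply: (@moment_valuation R K L (Num.max M N)); try exact: Po_measurable_set.
- by apply: subset_trans KM _; apply: mono; rewrite le_max lexx.
- by apply: subset_trans LN _; apply: mono; rewrite le_max lexx orbT.
Qed.

Lemma polar_moment_is_valuation : is_valuation polar_moment.
Proof.
move=> K L PK PL PU PI; rewrite /polar_moment polar_setU polar_setI //.
have [PKs PLs] := (Po_polar PK, Po_polar PL).
have := moment_is_valuation PKs PLs.
rewrite -polar_setI // -polar_setU => /(_ (Po_polar PI) (Po_polar PU)).
rewrite /vadd /rot90 => -[e1 e2]; congr pair => /=.
  by rewrite -!opprD addrC e2.
by rewrite addrC e1.
Qed.

Lemma moment_covariant : SL2_covariant (@moment R).
Proof.
move=> A P dA PP; have [M [_ PM]] := Po_bounded PP.
exact: moment_mxact dA (Po_measurable_set PP) PM.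
Qed.

Lemma polar_moment_covariant : SL2_covariant polar_moment.
Proof.
move=> A P dA PP; rewrite /polar_moment polar_mxact //.
have uA : A \in unitmx by rewrite unitmxE dA unitr1.
have dB : \det (invmx A)^T = 1 by rewrite det_tr det_inv dA invr1.
rewrite (moment_covariant dB (Po_polar PP)); move: (moment _) => w.
have J z : mxact A (rot90 (mxact A^T z)) = rot90 z.
  have := det_mx2 A; rewrite dA => d; rewrite /mxact /rot90 !mxE /=.
  rewrite [z in RHS]surjective_pairing /=; congr pair.
    by rewrite -[z.2 in RHS]mul1r d; ring.
  by rewrite -[z.1 in RHS]mul1r d; ring.
by rewrite -J -mxactM -trmx_mul mulVmx // trmx1 mxact1.
Qed.

Lemma moment_Po_measurable k l : Po_measurable (comb k (@moment R) l polar_moment).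
Proof.
have [c1 c2] := Po_continuous_moment R.
have p1 := Po_continuous_polar c1; have p2 := Po_continuous_polar c2.
apply: Po_continuous_measurable.
  have := Po_continuous_linear k (- l) c1 p2.
  congr Po_continuous; apply/funext => P; rewrite /comb /vadd /vscale /polar_moment /=; ring.
exact: (Po_continuous_linear k l c2 p1).
Qed.

Let comb10 mu nu : comb 1 mu 0 nu = mu.
Proof.
apply/funext => P; rewrite /comb /vadd /vscale [RHS]surjective_pairing /=.
by congr pair; ring.
Qed.

Let comb01 mu nu : comb 0 mu 1 nu = nu.
Proof.
apply/funext => P; rewrite /comb /vadd /vscale [RHS]surjective_pairing /=.
by congr pair; ring.
Qed.

Lemma moment_admissible : admissible (@moment R).
Proof.
split; [exact: moment_is_valuation|exact: moment_covariant|move=> P y z PP].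
by apply: Po_measurable_cut => //; rewrite -(comb10 (@moment R) polar_moment); exact: moment_Po_measurable.
Qed.

Lemma polar_moment_admissible : admissible polar_moment.
Proof.
split; [exact: polar_moment_is_valuation|exact: polar_moment_covariant|move=> P y z PP].
by apply: Po_measurable_cut => //; rewrite -(comb01 (@moment R) polar_moment); exact: moment_Po_measurable.
Qed.

(** By [moment_grows] the two rectangles have different moments, so one of them is nonzero. *)
Lemma exists_moment_neq0 : exists2 P, Po P & moment P != 0 :> pt.
Proof.
pose P : set pt := `[-1, 2] `*` `[-1, 1]; pose I : set pt := `[-1, 1] `*` `[-1, 1].
have PI : Po I.
  by rewrite /I -pboxE; exact: Po_pbox.
have PP : Po P.
  have rectP x : P x <-> [/\ -1 <= x.1, x.1 <= 2, -1 <= x.2 & x.2 <= 1].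
    rewrite /P /setX /= !in_itv /=.
    by split=> [[/andP[? ?] /andP[? ?]]|[-> -> -> ->]].
  apply/PoP; exists [:: (2^-1, 0); (-1, 0); (0, 1); (0, -1)], 2; split; last first.
    by move=> x /rectP[? ? ? ?]; split; rewrite ler_norml; apply/andP; split; lra.
  apply/seteqP; split=> x.
    by move=> /rectP[? ? ? ?] y; rewrite !inE => /or4P[] /eqP->; rewrite /dot /=; lra.
  move=> h; apply/rectP.
  have := h (2^-1, 0) ltac:(by rewrite !inE eqxx ?orbT).
  have := h (-1, 0) ltac:(by rewrite !inE eqxx ?orbT).
  have := h (0, 1) ltac:(by rewrite !inE eqxx ?orbT).
  have := h (0, -1) ltac:(by rewrite !inE eqxx ?orbT).
  by rewrite /dot /= => *; split; lra.
have := moment_grows R; rewrite -/P -/I => g.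
have [e|] := eqVneq (moment P) 0; last by exists P.
exists I => //; apply: contraTneq g => e'.
by rewrite e e' subrr ltxx.
Qed.

Lemma polar_vscale P k : 0 < k -> polar (vscale k @` P) = vscale k^-1 @` polar P.
Proof.
move=> k0; have kN := lt0r_neq0 k0; apply/seteqP; split=> y H.
  apply/vscaleP; rewrite ?invr_gt0 // invrK => x Px.
  have := H (vscale k x) (ex_intro2 _ _ x Px erefl).
  by congr (_ <= _); rewrite /dot /vscale /=; ring.
move: H => /vscaleP; rewrite invr_gt0 invrK => /(_ k0) H _ [x Px <-].
by have := H x Px; congr (_ <= _); rewrite /dot /vscale /=; ring.
Qed.

(* The two moments scale with different powers of 2 under dilation by 2. *)
Lemma moments_independent k l :
  (forall P, Po P -> comb k (@moment R) l polar_moment P = 0) -> k = 0 /\ l = 0.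
Proof.
move=> H; have two0 : 0 < 2 :> R by [].
have sep P : Po P -> vscale k (moment P) = 0 /\ vscale l (moment (polar P)) = 0.
  move=> PP; have PP2 := Po_vscale two0 PP.
  have [M [_ PM]] := Po_bounded PP; have [N [_ PN]] := Po_bounded (Po_polar PP).
  have h0 : 0 < 2^-1 :> R by rewrite invr_gt0.
  have := H _ PP2; rewrite /comb /polar_moment polar_vscale //.
  rewrite (moment_vscale two0 (Po_measurable_set PP) PM).
  rewrite (moment_vscale h0 (Po_measurable_set (Po_polar PP)) PN).
  have := H _ PP; rewrite /comb /polar_moment /vadd /vscale /rot90 /=.
  move=> [e1 e2] [e3 e4].
  by split; congr pair; rewrite exprVn in e3 e4; lra.
have [P PP P0] := exists_moment_neq0.
have nz (c : R) : vscale c (moment P) = 0 -> c = 0.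
  move: (moment P) P0 => [x1 x2] x0 [e1 e2]; apply/eqP; apply: contraTT x0 => c0.
  rewrite negbK; move/eqP: e1; move/eqP: e2; rewrite !mulf_eq0 (negPf c0) /=.
  by move=> /eqP-> /eqP->.
(* For [l], the relation is taken at the polar of [P], whose polar is [P] again. *)
have [k0 _] := sep P PP; have [_ l0] := sep _ (Po_polar PP).
by rewrite polarK // in l0; split; exact: nz.
Qed.

End Classification.

(** * Plane linear algebra and the conclusion *)

Lemma dt_neq0 (R : realType) (u w : R * R) :
  (forall k l, vadd (vscale k u) (vscale l w) = 0 -> k = 0 /\ l = 0) -> dt u w != 0.
Proof.
case: u w => [u1 u2] [w1 w2] dep; apply/eqP; rewrite /dt /= => d.
(* If the determinant is 0, the coefficients [(w1, - u1)] and [(w2, - u2)] both give linear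
   relations, so [u = w = 0]; then [(1, 0)] gives one too. *)
have [w10 u10] : w1 = 0 /\ - u1 = 0.
  by apply: dep; rewrite /vadd /vscale /=; congr pair; lra.
have [w20 u20] : w2 = 0 /\ - u2 = 0.
  by apply: dep; rewrite /vadd /vscale /=; congr pair; lra.
have [] : (1 : R) = 0 /\ (0 : R) = 0.
  by apply: dep; rewrite /vadd /vscale /=; congr pair; lra.
by move/eqP; rewrite oner_eq0.
Qed.

Lemma cramer (R : realType) (u w e : R * R) : dt u w != 0 ->
  vadd (vscale 1 e) (vscale (-1)
    (vadd (vscale (dt e w / dt u w) u) (vscale (dt u e / dt u w) w))) = 0.
Proof.
case: u w e => [u1 u2] [w1 w2] [e1 e2]; rewrite /vadd /vscale /dt /= => duw.
by congr pair; field.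
Qed.

Theorem theorem1p3 (R : realType) (mu : set (R * R) -> R * R) :
  (Po_measurable mu /\ is_valuation mu /\ SL2_covariant mu) <->
  (exists k1 k2 : R, forall P : set (R * R), Po P ->
     mu P = vadd (vscale k1 (moment P)) (vscale k2 (rot90 (moment (polar P))))).
Proof.
split=> [[muM [muV muC]]|[k1 [k2 muE]]]; last first.
  have muE' P : Po P -> mu P = comb k1 (@moment R) k2 (@polar_moment R) P by exact: muE.
  have [mV mC _] := moment_admissible R; have [pV pC _] := polar_moment_admissible R.
  split; [|split].
  - move=> B mB; have := moment_Po_measurable k1 k2 mB; congr Po_borel.
    by apply/seteqP; split=> P [PP]; rewrite /preimage /= muE'.
  - move=> K L PK PL PU PI; rewrite !muE' //.
    exact: comb_valuation.
  - move=> A P dA PP; rewrite !muE' //; last exact: Po_mxact.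
    exact: comb_covariant.
have muA : admissible mu by split=> // P y z PP; exact: Po_measurable_cut.
have mA := moment_admissible R; have pA := polar_moment_admissible R.
pose u := ear_value (@moment R) (1, 0) (1, 1) (0, 1).
pose w := ear_value (@polar_moment R) (1, 0) (1, 1) (0, 1).
pose e := ear_value mu (1, 0) (1, 1) (0, 1).
(* The vectors [u] and [w] remain uncomputed: by rigidity, a relation between them would hold
   between the two moments on every polygon. *)
have dep k l : vadd (vscale k u) (vscale l w) = 0 -> k = 0 /\ l = 0.
  rewrite /u /w -ear_value_comb => h; apply: moments_independent => P PP.
  exact: ear_value_rigidity (comb_admissible k l mA pA) h P PP.
have duw := dt_neq0 dep.
exists (dt e w / dt u w), (dt u e / dt u w) => P PP.
pose nu := comb 1 mu (-1) (comb (dt e w / dt u w) (@moment R) (dt u e / dt u w) (@polar_moment R)).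
have nuA : admissible nu by exact: comb_admissible muA (comb_admissible _ _ mA pA).
have nu0 : nu P = 0.
  apply: (ear_value_rigidity nuA) => //; rewrite /nu !ear_value_comb -/u -/w -/e.
  exact: cramer.
move: nu0; rewrite /nu /comb /vadd /vscale /polar_moment => -[e1 e2].
by rewrite [mu P]surjective_pairing; congr pair; move: e1 e2; rewrite /=; lra.
Qed.
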